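(* Let $d\ge 3$ be an integer and let $\alpha,\beta\in(0,1)$. Put $$C=40d+104\cdot 2^d-51,\qquad K=\frac{480}{\log(3/2)}+\frac{16}{\log 2}<1207 .$$ Then for every $L\in\mathbb N$ with $$L>\max\left\{\left(\frac{C}{\beta}+1\right)^2,\ \left(\bigl(\log(2/\alpha)\,K\bigr)^{2/(d-2)}+1\right)^2,\ 16\right\}$$ one has $$\sup_{\mu}\ \mathbb P_\mu\left\{\omega\in\mathbb R^{\mathbb Z^d} : \ \bigl\|N_\omega^{\Lambda_L}-N_\mu\bigr\|_\infty>\beta\right\}<\alpha ,$$ where the supremum is taken over all Borel probability measures $\mu$ on $\mathbb R$ with bounded support, $\mathbb P_\mu=\bigotimes_{\mathbb Z^d}\mu$, $N_\omega^{\Lambda_L}$ is the normalized eigenvalue counting function of the Anderson operator compressed to $\Lambda_L$, and $N_\mu$ is the integrated density of states of the Anderson operator under $\mathbb P_\mu$.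
   Context: $\log$ is the natural logarithm. For a real function $g$ on $\mathbb R$, $\|g\|_\infty=\sup_{E\in\mathbb R}|g(E)|$. For $\omega=(\omega_k)_{k\in\mathbb Z^d}\in\mathbb R^{\mathbb Z^d}$ the Anderson operator on $\ell^2(\mathbb Z^d)$ is $H_\omega=-\Delta+V_\omega$, $$(H_\omega\psi)(x)=\sum_{y\in\mathbb Z^d:\,|y-x|=1}(\psi(x)-\psi(y))+\omega_x\psi(x).$$ Under $\mathbb P_\mu=\bigotimes_{\mathbb Z^d}\mu$ the coordinates $\omega_k$ are i.i.d. with distribution $\mu$. For a finite set $\Lambda\subset\mathbb Z^d$ the compression is $H_\omega^\Lambda=p_\Lambda H_\omega i_\Lambda:\ell^2(\Lambda)\to\ell^2(\Lambda)$, where $i_\Lambda:\ell^2(\Lambda)\to\ell^2(\mathbb Z^d)$ is extension by zero and $p_\Lambda:\ell^2(\mathbb Z^d)\to\ell^2(\Lambda)$ is restriction. $\Lambda_L$ denotes the lattice cube $[-L/2,L/2)^d\cap\mathbb Z^d$. The normalized eigenvalue counting function is $$N_\omega^{\Lambda_L}(E)=\frac{\#\{\text{eigenvalues of }H_\omega^{\Lambda_L}\text{ that are}\le E\}}{|\Lambda_L|},\quad E\in\mathbb R,$$ with eigenvalues counted with multiplicity. The integrated density of states (IDS) is $$N_\mu(E)=\mathbb E_\mu\left[\langle\delta_0,\mathbf 1_{(-\infty,E]}(H_\omega)\delta_0\rangle\right],\quad E\in\mathbb R,$$ (where $\mathbb E_\mu$ is expectation with respect to $\mathbb P_\mu$),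 which also equals the $\mathbb P_\mu$-almost sure limit of $N_\omega^{\Lambda_L}(E)$ as $L\to\infty$ (at least at continuity points $E$). *)

(* Defs.v *)
From HB Require Import structures.
From mathcomp Require Import all_boot all_order all_algebra finmap.
From mathcomp Require Import all_classical all_reals all_analysis.
Import Order.TTheory GRing.Theory Num.Theory.
Import numFieldNormedType.Exports.

Set Implicit Arguments.
Unset Strict Implicit.
Unset Printing Implicit Defensive.

Local Open Scope classical_set_scope.
Local Open Scope ring_scope.

Notation Zd d := 'rV[int]_d.

Section Lattice.
Variables (R : realType) (d : nat).

Definition nearest_neighbours (x y : Zd d) : Prop := \sum_(i < d) `|y 0 i - x 0 i| = 1.

Definition cube (L : nat) : {fset Zd d} :=
  fset_set [set x : Zd d | forall i : 'I_d,
    (- (L%:R / 2) <= (x 0 i)%:~R :> R) && ((x 0 i)%:~R < L%:R / 2 :> R)].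

Definition delta0 : Zd d -> R := fun x => (x == 0)%:R.

(* The sum over [y] ranges over the 2d nearest neighbours of [x], so the
   formula makes sense for every function [psi] and every potential [om]. *)
Definition anderson (om psi : Zd d -> R) : Zd d -> R := fun x =>
  \sum_(y \in [set y | nearest_neighbours x y]) (psi x - psi y) + om x * psi x.

End Lattice.

Section Hilbert.
Variables (R : realType) (T : choiceType).
Implicit Types phi psi : T -> R.

Definition l2 psi : Prop := summable [set: T] (fun x => (psi x ^+ 2)%:E).

(* [\esum] only handles nonnegative families, hence the splitting into positive
   and negative parts; for [phi], [psi] in l^2 both sums are finite. *)
Definition inner phi psi : R :=
  let f := fun x => (phi x * psi x)%:E in
  fine (\esum_(x in [set: T]) (f^\+ x)%E) - fine (\esum_(x in [set: T]) (f^\- x)%E).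

Definition orthogonal_projection (Q : (T -> R) -> (T -> R)) : Prop :=
  [/\ forall psi, l2 psi -> l2 (Q psi),
      forall a phi psi, l2 phi -> l2 psi ->
        Q (fun x => a * phi x + psi x) = (fun x => a * Q phi x + Q psi x),
      forall psi, l2 psi -> Q (Q psi) = Q psi &
      forall phi psi, l2 phi -> l2 psi -> inner phi (Q psi) = inner (Q phi) psi].

(* [Q E] is the spectral projection 1_(-oo, E](H) of the (possibly unbounded)
   self-adjoint operator [H] with domain {psi in l^2 | H psi in l^2}: [Q] is the
   resolution of the identity such that H = \int x dQ(x).  Here [nu] is the
   spectral measure of [H] at [psi]; the domain of \int x dQ(x) consists of the
   [psi] such that \int x^2 dnu(x) is finite. *)
Definition spectral_resolution (H : (T -> R) -> (T -> R))
    (Q : R -> (T -> R) -> (T -> R)) : Prop :=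
  [/\ forall E, orthogonal_projection (Q E),
      forall E E' psi, E <= E' -> l2 psi -> Q E (Q E' psi) = Q E psi &
      forall psi, l2 psi ->
        exists nu : {measure set (measurableTypeR R) -> \bar R},
          [/\ nu setT = (inner psi psi)%:E,
              forall E, nu `]-oo, E]%classic = (inner psi (Q E psi))%:E,
              l2 (H psi) <-> (\int[nu]_x (x ^+ 2)%:E < +oo)%E &
              l2 (H psi) -> (\int[nu]_x x%:E = (inner psi (H psi))%:E)%E]].

End Hilbert.

Section EigenvalueCounting.
Variables (R : realType) (d : nat).

Definition extend0 (La : {fset Zd d}) (psi : {ffun La -> R^o}) : Zd d -> R :=
  fun x => if insub x is Some y then psi y else 0.

Definition compression (H : (Zd d -> R) -> (Zd d -> R)) (La : {fset Zd d}) :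
    'End({ffun La -> R^o}) :=
  linfun (fun psi : {ffun La -> R^o} =>
    [ffun x : La => H (extend0 psi) (val x)] : {ffun La -> R^o}).

(* The sum is finitely supported: only eigenvalues contribute. *)
Definition count_eigenvalues (vT : vectType R) (f : 'End(vT)) (E : R) : nat :=
  \sum_(a \in [set a : R | a <= E]) \dim (passmx.leigenspace f a).

Definition N_counting (om : Zd d -> R) (L : nat) (E : R) : R :=
  (count_eigenvalues (compression (anderson om) (cube R d L)) E)%:R
  / #|` cube R d L|%:R.

End EigenvalueCounting.

Section Probability.
Variables (R : realType) (d : nat).

Definition coordinate_cylinders : set (set (Zd d -> R)) :=
  [set A | exists k (B : set (measurableTypeR R)),
     measurable B /\ A = [set om | B (om k)]].

Definition config := g_sigma_algebraType coordinate_cylinders.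

(* [P] is the product of copies of [mu]; this determines [P] since the finite
   dimensional cylinders generate the product sigma-algebra. *)
Definition product_law (mu : probability (measurableTypeR R) R)
    (P : probability config R) : Prop :=
  forall (F : {fset Zd d}) (B : Zd d -> set (measurableTypeR R)),
    (forall k, measurable (B k)) ->
    P [set om | forall k, k \in F -> B k (om k)] = (\prod_(k <- F) mu (B k))%E.

Definition topological_support (mu : probability (measurableTypeR R) R) : set R :=
  [set x | forall e : R, 0 < e -> (0 < mu (ball x e))%E].

Definition boundedly_supported (mu : probability (measurableTypeR R) R) : Prop :=
  bounded_set (topological_support mu : set R^o).

(* The family [Q om] exists and is unique for every [om] by the spectral theorem. *)
Definition is_IDS (P : probability config R) (N : R -> R) : Prop :=
  exists2 Q : (Zd d -> R) -> R -> (Zd d -> R) -> (Zd d -> R),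
    forall om, spectral_resolution (anderson om) (Q om) &
    forall E, ((N E)%:E =
      'E_P[fun om : config => inner (@delta0 R d) (Q om E (@delta0 R d))])%E.

End Probability.

Definition sup_norm (R : realType) (g : R -> R) : \bar R :=
  ereal_sup [set `|g E|%:E | E in [set: R]].

Definition constC (R : realType) (d : nat) : R := 40 * d%:R + 104 * 2 ^+ d - 51.

Definition constK (R : realType) : R := 480 / ln (3 / 2) + 16 / ln 2.

(* Main.v *)
(* Write [l = m - 1] with [m^2 <= L < (m + 1)^2] and let [f] be the mean normalized
   counting function of a box of side [l].  Cutting a large box into boxes of side
   [l] separated by walls of width 1 decouples them, and by Cauchy interlacing
   moves the normalized counting function by at most the proportion of deleted
   sites.  Hence [|N_mu - f| <= d / m], uniformly in the energy and in [mu], where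
   the IDS is reached from finite volume through polynomials approximating
   indicators of half-lines, and the counting function of the cube of side [L] is
   within [2 d / m] of the average [A] over at least [m^d] independent boxes.
   Since [constC / m < beta] and [constC >= 800 + 3 d], it is enough to bound the
   probability that [|A - f| > 800 / m] somewhere.  By monotonicity only [2 m]
   energies matter, and at each of them Chernoff's bound gives a tail
   [exp (- 20000 m^(d - 2))]. *)
Require Import Defs.
From HB Require Import structures.
From mathcomp Require Import complex.
From mathcomp Require Import all_boot all_order all_algebra finmap.
From mathcomp Require Import all_classical all_reals all_analysis.
From mathcomp Require Import measurable_realfun.
From mathcomp Require Import ring lra zify.
Import Order.TTheory GRing.Theory Num.Theory.
Import numFieldNormedType.Exports.

Set Implicit Arguments.
Unset Strict Implicit.
Unset Printing Implicit Defensive.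

Local Open Scope classical_set_scope.
Local Open Scope ring_scope.

(** * Spectral theorem and Cauchy interlacing for real symmetric matrices *)

Section SymmetricSpectrum.
Variable R : rcfType.
Local Notation C := R[i].
Local Notation toC := (real_complex R).
Local Notation "M ^*t" := (map_mx (@Num.conj C) (M^T)) (at level 1).

(** The density of states is accessible only through an abstract resolution of the identity:
    projections whose spectral measures reproduce diagonal forms of [H], with neither a functional
    calculus nor measurability in [om]. Polynomials of [H] are the bridge. Their matrix elements are
    finite sums over hopping paths, hence measurable, local and covariant under translations, and by
    stationarity their mean at the origin is a trace per site up to boundary terms. That [H^k]
    agrees with the spectral measure is shown by replacing one factor [H] at a time by a step
    function of the projections, polarization supplying the off-diagonal forms. Since eigenvalue
    counts jump, the approximating polynomials have to converge at the threshold itself. The scale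
    [m], about the square root of [L], balances the walls, a proportion of order 1/m, against the
    remainder of the division of [L] by [m], of order m/L. Deviations of order 1/m over m^d
    independent boxes give an exponent of order m^d / m^2, which grows because d >= 3. The support
    of [mu] enters only through an almost sure bound on the potential, which is absent from the
    final estimates; this gives uniformity in [mu]. *)

Definition diagonalizes n (A : 'M[R]_n) (P : 'M[C]_n) (lam : 'I_n -> R) :=
  [/\ P *m P^*t = 1%:M, P^*t *m P = 1%:M &
      map_mx toC A = P^*t *m diag_mx (\row_j (lam j)%:C%C) *m P].

(** The matrix is regarded as a complex Hermitian one: the unitary matrix may be complex, but the
    eigenvalues are real. *)
Lemma symmetric_diagonalizes n (A : 'M[R]_n) :
  A^T = A -> exists P lam, diagonalizes A P lam.
Proof.
move=> symA; set B := map_mx toC A.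
have conjB : map_mx (@Num.conj C) B = B.
  by apply/matrixP => i j; rewrite !mxE; apply: conjc_real.
have hB : B \is hermsymmx.
  have BT : B^T = B by rewrite /B map_trmx symA.
  by apply/is_hermitianmxP; rewrite expr0 scale1r BT conjB.
have Dreal := hermitian_spectral_diag_real hB.
have /orthomx_spectralP eB := hermitian_normalmx hB.
have uP := spectral_unitarymx B.
move: (spectralmx B) (spectral_diag B) uP Dreal eB => P D uP /mxOverP Dreal eB.
exists P, (fun j => complex.Re (D 0 j)).
have e1 : P *m P^*t = 1%:M by move/unitarymxP: uP.
split=> //; first exact: mulmx1C.
have eD : \row_j (complex.Re (D 0 j))%:C%C = D.
  by apply/rowP => j; rewrite !mxE RRe_real.
by rewrite eD -/B eB invmx_unitary.
Qed.

Lemma rank_diag_le (F : fieldType) n (d : 'rV[F]_n) :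
  (\rank (diag_mx d) <= #|[pred i | d ord0 i != 0%R]|)%N.
Proof.
set Q := [pred i | _]; pose f := @enum_val _ Q.
have -> : diag_mx d = colsub f (diag_mx d) *m rowsub f 1%:M.
  apply/matrixP => i j; rewrite !mxE.
  have [Qj|nQj] := boolP (j \in Q); last first.
    have dj : d 0 j = 0 by move: nQj; rewrite inE negbK => /eqP.
    rewrite big1 => [|k _].
      by case: eqP => [->|]; rewrite ?mulr0n // dj mul0rn.
    rewrite !mxE; case: (f k =P j) => [e|]; rewrite ?mulr0 //.
    by move: nQj; rewrite -e enum_valP.
  rewrite (bigD1 (enum_rank_in Qj j)) //= !mxE /f enum_rankK_in // eqxx mulr1.
  rewrite big1 ?addr0 // => k nk; rewrite !mxE.
  case: (enum_val k =P j) => [e|]; rewrite ?mulr0 //.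
  case/eqP: nk; apply: enum_val_inj; by rewrite enum_rankK_in.
exact: leq_trans (mxrankM_maxl _ _) (rank_leq_col _).
Qed.

Lemma rank_diag (F : fieldType) n (d : 'rV[F]_n) :
  \rank (diag_mx d) = #|[pred i | d ord0 i != 0%R]|.
Proof.
apply/eqP; rewrite eqn_leq rank_diag_le /=.
(* [d'] is 1 exactly where [d] vanishes, so [d + d'] has no zero entry and the two ranks add up to
   at least n. The upper bound on the rank of [d'] thus becomes a lower bound on that of [d]. *)
pose d' : 'rV[F]_n := \row_j (d ord0 j == 0)%:R.
have h : (n <= \rank (diag_mx d) + \rank (diag_mx d'))%N.
  rewrite -[X in (X <= _)%N](mxrank1 F n).
  have -> : 1%:M = invmx (diag_mx (d + d')) *m (diag_mx d + diag_mx d').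
    rewrite -linearD /= mulVmx // unitmxE det_diag unitfE; apply/prodf_neq0 => i _.
    by rewrite !mxE; case: (d _ i =P 0) => [->|/eqP h];
      rewrite ?add0r ?oner_neq0 // addr0.
  exact: leq_trans (mxrankM_maxr _ _) (mxrank_add _ _).
have := rank_diag_le d'.
have -> : #|[pred i | d' ord0 i != 0%R]| = (n - #|[pred i | d ord0 i != 0%R]|)%N.
  have := cardC [pred i | d ord0 i != 0%R]; rewrite card_ord => e.
  rewrite -[X in (X - _)%N]e addKn; apply: eq_card => i; rewrite !inE mxE.
  by case: (d ord0 i == 0); rewrite ?oner_neq0 ?eqxx.
have := max_card [pred i | d ord0 i != 0%R]; rewrite card_ord => h2 h3.
move: h; rewrite -leq_subLR; set a := #|_| in h2 h3 *.
move=> h; have h4 := leq_trans h h3.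
by rewrite leq_sub2lE in h4.
Qed.

Section Diag.
Variables (n : nat) (A : 'M[R]_n) (P : 'M[C]_n) (lam : 'I_n -> R).
Hypothesis dA : diagonalizes A P lam.

Lemma diagonalizes_eigenspace a :
  \rank (eigenspace A a) = #|[pred i | lam i == a]|.
Proof.
have [PP PP' eA] := dA.
rewrite /eigenspace mxrank_ker -(mxrank_map toC) map_mxB eA.
have -> : map_mx toC a%:M = P^*t *m (toC a)%:M *m P.
  by rewrite map_scalar_mx mul_mx_scalar -scalemxAl PP' scalemx1.
rewrite -mulmxBl -mulmxBr.
have uP : P \in unitmx by case/mulmx1_unit: PP.
have uP' : P^*t \in unitmx by case/mulmx1_unit: PP.
rewrite mxrankMfree ?row_free_unit // -mxrank_tr trmx_mul mxrankMfree; last first.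
  by rewrite row_free_unit unitmx_tr.
rewrite mxrank_tr -diag_const_mx -linearB /= rank_diag.
have := cardC [pred i | lam i == a]; rewrite card_ord => e.
rewrite (@eq_card _ _ [predC [pred i | lam i == a]]).
  by rewrite -[X in (X - _)%N]e addnK.
by move=> i; rewrite !inE !mxE subr_eq0 (inj_eq (@complexI R)).
Qed.

Definition mxpow (F : pzRingType) n (M : 'M[F]_n) k : 'M[F]_n := iter k (mulmx M) 1%:M.

Lemma diagonalizes_trace k : \tr (mxpow A k) = \sum_i lam i ^+ k.
Proof.
have [PP PP' eA] := dA; apply: (@complexI R).
rewrite -trace_map_mx /=.
have -> : map_mx toC (mxpow A k) = P^*t *m diag_mx (\row_j (lam j)%:C%C ^+ k) *m P.
  elim: k => [|k IH] /=.
    rewrite map_mx1 (_ : \row_j _ = const_mx 1) ?diag_const_mx ?mulmx1 //.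
    by apply/rowP => j; rewrite !mxE.
  rewrite map_mxM IH eA -!mulmxA; congr (_ *m _); rewrite !mulmxA; congr (_ *m _).
  rewrite -(mulmxA (diag_mx _)) PP mulmx1 mulmx_diag; congr diag_mx.
  by apply/rowP => j; rewrite !mxE exprS.
rewrite mxtrace_mulC mulmxA PP mul1mx mxtrace_diag rmorph_sum /=.
by apply: eq_bigr => i _; rewrite mxE -rmorphXn.
Qed.

Lemma diagonalizes_form (v : 'rV[C]_n) : let w := v *m P^*t in
  (v *m map_mx toC A *m v^*t) 0 0 = \sum_i `|w 0 i| ^+ 2 * (lam i)%:C%C.
Proof.
have [PP PP' eA] := dA; move=> w.
rewrite eA !mulmxA -/w -mulmxA (_ : P *m v^*t = w^*t); last first.
  by rewrite /w trmx_mul map_mxM map_trmx -map_mx_comp trmxK (map_mx_id (@conjCK _)).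
rewrite mxE; apply: eq_bigr => i _; rewrite mul_mx_diag !mxE normCK.
by rewrite -!mulrA; congr (_ * _); rewrite mulrC.
Qed.

Lemma isometry_norm m (v : 'rV[C]_m) (J : 'M[C]_(m, n)) :
  J *m J^*t = 1%:M -> (v *m v^*t) 0 0 = \sum_i `|(v *m J) 0 i| ^+ 2.
Proof.
move=> JJ; have -> : v *m v^*t = (v *m J) *m (v *m J)^*t.
  by rewrite trmx_mul map_mxM -mulmxA (mulmxA J) JJ mul1mx.
by rewrite mxE; apply: eq_bigr => i _; rewrite !mxE normCK.
Qed.

End Diag.

Lemma card_lt_kernel (F : fieldType) m n (G : 'M[F]_(m, n)) :
  (n < m)%N -> exists2 u : 'rV_m, u != 0 & u *m G = 0.
Proof.
move=> lt_nm; have : kermx G != 0.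
  rewrite -mxrank_eq0 mxrank_ker -lt0n subn_gt0.
  exact: leq_ltn_trans (rank_leq_col _) lt_nm.
by case/rowV0Pn => u /sub_kermxP uG u0; exists u.
Qed.

(* If more eigenvalues of the compression [B] lie on the [Q]-side than those of
   [A], some vector spanned by the former is orthogonal to the latter. *)
Lemma interlacing_vector m n (A : 'M[R]_n) (B : 'M[R]_m) (J : 'M[R]_(m, n))
    P lam P' lam' (Q : pred R) :
  diagonalizes A P lam -> diagonalizes B P' lam' -> J *m J^T = 1%:M ->
  B = J *m A *m J^T ->
  (#|[pred i | Q (lam i)]| < #|[pred i | Q (lam' i)]|)%N ->
  exists w z, [/\ \sum_i `|w i : C| ^+ 2 * (lam' i)%:C%C
                    = \sum_i `|z i : C| ^+ 2 * (lam i)%:C%C,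
    \sum_i `|w i| ^+ 2 = \sum_i `|z i| ^+ 2, \sum_i `|w i| ^+ 2 != 0,
    forall i, ~~ Q (lam' i) -> w i = 0 & forall i, Q (lam i) -> z i = 0].
Proof.
move=> dA dB JJ eB lt; set K := map_mx toC J.
have eK : K^*t = map_mx toC J^T.
  by apply/matrixP => i j; rewrite !mxE; apply: conjc_real.
have KK : K *m K^*t = 1%:M by rewrite eK -map_mxM JJ map_mx1.
have [PP PP' eA] := dA; have [QQ QQ' _] := dB.
pose f := @enum_val _ [pred i | Q (lam' i)]; pose g := @enum_val _ [pred i | Q (lam i)].
have [u u0 uG] := card_lt_kernel (mxsub f g (P' *m K *m P^*t)) lt.
(* [w] holds the coordinates of [v] in the eigenbasis of [B], and [z] those of its embedding
   [v *m K] in the eigenbasis of [A]. *)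
pose v := u *m rowsub f P'; pose w := v *m P'^*t; pose z := v *m K *m P^*t.
have ew : w = u *m rowsub f 1%:M by rewrite /w /v -mulmxA mul_rowsub_mx QQ.
have tK p q (M : 'M[C]_(p, q)) : (M^*t)^*t = M.
  by apply/matrixP => i j; rewrite !mxE conjCK.
have nw : (v *m v^*t) 0 0 = \sum_i `|w 0 i| ^+ 2.
  by rewrite (isometry_norm v (J := P'^*t)) // tK.
have nz : (v *m v^*t) 0 0 = \sum_i `|z 0 i| ^+ 2.
  have -> : z = v *m (K *m P^*t) by rewrite mulmxA.
  rewrite -isometry_norm //.
  by rewrite trmx_mul map_mxM tK -mulmxA (mulmxA _ P) PP' mul1mx KK.
have wQ i : ~~ Q (lam' i) -> w 0 i = 0.
  move=> nQ; rewrite ew mxE big1 // => k _; rewrite !mxE.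
  case: (f k =P i) => [e|]; rewrite ?mulr0 //.
  by move: nQ; rewrite -e; have := enum_valP k; rewrite inE => ->.
have wu k : w 0 (f k) = u 0 k.
  rewrite ew mxE (bigD1 k) //= !mxE eqxx mulr1 big1 ?addr0 // => l nl.
  by rewrite !mxE (inj_eq enum_val_inj) (negPf nl) mulr0.
exists (fun i => w 0 i), (fun i => z 0 i); split=> //.
- rewrite -(diagonalizes_form dB v) /z.
  have := diagonalizes_form dA (v *m K) => /= <-.
  rewrite (_ : (v *m K)^*t = K^*t *m v^*t); last by rewrite trmx_mul map_mxM.
  by rewrite eB !map_mxM eK !mulmxA.
- by rewrite -nw.
- apply: contra u0 => /eqP h; apply/eqP/rowP => k; rewrite mxE -wu.
  have /psumr_eq0P e := h; have /eqP := e (fun i _ => exprn_ge0 2 (normr_ge0 _)) (f k) isT.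
  by rewrite expf_eq0 /= normr_eq0 => /eqP.
- move=> i Qi; have Qi' : i \in [pred i | Q (lam i)] by rewrite inE.
  have ez : z = u *m rowsub f (P' *m K *m P^*t).
    by rewrite /z /v -2!mulmxA mul_rowsub_mx mulmxA.
  transitivity ((u *m mxsub f g (P' *m K *m P^*t)) 0 (enum_rank_in Qi' i)).
    rewrite ez !mxE; apply: eq_bigr => j _; congr (_ * _).
    by rewrite [LHS]mxE [RHS]mxE /g enum_rankK_in.
  by rewrite uG mxE.
Qed.

(** Otherwise some nonzero vector would have Rayleigh quotient at most [E] in the eigenbasis of [B]
    and greater than [E] in that of [A], although the two forms agree on it. *)
Lemma interlacing_le m n (A : 'M[R]_n) (B : 'M[R]_m) (J : 'M[R]_(m, n))
    P lam P' lam' E :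
  diagonalizes A P lam -> diagonalizes B P' lam' -> J *m J^T = 1%:M ->
  B = J *m A *m J^T ->
  (#|[pred i | (lam' i <= E)%R]| <= #|[pred i | (lam i <= E)%R]|)%N.
Proof.
move=> dA dB JJ eB; rewrite leqNgt; apply/negP => lt.
have [w [z [e1 e2 nz wQ zQ]]] := interlacing_vector (Q := fun t => t <= E) dA dB JJ eB lt.
have : \sum_i `|w i| ^+ 2 * ((lam' i)%:C%C - E%:C%C) =
       \sum_i `|z i| ^+ 2 * ((lam i)%:C%C - E%:C%C).
  under eq_bigr do rewrite mulrBr; under [RHS]eq_bigr do rewrite mulrBr.
  by rewrite !sumrB -!mulr_suml e1 e2.
have h1 : \sum_i `|w i| ^+ 2 * ((lam' i)%:C%C - E%:C%C) <= 0.
  apply: sumr_le0 => i _; have [le|gt] := boolP (lam' i <= E).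
    by rewrite mulr_ge0_le0 ?exprn_ge0 // subr_le0 lecR.
  by rewrite wQ // normr0 expr0n mul0r.
have h2 i : 0 <= `|z i| ^+ 2 * ((lam i)%:C%C - E%:C%C).
  have [le|] := boolP (lam i <= E); first by rewrite zQ // normr0 expr0n mul0r.
  by rewrite -ltNge => gt; rewrite mulr_ge0 ?exprn_ge0 // subr_ge0 lecR ltW.
move=> e3; have h0 : \sum_i `|z i| ^+ 2 * ((lam i)%:C%C - E%:C%C) = 0.
  by apply/eqP; rewrite eq_le sumr_ge0 // -e3 h1.
case/eqP: nz; rewrite e2 big1 // => i _.
have [le|] := boolP (lam i <= E); first by rewrite zQ // normr0 expr0n.
rewrite -ltNge -ltcR -subr_gt0 => gt.
have /psumr_eq0P/(_ i isT)/eqP := h0 => /(_ (fun i _ => h2 i)).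
by rewrite mulf_eq0 (gt_eqF gt) orbF => /eqP.
Qed.

(** Counting from above as well as from below confines the change of the counting function between 0
    and the number of removed coordinates. *)
Lemma interlacing_gt m n (A : 'M[R]_n) (B : 'M[R]_m) (J : 'M[R]_(m, n))
    P lam P' lam' E :
  diagonalizes A P lam -> diagonalizes B P' lam' -> J *m J^T = 1%:M ->
  B = J *m A *m J^T ->
  (#|[pred i | (E < lam' i)%R]| <= #|[pred i | (E < lam i)%R]|)%N.
Proof.
move=> dA dB JJ eB; rewrite leqNgt; apply/negP => lt.
have [w [z [e1 e2 nz wQ zQ]]] := interlacing_vector (Q := fun t => E < t) dA dB JJ eB lt.
have : \sum_i `|w i| ^+ 2 * ((lam' i)%:C%C - E%:C%C) =
       \sum_i `|z i| ^+ 2 * ((lam i)%:C%C - E%:C%C).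
  under eq_bigr do rewrite mulrBr; under [RHS]eq_bigr do rewrite mulrBr.
  by rewrite !sumrB -!mulr_suml e1 e2.
have h1 : \sum_i `|z i| ^+ 2 * ((lam i)%:C%C - E%:C%C) <= 0.
  apply: sumr_le0 => i _; have [gt|] := boolP (E < lam i).
    by rewrite zQ // normr0 expr0n mul0r.
  by rewrite -leNgt => le; rewrite mulr_ge0_le0 ?exprn_ge0 // subr_le0 lecR.
have h2 i : 0 <= `|w i| ^+ 2 * ((lam' i)%:C%C - E%:C%C).
  have [gt|le] := boolP (E < lam' i); last by rewrite wQ // normr0 expr0n mul0r.
  by rewrite mulr_ge0 ?exprn_ge0 // subr_ge0 lecR ltW.
move=> e3; have h0 : \sum_i `|w i| ^+ 2 * ((lam' i)%:C%C - E%:C%C) = 0.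
  by apply/eqP; rewrite eq_le sumr_ge0 // e3 h1.
case/eqP: nz; rewrite big1 // => i _.
have [|le] := boolP (E < lam' i); last by rewrite wQ // normr0 expr0n.
rewrite -ltcR -subr_gt0 => gt.
have /psumr_eq0P/(_ i isT)/eqP := h0 => /(_ (fun i _ => h2 i)).
by rewrite mulf_eq0 (gt_eqF gt) orbF => /eqP.
Qed.

(** The eigenvector equation is read at the coordinate of largest modulus. *)
Lemma diagonalizes_bound n (A : 'M[R]_n) P lam (b : R) : diagonalizes A P lam ->
  (forall j, \sum_k `|A k j| <= b) -> forall i, `|lam i| <= b.
Proof.
move=> dA hb i; have := diagonalizes_eigenspace dA (lam i).
case: (eqVneq (\rank (eigenspace A (lam i))) 0%N) => [-> /esym/card0_eq/(_ i)|].
  by rewrite inE eqxx.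
rewrite mxrank_eq0 => /rowV0Pn[v /eigenspaceP vA v0] _.
have [j _ jmax] := @arg_maxP _ _ _ i xpredT (fun j => `|v 0 j|) isT.
have vj0 : 0 < `|v 0 j|.
  rewrite lt_neqAle normr_ge0 andbT eq_sym; apply: contra v0 => /eqP h.
  apply/eqP/rowP => k; rewrite mxE; apply/eqP; rewrite -normr_le0 -h.
  exact: jmax.
rewrite -(ler_pM2r vj0) -normrM.
have /rowP/(_ j) := vA; rewrite !mxE => <-.
apply: le_trans (ler_norm_sum _ _ _) _.
apply: (@le_trans _ _ (\sum_k `|A k j| * `|v 0 j|)).
  apply: ler_sum => k _; rewrite normrM mulrC ler_wpM2l //; exact: jmax.
by rewrite -mulr_suml ler_wpM2r.
Qed.
End SymmetricSpectrum.

(** * Eigenspaces of operators on finite families as eigenspaces of matrices *)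

Section LeigenspaceMatrix.
Import VectorInternalTheory.
Variables (F : fieldType) (I : finType).
Local Notation V := {ffun I -> F^o}.
Implicit Types (f : 'End(V)) (M : 'M[F]_#|I|) (psi : V).

Definition ffun_row psi : 'rV[F]_#|I| := \row_i psi (enum_val i).
Definition row_ffun (u : 'rV[F]_#|I|) : V := [ffun x => u 0 (enum_rank x)].

Lemma ffun_rowK : cancel ffun_row row_ffun.
Proof. by move=> psi; apply/ffunP => x; rewrite ffunE mxE enum_rankK. Qed.

Lemma row_ffunK : cancel row_ffun ffun_row.
Proof. by move=> u; apply/rowP => i; rewrite mxE ffunE enum_valK. Qed.

Lemma ffun_row_linear : linear ffun_row.
Proof. by move=> a u v; apply/rowP => i; rewrite !mxE !ffunE. Qed.

Lemma row_ffun_linear : linear row_ffun.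
Proof. by move=> a u v; apply/ffunP => x; rewrite !(mxE, ffunE). Qed.

HB.instance Definition _ := GRing.isSemilinear.Build F _ _ _ ffun_row
  (GRing.semilinear_linear ffun_row_linear).
HB.instance Definition _ := GRing.isSemilinear.Build F _ _ _ row_ffun
  (GRing.semilinear_linear row_ffun_linear).

Lemma dim_leigenspace f M a :
  (forall psi, ffun_row (f psi) = ffun_row psi *m M) ->
  \dim (passmx.leigenspace f a) = \rank (eigenspace M a).
Proof.
move=> fM; rewrite /dimv /passmx.leigenspace /lker mx2vsK /eigenspace.
set g := (f - a *: \1%VF)%R.
have gM psi : ffun_row (g psi) = ffun_row psi *m (M - a%:M).
  have -> : g psi = f psi - a *: psi by rewrite /g !(add_lfunE, opp_lfunE, scale_lfunE, id_lfunE).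
  by rewrite linearB linearZ /= fM mulmxBr mul_mx_scalar.
(* [T] and [T'] are mutually inverse changes of coordinates between the basis behind [v2r] and the
   enumeration of [I]; conjugation by them preserves the rank. *)
pose T := lin1_mx (ffun_row \o r2v (vT := V)).
pose T' := lin1_mx (v2r (vT := V) \o row_ffun).
have TT' : T *m T' = 1%:M.
  apply/row_matrixP => i; rewrite row1 row_mul rowE !mul_rV_lin1 /= ffun_rowK.
  by rewrite r2vK.
have T'T : T' *m T = 1%:M.
  apply/row_matrixP => i; rewrite row1 row_mul rowE !mul_rV_lin1 /= v2rK.
  by rewrite row_ffunK.
have f2mxE (k : 'End(V)) v : v2r (k v) = v2r v *m f2mx k.
  by rewrite unlock /= r2vK.
have eg : f2mx g = T *m (M - a%:M) *m T'.
  apply/row_matrixP => i; rewrite !rowE !mulmxA !mul_rV_lin1 /= -gM ffun_rowK.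
  by rewrite f2mxE r2vK.
rewrite !mxrank_ker eg; congr (_ - _)%N.
  by apply/eqP; rewrite eqn_leq (mulmx1_min TT') (mulmx1_min T'T).
apply/eqP; rewrite eqn_leq; apply/andP; split.
  exact: leq_trans (mxrankM_maxl _ _) (mxrankM_maxr _ _).
have {1}-> : M - a%:M = T' *m (T *m (M - a%:M) *m T') *m T.
  by rewrite !mulmxA T'T mul1mx -mulmxA T'T mulmx1.
apply: leq_trans (mxrankM_maxl _ _) _; exact: mxrankM_maxr.
Qed.
End LeigenspaceMatrix.

(** * The matrix of the Anderson operator on finite sets of sites *)

Section LatticeOperator.
Variables (R : realType) (d : nat).
Implicit Types (om psi : Zd d -> R) (x y z e : Zd d) (S : {fset Zd d}).

Definition units : {fset Zd d} := fset_set [set e : Zd d | nearest_neighbours 0 e].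

Lemma nearest_neighbours_shift x y :
  nearest_neighbours x y = nearest_neighbours 0 (y - x).
Proof.
by rewrite /nearest_neighbours; under [in RHS]eq_bigr do rewrite !mxE subr0.
Qed.

Lemma nearest_neighbours_coord x y i : nearest_neighbours x y -> `|y 0 i - x 0 i| <= 1.
Proof.
rewrite /nearest_neighbours (bigD1 i) //= => <-; rewrite lerDl.
by apply: sumr_ge0.
Qed.

Lemma finite_units : finite_set [set e : Zd d | nearest_neighbours 0 e].
Proof.
pose h (g : {ffun 'I_d -> 'I_3}) : Zd d := \row_i ((g i)%:Z - 1).
apply: (@sub_finite_set _ _ (h @` [set: {ffun 'I_d -> 'I_3}])); last first.
  exact/finite_image/finite_finset.
move=> e /= ne; exists [ffun i => inord (absz (e ord0 i + 1))] => //.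
apply/rowP => i; rewrite mxE ffunE.
have := nearest_neighbours_coord i ne; rewrite mxE subr0 ler_norml => /andP[h1 h2].
have e0 : 0 <= e 0 i + 1 by rewrite -lerBlDr sub0r.
rewrite inordK; first by rewrite gez0_abs // addrK.
by rewrite -ltz_nat gez0_abs // -(ltrBrDr); apply: le_lt_trans h2 _.
Qed.

Lemma mem_units e : e \in units <-> nearest_neighbours 0 e.
Proof. by rewrite in_fset_set ?inE //; exact: finite_units. Qed.

Lemma mem_unitsN e : (- e \in units) = (e \in units).
Proof.
apply/idP/idP => /mem_units h; apply/mem_units; move: h;
  rewrite /nearest_neighbours => <-; apply: eq_bigr => i _;
  by rewrite !mxE ?subr0 ?normrN.
Qed.

Lemma andersonE om psi x :
  anderson om psi x = \sum_(e <- units) (psi x - psi (x + e)) + om x * psi x.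
Proof.
rewrite /anderson; congr (_ + _).
rewrite (reindex_fsbig (fun e => x + e) [set e | nearest_neighbours 0 e]); last first.
  split=> [e /= he|e e' _ _ /addrI //|y /= hy].
    by rewrite nearest_neighbours_shift addrC addKr.
  by exists (y - x); rewrite /= -?nearest_neighbours_shift // addrC subrK.
by rewrite fsbig_finite //; exact: finite_units.
Qed.

Lemma anderson_linear om a psi psi' x :
  anderson om (fun y => a * psi y + psi' y) x =
  a * anderson om psi x + anderson om psi' x.
Proof.
rewrite !andersonE [a * (_ + _)]mulrDr big_distrr /= addrACA -big_split /=.
by congr (_ + _); [apply: eq_bigr => e _|]; ring.
Qed.

Definition delta y : Zd d -> R := fun x => (x == y)%:R.

(** The matrix elements in the site basis. The degree on the diagonal comes from the graph
    Laplacian; zero is not in [units], so the two terms never overlap. *)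
Definition kern om x y : R :=
  (#|` units|%:R + om x) * (x == y)%:R - (y - x \in units)%:R.

Lemma kernC om x y : kern om x y = kern om y x.
Proof.
rewrite /kern -(mem_unitsN (y - x)) opprB.
by rewrite (eq_sym y); case: (eqVneq x y) => [->|_] //; rewrite !mulr0.
Qed.

Definition supported S psi := forall x, x \notin S -> psi x = 0.

Lemma supportedE S psi x : supported S psi ->
  psi x = \sum_(z : S) (x == val z)%:R * psi (val z).
Proof.
move=> sS; have [xS|xS] := boolP (x \in S).
  rewrite (bigD1 [` xS]%fset) //= eqxx mul1r big1 ?addr0 // => z.
  by rewrite -val_eqE /= eq_sym => /negPf ->; rewrite mul0r.
rewrite sS // big1 // => z _; case: eqP => [e|]; rewrite ?mul0r //.
by move: xS; rewrite e (valP z).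
Qed.

Lemma anderson_kern S om psi x : supported S psi ->
  anderson om psi x = \sum_(z : S) kern om x (val z) * psi (val z).
Proof.
move=> sS; rewrite andersonE big_split /= sumrN.
transitivity ((#|` units|%:R + om x) * psi x - \sum_(e <- units) psi (x + e)).
  have -> : \sum_(e <- units) psi x = #|` units|%:R * psi x.
    by rewrite big_const_seq count_predT iter_addr_0 mulr_natl.
  by ring.
under [in RHS]eq_bigr do rewrite /kern mulrBl.
rewrite sumrB; congr (_ - _).
  by rewrite [in LHS](supportedE x sS) mulr_sumr; apply: eq_bigr => z _; rewrite mulrA.
under eq_bigr do rewrite (supportedE _ sS).
rewrite exchange_big /=; apply: eq_bigr => z _; rewrite -mulr_suml; congr (_ * _).
have [h|h] := boolP (val z - x \in units).
  rewrite (big_fsetD1 _ h) /= [x + _]addrC subrK eqxx big1_seq ?addr0 // => e /=.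
  rewrite !inE => /andP[ne _]; case: eqP => // h'.
  by move: ne; rewrite -h' addrC addKr eqxx.
rewrite big1_seq // => e /= eU; case: eqP => // h'.
by case/negP: h; rewrite -[\val z]/(fsval z) -h' addrC addKr.
Qed.

Definition hmx om S : 'M[R]_#|{: S}| :=
  \matrix_(i, j) kern om (val (enum_val i)) (val (enum_val j)).

Lemma tr_hmx om S : (hmx om S)^T = hmx om S.
Proof. by apply/matrixP => i j; rewrite !mxE kernC. Qed.

Lemma extend0_val S (psi : {ffun S -> R^o}) (x : S) : extend0 psi (val x) = psi x.
Proof. by rewrite /extend0 valK. Qed.

Lemma supported_extend0 S (psi : {ffun S -> R^o}) : supported S (extend0 psi).
Proof. by move=> x xS; rewrite /extend0 insubN. Qed.

Lemma compressionE om S (psi : {ffun S -> R^o}) (x : S) :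
  compression (anderson om) S psi x = anderson om (extend0 psi) (val x).
Proof.
set f := fun p : {ffun S -> R^o} => [ffun x : S => anderson om (extend0 p) (val x)] : {ffun S -> R^o}.
have fl : linear f.
  move=> a u v; apply/ffunP => y; rewrite ffunE.
  have -> : (a *: f u + f v) y = a * f u y + f v y.
    by rewrite ffunE; congr (_ + _); rewrite ffunE.
  rewrite /f !ffunE -anderson_linear; congr anderson; apply/funext => z.
  rewrite /extend0; case: insubP => [w _ _|_]; last by rewrite mulr0 addr0.
  by rewrite ffunE; congr (_ + _); rewrite ffunE.
pose fL : {linear {ffun S -> R^o} -> {ffun S -> R^o}} :=
  HB.pack f (GRing.isSemilinear.Build R _ _ _ f (GRing.semilinear_linear fl)).
by rewrite /compression -/f -[f]/(fL : _ -> _) lfunE /= ffunE.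
Qed.

Lemma ffun_row_compression om S (psi : {ffun S -> R^o}) :
  ffun_row (compression (anderson om) S psi) = ffun_row psi *m hmx om S.
Proof.
apply/rowP => i; rewrite !mxE compressionE.
rewrite (anderson_kern _ _ (supported_extend0 psi)).
rewrite (reindex _ (onW_bij _ (@enum_val_bij {: S}))) /=.
by apply: eq_bigr => j _; rewrite !mxE extend0_val mulrC kernC.
Qed.

Lemma count_eigenvaluesE om S P lam E : diagonalizes (hmx om S) P lam ->
  count_eigenvalues (compression (anderson om) S) E = #|[pred i | lam i <= E]|.
Proof.
move=> dS; rewrite /count_eigenvalues.
have eq_dim a : \dim (passmx.leigenspace (compression (anderson om) S) a) =
                #|[pred i | lam i == a]|.
  rewrite (dim_leigenspace _ (@ffun_row_compression om S)).
  exact: diagonalizes_eigenspace dS a.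
under eq_fsbigr do rewrite eq_dim.
(* The distinct eigenvalues up to [E]. Any other real number has a trivial eigenspace, so the sum
   over the half-line reduces to [r]. *)
pose r := [seq a <- undup [seq lam i | i : 'I_#|{: S}|] | a <= E].
have ur : uniq r by rewrite filter_uniq ?undup_uniq.
have mr i : (lam i \in r) = (lam i <= E).
  by rewrite mem_filter mem_undup map_f ?andbT // mem_enum.
transitivity (\sum_(a \in [set` r]) #|[pred i | lam i == a]|)%N.
  apply/esym/fsbig_widen => [a|a [/= aE ar]] /=; first by rewrite mem_filter => /andP[].
  apply: eq_card0 => i; rewrite inE; apply/negP => /eqP h.
  by apply: ar; rewrite /= -h mr h.
rewrite -fsbig_seq //= -[RHS]sum1_card.
under eq_bigr do rewrite -sum1_card big_mkcond /=.
rewrite exchange_big /= [RHS]big_mkcond /=; apply: eq_bigr => i _.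
transitivity (count_mem (lam i) r).
  rewrite -big_mkcond /= sum1_count.
  by apply: eq_count => a; rewrite /= inE eq_sym.
by rewrite count_uniq_mem // mr inE; case: ifP.
Qed.
End LatticeOperator.

(** * Polynomials approximating indicators of half-lines *)

Lemma double_leq_exp2 n : (0 < n)%N -> (2 * n <= 2 ^ n)%N.
Proof.
elim: n => // k IH _; case: k IH => // k IH.
by rewrite expnS; have := IH isT; lia.
Qed.

Section StepPolynomials.
Variable R : realType.
Implicit Types (x t E e : R) (n m : nat).

Lemma bernoulli_ge x m : -1 <= x -> 1 + m%:R * x <= (1 + x) ^+ m.
Proof.
move=> x1; elim: m => [|m IH]; first by rewrite mul0r addr0 expr0.
rewrite exprSr; apply: (@le_trans _ _ ((1 + m%:R * x) * (1 + x))).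
  rewrite -natr1; have : 0 <= m%:R * (x * x) by rewrite mulr_ge0 // -expr2 sqr_ge0.
  by move=> h; rewrite -subr_ge0; apply: le_trans h _; rewrite le_eqVlt; apply/orP; left; apply/eqP; ring.
by rewrite ler_wpM2r // -lerBlDl sub0r.
Qed.

Definition step_exponent n : nat := (2 ^ (n ^ 3)) %/ n.

(* Interpolates the indicator of []-oo, E]] on [[-n, n + 2 E]]: with
   y = (t + n) / (2 (E + n)), the base 1 - y ^ (n ^ 3) is raised to a power
   slightly smaller than 2 ^ (n ^ 3), so that the threshold y = 1/2 itself is
   sent to 1 in the limit. *)
Definition step_poly E n : {poly R} :=
  (1 - ((2 * (E + n%:R))^-1 *: ('X + n%:R%:P)) ^+ (n ^ 3)) ^+ step_exponent n.

Variables (E : R) (n : nat).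
Hypothesis En : `|E| < n%:R.

Let y t := (t + n%:R) / (2 * (E + n%:R)).

Lemma horner_step_poly t :
  (step_poly E n).[t] = (1 - y t ^+ (n ^ 3)) ^+ step_exponent n.
Proof.
by rewrite /step_poly !(hornerE, horner_exp) /y; congr ((1 - _ ^+ _) ^+ _); rewrite mulrC.
Qed.

Let n0 : 0 < n%:R :> R. Proof. exact: le_lt_trans (normr_ge0 _) En. Qed.
Let En0 : 0 < E + n%:R.
Proof. by move: En; rewrite ltr_norml => /andP[h _]; rewrite -ltrBlDr sub0r. Qed.

Let y01 t : - n%:R <= t <= n%:R + 2 * E -> 0 <= y t <= 1.
Proof.
move=> /andP[h1 h2]; have p : 0 < 2 * (E + n%:R) by rewrite mulr_gt0.
by rewrite /y ler_pdivlMr // ler_pdivrMr // mul0r mul1r; lra.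
Qed.

Lemma step_poly01 t : - n%:R <= t <= n%:R + 2 * E -> 0 <= (step_poly E n).[t] <= 1.
Proof.
move=> /y01/andP[h1 h2]; rewrite horner_step_poly.
have h3 : 0 <= y t ^+ (n ^ 3) by rewrite exprn_ge0.
have h4 : y t ^+ (n ^ 3) <= 1 by rewrite exprn_ile1.
by rewrite exprn_ge0 ?subr_ge0 // exprn_ile1 ?subr_ge0 // lerBlDr lerDl.
Qed.

(** Here y is at most 1/2, so by Bernoulli's inequality the loss is at most the exponent times
    2^-(n^3). The division by n in [step_exponent] brings this down to 1/n. *)
Lemma step_poly_ge t : - n%:R <= t <= E -> 1 - n%:R^-1 <= (step_poly E n).[t].
Proof.
move=> /andP[h1 h2]; have p : 0 < 2 * (E + n%:R) by rewrite mulr_gt0.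
have y0 : 0 <= y t by rewrite /y ler_pdivlMr // mul0r; lra.
have y2 : y t <= 2^-1.
  by rewrite /y ler_pdivrMr // mulrA mulVf ?mul1r ?lerD2r // pnatr_eq0.
rewrite horner_step_poly.
have h3 : y t ^+ (n ^ 3) <= (2 ^+ (n ^ 3))^-1 by rewrite -exprVn lerXn2r ?nnegrE ?invr_ge0.
have h4 : (2 ^+ (n ^ 3))^-1 <= 1 :> R by rewrite -exprVn exprn_ile1 ?invr_ge0 // invf_le1 // ler1n.
apply: le_trans (bernoulli_ge _ _); last by rewrite lerN2 (le_trans h3).
rewrite lerD2l mulrN lerN2.
apply: (@le_trans _ _ ((step_exponent n)%:R * (2 ^+ (n ^ 3))^-1)).
  by rewrite ler_wpM2l.
rewrite ler_pdivrMr ?exprn_gt0 // mulrC ler_pdivlMr // -natrM -natrX ler_nat.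
exact: leq_divM.
Qed.

Lemma step_exponent_ge : 2 ^+ (n ^ 3) / (2 * n%:R) <= (step_exponent n)%:R :> R.
Proof.
have n1 : (0 < n)%N by rewrite -(ltr0n R).
have h : (2 * n <= 2 ^ (n ^ 3))%N.
  apply: (@leq_trans (2 ^ n)); last first.
    by rewrite leq_exp2l // -{1}(expn1 n) leq_pexp2l.
  exact: double_leq_exp2.
rewrite ler_pdivrMr ?mulr_gt0 // -natrX -!natrM ler_nat /step_exponent.
set a := (2 ^ _)%N in h *; rewrite mulnC -mulnA [(n * _)%N]mulnC.
have e := divn_eq a n; have := ltn_pmod a n1; move: e h.
set q := (a %/ n)%N; set r := (a %% n)%N; move=> -> h1 h2.
have q1 : (1 <= q)%N by rewrite lt0n; apply: contraTneq h1 => ->; rewrite mul0n add0n -ltnNge; lia.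
by nia.
Qed.

(** Past the threshold 2y is at least 1 + e/(E + n), so Bernoulli's inequality makes 2^(n^3) y^(n^3)
    at least n^2 e/2. The cube pays for the width of the interval and for the division by n in the
    exponent, and still leaves a factor n. The end is (1 - z)^m (1 + m z) <= (1 - z^2)^m <= 1. *)
Lemma step_poly_le e t : 0 < e -> E + e <= t <= n%:R + 2 * E ->
  (step_poly E n).[t] <= 4 / (n%:R * e).
Proof.
move=> e0 /andP[h1 h2]; have p : 0 < 2 * (E + n%:R) by rewrite mulr_gt0.
have ht : - n%:R <= t <= n%:R + 2 * E.
  by rewrite h2 andbT; move: En0 h1 e0; lra.
have /andP[y0 y1] := y01 ht; rewrite horner_step_poly.
set N := (n ^ 3)%N; set m := step_exponent n; set z := y t ^+ N.
have z0 : 0 <= z by rewrite exprn_ge0.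
have z1 : z <= 1 by rewrite exprn_ile1.
have hz : n%:R ^+ 2 * e / 2 <= 2 ^+ N * z.
  rewrite -exprMn.
  have h3 : 1 + e / (E + n%:R) <= 2 * y t.
    have -> : 2 * y t = (t + n%:R) / (E + n%:R).
      by rewrite /y invfM; field; rewrite gt_eqF.
    rewrite ler_pdivlMr // mulrDl mul1r divfK ?gt_eqF //; lra.
  apply: (@le_trans _ _ ((1 + e / (E + n%:R)) ^+ N)); last first.
    have h0 : 0 <= 1 + e / (E + n%:R) by rewrite addr_ge0 // divr_ge0 // ltW.
    by rewrite lerXn2r // nnegrE // (le_trans h0).
  have h4 : -1 <= e / (E + n%:R).
    by apply: (@le_trans _ _ 0); rewrite ?divr_ge0 ?ltW // oppr_le0.
  apply: le_trans (bernoulli_ge N h4).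
  apply: (@le_trans _ _ (N%:R * (e / (E + n%:R)))); last by rewrite lerDr.
  rewrite /N natrX ler_pdivrMr //.
  have -> : n%:R ^+ 3 * (e / (E + n%:R)) * 2 = 2 * n%:R ^+ 3 * e / (E + n%:R) by ring.
  rewrite ler_pdivlMr //.
  have hE : E + n%:R <= 2 * n%:R by move: En; rewrite ltr_norml; lra.
  have : n%:R ^+ 2 * e * (E + n%:R) <= n%:R ^+ 2 * e * (2 * n%:R).
    by rewrite ler_wpM2l // mulr_ge0 ?ltW // exprn_gt0.
  by move=> h; apply: le_trans h _; rewrite le_eqVlt; apply/orP; left; apply/eqP; ring.
have hmz : n%:R * e / 4 <= m%:R * z.
  apply: (@le_trans _ _ (2 ^+ N / (2 * n%:R) * z)); last first.
    by rewrite ler_wpM2r // step_exponent_ge.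
  have -> : 2 ^+ N / (2 * n%:R) * z = 2 ^+ N * z / (2 * n%:R) by rewrite mulrAC.
  rewrite ler_pdivlMr ?mulr_gt0 //.
  by apply: le_trans hz; rewrite le_eqVlt; apply/orP; left; apply/eqP; field.
have h5 : (1 - z) ^+ m * (1 + m%:R * z) <= 1.
  apply: (@le_trans _ _ ((1 - z) ^+ m * (1 + z) ^+ m)).
    by rewrite ler_wpM2l ?exprn_ge0 ?subr_ge0 // bernoulli_ge // (le_trans _ z0) // lerN10.
  rewrite -exprMn; have -> : (1 - z) * (1 + z) = 1 - z ^+ 2 by ring.
  rewrite exprn_ile1 //; last by rewrite lerBlDr lerDl sqr_ge0.
  by rewrite subr_ge0 exprn_ile1.
have ne0 : 0 < n%:R * e by rewrite mulr_gt0.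
rewrite ler_pdivlMr //.
have h6 : (1 - z) ^+ m * (n%:R * e / 4) <= 1.
  apply: le_trans h5; rewrite ler_wpM2l ?exprn_ge0 ?subr_ge0 //.
  by apply: le_trans hmz _; rewrite lerDr.
by move: h6; rewrite mulrA ler_pdivrMr // mul1r.
Qed.
End StepPolynomials.

(** * Counting functions of finite sets: interlacing, traces, decoupling *)

Section CountingFunction.
Variables (R : realType) (d : nat).
Implicit Types (om psi : Zd d -> R) (x y z e : Zd d) (S T : {fset Zd d}).

Definition neig om S (E : R) : nat :=
  count_eigenvalues (compression (anderson om) S) E.

Lemma spectrumP om S : exists lam : 'I_#|{: S}| -> R,
  exists P, diagonalizes (hmx om S) P lam.
Proof. by have [P [lam h]] := symmetric_diagonalizes (tr_hmx om S); exists lam, P. Qed.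

(** The eigenvalues are picked by choice, with no regularity in [om]; measurability of the counting
    function is obtained from traces instead. *)
Definition spectrum om S : 'I_#|{: S}| -> R := projT1 (cid (spectrumP om S)).

Arguments spectrum om S _ : clear implicits.

Lemma neigE om S E : neig om S E = #|[pred i | spectrum om S i <= E]|.
Proof.
by rewrite /spectrum; case: cid => lam [P h] /=; exact: count_eigenvaluesE h.
Qed.

Lemma neig_card om S E : (neig om S E <= #|` S|)%N.
Proof. by rewrite neigE cardfE -[X in (_ <= X)%N]card_ord max_card. Qed.

Lemma neig_mono om S E E' : E <= E' -> (neig om S E <= neig om S E')%N.
Proof.
move=> h; rewrite !neigE; apply: subset_leq_card; apply/fintype.subsetP => i.
by rewrite !inE => /le_trans; apply.
Qed.

Lemma neig_interlacing om S T E : (S `<=` T)%fset ->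
  (neig om S E <= neig om T E)%N /\ (neig om T E + #|` S| <= neig om S E + #|` T|)%N.
Proof.
move=> /fsubsetP ST.
pose J : 'M[R]_(#|{: S}|, #|{: T}|) :=
  \matrix_(i, j) (val (enum_val i) == val (enum_val j))%:R.
have JE i (F : Zd d -> R) : \sum_j J i j * F (val (enum_val j)) = F (val (enum_val i)).
  pose z : T := [` ST _ (valP (enum_val i)) ]%fset.
  rewrite (bigD1 (enum_rank z)) //= mxE enum_rankK eqxx mul1r big1 ?addr0 // => j nj.
  rewrite mxE; case: eqP => [h|]; rewrite ?mul0r //.
  by case/eqP: nj; rewrite -[j in LHS]enum_valK; congr enum_rank; apply: val_inj.
have JJ : J *m J^T = 1%:M.
  apply/matrixP => i k; rewrite !mxE.
  under eq_bigr do rewrite [J^T _ _]mxE [J k _]mxE.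
  have := JE i (fun x => (val (enum_val k) == x)%:R) => /=.
  under eq_bigr do rewrite mxE.
  by move=> ->; rewrite val_eqE (inj_eq enum_val_inj) eq_sym.
have eB : hmx om S = J *m hmx om T *m J^T.
  have H i l : (J *m hmx om T) i l = kern om (val (enum_val i)) (val (enum_val l)).
    rewrite mxE -(JE i (fun x => kern om x (val (enum_val l)))).
    by apply: eq_bigr => j _; rewrite [hmx _ _ _ _]mxE.
  apply/matrixP => i k; rewrite mxE kernC -(JE k (fun x => kern om x (val (enum_val i)))).
  by rewrite [RHS]mxE; apply: eq_bigr => j _; rewrite H kernC [J^T _ _]mxE mulrC.
rewrite !neigE /spectrum; case: cid => lamS [PS dS] /=; case: cid => lamT [PT dT] /=.
split; first exact: interlacing_le dT dS JJ eB.
have := interlacing_gt E dT dS JJ eB.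
have cS := cardC [pred i | (lamS i <= E)%R]; have cT := cardC [pred i | (lamT i <= E)%R].
rewrite !card_ord in cS cT.
have eS : #|` S| = #|{: S}| by rewrite cardfE.
have eT : #|` T| = #|{: T}| by rewrite cardfE.
rewrite -cS in eS; rewrite -cT in eT; rewrite eS eT.
rewrite (@eq_card _ [pred i | (E < lamS i)%R] [predC [pred i | (lamS i <= E)%R]]); last first.
  by move=> i; rewrite !inE ltNge.
rewrite (@eq_card _ [pred i | (E < lamT i)%R] [predC [pred i | (lamT i <= E)%R]]); last first.
  by move=> i; rewrite !inE ltNge.
by move=> h; rewrite [X in (X <= _)%N]addnCA !leq_add2l.
Qed.

(** Cutting off after [H] gives the powers of the compression on functions supported in [A], and [H]
    itself when [A] is [xpredT]; finite and infinite volume thus share one notation. *)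
Definition restricted om (A : pred (Zd d)) psi x : R :=
  if A x then anderson om psi x else 0.

Definition powk om (A : pred (Zd d)) k y : Zd d -> R :=
  iter k (restricted om A) (delta R y).

Lemma supported_powk om S k y : y \in S -> supported S (powk om (mem S) k y).
Proof.
move=> yS x xS; rewrite /powk; case: k => [|k] /=.
  by rewrite /delta; case: eqP => // e; rewrite e yS in xS.
by rewrite /restricted /= (negPf xS).
Qed.

Lemma mxpow_hmx om S k i j :
  mxpow (hmx om S) k i j = powk om (mem S) k (val (enum_val j)) (val (enum_val i)).
Proof.
elim: k i => [|k IH] i /=.
  by rewrite !mxE /powk /= /delta val_eqE (inj_eq enum_val_inj).
rewrite mxE -/(powk om (mem S) k _) /restricted /= (valP (enum_val i)).
rewrite (anderson_kern _ _ (supported_powk om k (valP (enum_val j)))).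
rewrite [RHS](reindex _ (onW_bij _ (@enum_val_bij {: S}))) /=.
by apply: eq_bigr => l _; rewrite IH mxE.
Qed.

(** The diagonal matrix element at [x] of [p] of the operator restricted to [A], written without
    matrices so that [A] may be infinite. *)
Definition ploc om (A : pred (Zd d)) (p : {poly R}) x : R :=
  \sum_(k < size p) p`_k * powk om A k x x.

Lemma sum_ploc om S p : \sum_(x : S) ploc om (mem S) p (val x) =
  \sum_i p.[spectrum om S i].
Proof.
rewrite /spectrum; case: cid => lam [P dS] /=.
rewrite /ploc exchange_big /=; under [RHS]eq_bigr do rewrite horner_coef.
rewrite [RHS]exchange_big /=; apply: eq_bigr => k _; rewrite -!mulr_sumr; congr (_ * _).
rewrite -(diagonalizes_trace dS k) /mxtrace.
rewrite (reindex _ (onW_bij _ (@enum_val_bij {: S}))) /=.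
by apply: eq_bigr => i _; rewrite mxpow_hmx.
Qed.

Lemma spectrum_bound om S M : (forall x, x \in S -> `|om x| <= M) ->
  forall i, `|spectrum om S i| <= (2 * #|` units d|)%:R + M.
Proof.
rewrite /spectrum; case: cid => lam [P dS] /= hM; apply: diagonalizes_bound dS _ => j.
under eq_bigr do rewrite mxE.
set y := val (enum_val j).
pose G (x : S) := `|kern om (val x) y|.
rewrite (_ : \sum_i _ = \sum_(x : S) G x); last first.
  by apply/esym; rewrite (reindex _ (onW_bij _ (@enum_val_bij {: S}))).
rewrite /G.
apply: (@le_trans _ _ (\sum_(x : S) ((x == enum_val j)%:R * (#|` units d|%:R + M)
    + (y - val x \in units d)%:R))).
  apply: ler_sum => x _; rewrite /kern; apply: le_trans (ler_normB _ _) _.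
  rewrite [X in _ + X <= _]ger0_norm // lerD2r normrM mulrC [X in X * _]ger0_norm //.
  rewrite /y val_eqE; case: eqP => [-> |]; rewrite ?mul0r // !mul1r.
  by rewrite (le_trans (ler_normD _ _)) // ger0_norm // lerD2l hM // (valP (enum_val j)).
rewrite big_split /= -mulr_suml (bigD1 (enum_val j)) //= eqxx big1 ?addr0 ?mul1r; last first.
  by move=> x /negPf ->.
rewrite addrAC mul2n -addnn natrD lerD2r lerD2l -natr_sum ler_nat.
rewrite -big_mkcond /= sum1_card cardE.
rewrite -(size_map (fun x : S => y - val x)); apply: uniq_leq_size.
  by rewrite map_inj_uniq ?enum_uniq // => x x' /addrI/oppr_inj/val_inj.
by move=> _ /mapP[x xS ->]; move: xS; rewrite mem_enum.
Qed.

Lemma cvg_sumr (I : Type) (r : seq I) (f : I -> nat -> R) (l : I -> R) :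
  (forall i, f i n @[n --> \oo] --> l i) ->
  \sum_(i <- r) f i n @[n --> \oo] --> \sum_(i <- r) l i.
Proof.
move=> h; elim: r => [|i r IH].
  by under eq_fun do rewrite big_nil; rewrite big_nil; exact: cvg_cst.
by under eq_fun do rewrite big_cons; rewrite big_cons; exact: cvgD.
Qed.

Lemma near_natr_ge (c : R) : \forall n \near \oo, c <= n%:R.
Proof. exact: nbhs_infty_ger. Qed.

Lemma near_natr_gt (c : R) : \forall n \near \oo, c < n%:R.
Proof. exact: nbhs_infty_gtr. Qed.

Lemma step_poly_cvg (E t : R) :
  (step_poly E n).[t] @[n --> \oo] --> ((nat_of_bool (t <= E))%:R : R).
Proof.
apply/cvgrPdist_le => e e0; have [le|gt] := leP t E; near=> n.
  have hE : `|E| < n%:R by near: n; exact: near_natr_gt.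
  have ht : - n%:R <= t by rewrite lerNl; near: n; exact: near_natr_ge.
  have h2 : t <= n%:R + 2 * E by rewrite -lerBlDr; near: n; exact: near_natr_ge.
  have /andP[p0 p1] : 0 <= (step_poly E n).[t] <= 1 by apply: step_poly01; rewrite ?ht.
  have h3 : 1 - n%:R^-1 <= (step_poly E n).[t] by apply: step_poly_ge; rewrite ?ht.
  have n0 : 0 < n%:R :> R by exact: le_lt_trans hE.
  have h4 : n%:R^-1 <= e.
    by rewrite -[e]invrK lef_pV2 ?posrE ?invr_gt0 //; near: n; exact: near_natr_ge.
  by rewrite ger0_norm ?subr_ge0 // lerBlDr -lerBlDl (le_trans _ h3) // lerD2l lerN2.
have hE : `|E| < n%:R by near: n; exact: near_natr_gt.
have h2 : t <= n%:R + 2 * E by rewrite -lerBlDr; near: n; exact: near_natr_ge.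
have n0 : 0 < n%:R :> R by exact: le_lt_trans hE.
have ht : - n%:R <= t.
  by apply: le_trans (ltW gt); rewrite lerNl (le_trans _ (ltW hE)) // -normrN ler_norm.
have /andP[p0 p1] : 0 <= (step_poly E n).[t] <= 1 by apply: step_poly01; rewrite ?ht.
have tE : 0 < t - E by rewrite subr_gt0.
have h3 : (step_poly E n).[t] <= 4 / (n%:R * (t - E)).
  by apply: step_poly_le => //; rewrite h2 andbT addrC subrK.
rewrite sub0r normrN ger0_norm // (le_trans h3) //.
rewrite ler_pdivrMr ?mulr_gt0 // mulrCA -ler_pdivrMr ?mulr_gt0 //.
by near: n; exact: near_natr_ge.
Unshelve. all: by end_near. Qed.

(** The counting function becomes a limit of expressions polynomial in finitely many coordinates of
    [om]. Measurability, translation covariance and additivity over separated sets all rest on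
    this. *)
Lemma neig_cvg om S E :
  \sum_(x <- S) ploc om (mem S) (step_poly E n) x @[n --> \oo] -->
    ((neig om S E)%:R : R).
Proof.
under eq_fun do rewrite big_seq_fsetE sum_ploc.
have -> : (neig om S E)%:R =
    \sum_i (nat_of_bool (spectrum om S i <= E))%:R :> R.
  rewrite neigE -sum1_card big_mkcond /= natr_sum; apply: eq_bigr => i _.
  by rewrite inE; case: ifP.
by apply: cvg_sumr => i; exact: step_poly_cvg.
Qed.

Definition nonadjacent S T :=
  forall x y, x \in S -> y \in T -> x != y /\ y - x \notin units d.

Lemma powkS om A k y : powk om A k.+1 y = restricted om A (powk om A k y).
Proof. by []. Qed.

(** A hopping path inside [S] that starts in [T] cannot leave [T], since no other site of [S]
    neighbours it. *)
Lemma powk_separated om S T k y : y \in T -> (T `<=` S)%fset ->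
  nonadjacent (S `\` T)%fset T -> powk om (mem S) k y = powk om (mem T) k y.
Proof.
move=> yT /fsubsetP TS sep; elim: k => // k IH; rewrite !powkS IH; apply/funext => x; rewrite /restricted /=.
have [xT|xT] := boolP (x \in T); first by rewrite TS.
case: ifP => // xS; rewrite (anderson_kern _ _ (supported_powk om k yT)) big1 // => z _.
have [] := sep x (val z) _ (valP z); first by rewrite inE xT.
by rewrite /kern => /negPf -> /negPf ->; rewrite mulr0 subrr mul0r.
Qed.

Lemma neig_bigfcup om (K : {fset Zd d}) (F : Zd d -> {fset Zd d}) E :
  {in K &, forall i j, i != j -> nonadjacent (F i) (F j)} ->
  neig om (\bigcup_(i <- K) F i)%fset E = (\sum_(i <- K) neig om (F i) E)%N.
Proof.
move=> sep; set S := (\bigcup_(i <- K) F i)%fset.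
have FS i : i \in K -> (F i `<=` S)%fset by move=> iK; apply: bigfcup_sup.
have sepS i : i \in K -> nonadjacent (S `\` F i)%fset (F i).
  move=> iK x y; rewrite inE => /andP[xFi /bigfcupP[j]]; rewrite andbT => jK xFj yFi.
  by apply: (sep j i) => //; apply: contraNneq xFi => <-.
apply/eqP; rewrite -(eqr_nat R); apply/eqP; rewrite natr_sum.
apply: (@cvg_unique _ (@Rhausdorff R) _ _ _ _ (neig_cvg (om := om) (S := S) (E := E))).
have -> : (fun n => \sum_(x <- S) ploc om (mem S) (step_poly E n) x) =
   (fun n => \sum_(i <- K) \sum_(x <- F i) ploc om (mem (F i)) (step_poly E n) x).
  apply/funext => n; rewrite /S partition_disjoint_bigfcup; last first.
    move=> i j iK jK nij; apply/fdisjointP => x xi; apply/negP => xj.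
    by have [] := sep i j iK jK nij x x xi xj; rewrite eqxx.
  apply: eq_big_seq => i iK; apply: eq_big_seq => x xi.
  apply: eq_bigr => k _; congr (_ * _).
  by rewrite (powk_separated om _ xi (FS _ iK) (sepS _ iK)).
by apply: cvg_sumr => i; exact: neig_cvg.
Qed.

End CountingFunction.

(** * Boxes, grids of boxes and the cost of the walls *)

Section Boxes.
Variables (R : realType) (d : nat).
Implicit Types (a c x y : Zd d) (l m q N : nat).

Definition grid_point a m q (g : {ffun 'I_d -> 'I_q}) : Zd d :=
  \row_i (a 0 i + m%:Z * (g i)%:Z).

Definition grid a m q : {fset Zd d} :=
  [fset grid_point a m g | g in {: {ffun 'I_d -> 'I_q}}]%fset.

Definition box a l : {fset Zd d} := grid a 1 l.

Lemma card_grid a m q : (0 < m)%N -> #|` grid a m q| = (q ^ d)%N.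
Proof.
move=> m0; rewrite /grid card_imfset /=; last first.
  move=> g h /rowP e; apply/ffunP => i; have := e i; rewrite !mxE => /addrI.
  have mz : m%:Z != 0 by case: m m0 {e}.
  by move=> /(mulfI mz) [] /val_inj.
by rewrite -cardE card_ffun !card_ord.
Qed.

Lemma card_box a l : #|` box a l| = (l ^ d)%N.
Proof. exact: card_grid. Qed.

Lemma in_box a l x : reflect (forall i, a 0 i <= x 0 i < a 0 i + l%:Z) (x \in box a l).
Proof.
apply: (iffP idP) => [/imfsetP[g _ ->] i|h].
  by rewrite !mxE mul1r lerDl ltrD2l /= ltz_nat ltn_ord.
have hi i : (absz (x ord0 i - a ord0 i) < l)%N.
  have /andP[h1 h2] := h i; rewrite -ltz_nat gez0_abs ?subr_ge0 //.
  by rewrite ltrBlDl.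
apply/imfsetP; exists [ffun i => Ordinal (hi i)] => //.
apply/rowP => i; rewrite mxE ffunE /= mul1r.
have /andP[h1 h2] := h i.
rewrite gez0_abs; last by rewrite subr_ge0; exact: h1.
by move: (x ord0 i) (a ord0 i) => s t; rewrite [RHS]addrC subrK.
Qed.

Lemma cube_box L : cube R d L = box (\row_i - (L./2)%:Z) L.
Proof.
rewrite /cube; set A := [set x | _].
have eA : A = [set` box (\row_i - (L./2)%:Z) L].
  apply/seteqP; split=> x /= h.
    apply/in_box => i; have := h i; rewrite mxE.
    have e : L%:R = (odd L)%:R + 2 * (L./2)%:R :> R.
      by rewrite -{1}(odd_double_half L) natrD -mul2n natrM.
    have e' : L%:Z = (odd L)%:Z + 2 * (L./2)%:Z.
      by rewrite -{1}(odd_double_half L) PoszD -mul2n PoszM.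
    move=> /andP[h1 h2].
    (* A strict bound by the integer just below the corner holds for both parities of [L], and
       integrality turns it into the corner itself. *)
    have g1 : (- (L./2)%:Z - 1)%:~R < (x ord0 i)%:~R :> R.
      rewrite intrD intrN; apply: lt_le_trans h1.
      by rewrite -[(_%:Z)%:~R]/(_%:R) e; case: odd => /=; lra.
    have g2 : (x ord0 i)%:~R < (- (L./2)%:Z + L%:Z)%:~R :> R.
      apply: lt_le_trans h2 _; rewrite intrD intrN -![(_%:Z)%:~R]/(_%:R) e.
      by case: odd => /=; lra.
    rewrite !ltr_int in g1 g2; apply/andP; split; last exact: g2.
    by move: g1; rewrite ltrBlDr ltzD1.
  move=> i; have /in_box/(_ i) := h; rewrite mxE => /andP[h1 h2].
  have e : L%:R = (odd L)%:R + 2 * (L./2)%:R :> R.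
    by rewrite -{1}(odd_double_half L) natrD -mul2n natrM.
  have h3 : x ord0 i <= - (L./2)%:Z + L%:Z - 1 by rewrite lerBrDr lezD1.
  move: h1 h3; rewrite -!(ler_int R) !(intrD, intrN) -![(_%:Z)%:~R]/(_%:R) e => h1 h3.
  by case: odd h1 h3 => /=; lra.
by rewrite eA set_fsetK.
Qed.

(** In a coordinate where the indices differ, sites of the two boxes are at least m - l + 1 >= 2
    apart. *)
Lemma separated_grid a m q l : (l < m)%N ->
  {in grid a m q &, forall c c', c != c' -> nonadjacent (box c l) (box c' l)}.
Proof.
move=> lm _ _ /imfsetP[g _ ->] /imfsetP[h _ ->] ngh x y /in_box hx /in_box hy.
have [i ngi] : exists i, g i != h i.
  apply/existsP; apply: contraNT ngh; rewrite negb_exists => /forallP e.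
  by apply/eqP/rowP => i; rewrite !mxE; have := e i; rewrite negbK => /eqP ->.
have := hx i; have := hy i; rewrite !mxE => /andP[y1 y2] /andP[x1 x2].
have far : 1 < `|y ord0 i - x ord0 i|.
  move: (x ord0 i) (y ord0 i) (a ord0 i) x1 x2 y1 y2 => s t b x1 x2 y1 y2.
  move: ngi; rewrite -val_eqE neq_ltn => /orP[] lt; rewrite ltr_normr; apply/orP; [left|right].
    have lt' : (m + m * g i <= m * h i)%N by rewrite -mulnS leq_mul2l lt orbT.
    rewrite -!PoszM in x1 x2 y1 y2.
    by move: (m * g i)%N (m * h i)%N lt' x1 x2 y1 y2 => u w; clear -lm; lia.
  have lt' : (m + m * h i <= m * g i)%N by rewrite -mulnS leq_mul2l lt orbT.
  rewrite -!PoszM in x1 x2 y1 y2.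
  by move: (m * g i)%N (m * h i)%N lt' x1 x2 y1 y2 => u w; clear -lm; lia.
split; first by apply: contraTneq far => ->; rewrite subrr normr0.
apply/negP => /mem_units /(nearest_neighbours_coord i); rewrite !mxE subr0.
by rewrite leNgt far.
Qed.

Lemma box_sub_grid a m q l N c : (l <= m)%N -> (q * m <= N)%N ->
  c \in grid a m q -> (box c l `<=` box a N)%fset.
Proof.
move=> lm qm /imfsetP[g _ ->]; apply/fsubsetP => x /in_box hx; apply/in_box => i.
have := hx i; rewrite mxE => /andP[h1 h2].
have h3 : 0 <= m%:Z * (g i)%:Z by rewrite -PoszM.
have h4 : m%:Z * (g i)%:Z + l%:Z <= N%:Z.
  rewrite -PoszM -PoszD lez_nat; apply: leq_trans qm.
  by have := ltn_ord (g i); nia.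
apply/andP; split; first by apply: le_trans h1; rewrite lerDl.
by apply: lt_le_trans h2 _; rewrite -addrA lerD2l.
Qed.

(** Deleting sites lowers the count, and normalizing by the smaller volume raises the quotient. Each
    effect is at most the proportion of deleted sites, and having opposite signs they do not add
    up. *)
Lemma neig_grid_average (om : Zd d -> R) a m q l N E :
  (l < m)%N -> (q * m <= N)%N -> (0 < l)%N -> (0 < q)%N ->
  `|(neig om (box a N) E)%:R / (N ^ d)%:R -
    (\sum_(c <- grid a m q) (neig om (box c l) E)%:R) / ((q * l) ^ d)%:R|
  <= 1 - ((q * l) ^ d)%:R / (N ^ d)%:R :> R.
Proof.
move=> lm qm l0 q0; have m0 : (0 < m)%N by exact: leq_ltn_trans lm.
pose S := (\bigcup_(c <- grid a m q) box c l)%fset.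
have SN : (S `<=` box a N)%fset.
  by apply/bigfcupsP => c cG _; apply: box_sub_grid qm cG; exact: ltnW.
have cS : #|` S| = ((q * l) ^ d)%N.
  apply/eqP; rewrite -(eqr_nat R); apply/eqP.
  transitivity (\sum_(x <- S) 1%R : R).
    by rewrite big_const_seq count_predT iter_addr_0.
  rewrite /S partition_disjoint_bigfcup; last first.
    move=> i j iK jK nij; apply/fdisjointP => x xi; apply/negP => xj.
    by have [] := separated_grid lm iK jK nij xi xj; rewrite eqxx.
  under eq_bigr do rewrite big_const_seq count_predT iter_addr_0 card_box.
  by rewrite big_const_seq count_predT iter_addr_0 card_grid // expnMn natrM mulr_natl.
have [h1 h2] := neig_interlacing om E SN.
have h3 := neig_card om S E.
rewrite card_box cS in h2 h3.
rewrite -natr_sum -(neig_bigfcup om E (separated_grid (a := a) (q := q) lm)) -/S.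
have s0 : (0 < (q * l) ^ d)%N by rewrite expn_gt0 muln_gt0 q0 l0.
have V0 : (0 < N ^ d)%N.
  by rewrite expn_gt0 (leq_trans _ qm) // muln_gt0 q0 m0.
move: ((q * l) ^ d)%N (N ^ d)%N (neig om S E) (neig om (box a N) E) s0 V0 h1 h2 h3.
move=> s V nS nV s0 V0 h1 h2 h3 {cS}.
have sV : (s <= V)%N by lia.
have {}s0 : 0 < s%:R :> R by rewrite ltr0n.
have {}V0 : 0 < V%:R :> R by rewrite ltr0n.
move: h1 h2 h3 sV; rewrite -!(ler_nat R) !natrD => h1 h2 h3 sV.
have nS0 : 0 <= nS%:R :> R by [].
move: (s%:R : R) (V%:R : R) (nS%:R : R) (nV%:R : R) s0 V0 h1 h2 h3 sV nS0 => {}s {}V {}nS {}nV s0 V0 h1 h2 h3 sV nS0.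
have iV : 0 < V^-1 by rewrite invr_gt0.
have is' : 0 < s^-1 by rewrite invr_gt0.
have isV : V^-1 <= s^-1 by rewrite lef_pV2 // posrE.
have Vi : V * V^-1 = 1 by rewrite divff // gt_eqF.
have si : s * s^-1 = 1 by rewrite divff // gt_eqF.
rewrite ler_norml; apply/andP; split.
  have : nS * V^-1 <= nV * V^-1 by rewrite ler_wpM2r // ltW.
  have : nS * (s^-1 - V^-1) <= s * (s^-1 - V^-1) by rewrite ler_wpM2r // subr_ge0.
  by rewrite !mulrBr si; lra.
have : (nV + s) * V^-1 <= (nS + V) * V^-1 by rewrite ler_wpM2r // ltW.
have : nS * V^-1 <= nS * s^-1 by rewrite ler_wpM2l.
by rewrite !mulrDl Vi; lra.
Qed.
End Boxes.

(** * Product laws: uniqueness, translation invariance, independence *)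

Section ProductLaw.
Local Open Scope ereal_scope.
Variables (R : realType) (d : nat).
Local Notation Om := (config R d).
Implicit Types (F : {fset Zd d}) (B : Zd d -> set (measurableTypeR R)).

Definition cylinder F B : set Om := [set om | forall k, k \in F -> B k (om k)].

Definition cylinders : set (set Om) :=
  [set A | exists F B, (forall k, measurable (B k)) /\ A = cylinder F B].

Lemma cylindersI : setI_closed cylinders.
Proof.
move=> _ _ [F [B [mB ->]]] [F' [B' [mB' ->]]].
exists (F `|` F')%fset, (fun k => (if k \in F then B k else setT) `&`
                          (if k \in F' then B' k else setT)).
split.
  by move=> k; apply: measurableI; case: ifP.
apply/seteqP; split=> om /=.
  by move=> [h h'] k _; split; case: ifP => // kF; [exact: h|exact: h'].
move=> h; split=> k kF.
  by have [] := h k; rewrite ?inE ?kF.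
by have [] := h k; rewrite ?inE ?kF ?orbT.
Qed.

Lemma measurable_coord k : measurable_fun setT (fun om : Om => om k : measurableTypeR R).
Proof.
move=> _ B mB; rewrite setTI; apply: sub_sigma_algebra; exists k, B; split=> //.
Qed.

Lemma measurable_cylinder F B : (forall k, measurable (B k)) -> measurable (cylinder F B).
Proof.
move=> mB.
have -> : cylinder F B = \bigcap_(k in [set` F]) ((fun om : Om => om k) @^-1` B k).
  by apply/seteqP; split.
apply: fin_bigcap_measurable => // k _.
by rewrite -[X in measurable X]setTI; exact: measurable_coord.
Qed.

Lemma measurable_config : (@measurable _ Om) = <<s cylinders >>.
Proof.
apply/seteqP; split.
  apply: smallest_sub; first exact: smallest_sigma_algebra.
  move=> _ [k [B [mB ->]]]; apply: sub_sigma_algebra.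
  exists [fset k]%fset, (fun=> B); split=> //.
  apply/seteqP; split=> om /=; first by move=> h j; rewrite inE => /eqP ->.
  by apply; rewrite inE.
apply: smallest_sub; first exact: sigma_algebra_measurable.
by move=> _ [F [B [mB ->]]]; exact: measurable_cylinder.
Qed.

Lemma measurable_to_config dX (X : measurableType dX) (phi : X -> Om) :
  (forall k, measurable_fun setT (fun x => phi x k : measurableTypeR R)) ->
  measurable_fun setT phi.
Proof.
move=> h.
apply: (@measurability _ _ X Om setT phi (@coordinate_cylinders R d) erefl).
move=> _ [_ [k [B [mB ->]]] <-].
exact: (h k measurableT _ mB).
Qed.

Section Uniqueness.
Variables (mu : probability (measurableTypeR R) R).

Lemma product_law_unique (m1 m2 : {measure set Om -> \bar R}) :
  (forall F B, (forall k, measurable (B k)) ->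
    m1 (cylinder F B) = \prod_(k <- F) mu (B k)) ->
  (forall F B, (forall k, measurable (B k)) ->
    m2 (cylinder F B) = \prod_(k <- F) mu (B k)) ->
  forall A, measurable A -> m1 A = m2 A.
Proof.
move=> h1 h2.
have T0 : cylinder fset0 (fun=> setT) = setT.
  by apply/seteqP; split.
apply: (measure_unique cylinders (fun=> setT)).
- exact: measurable_config.
- exact: cylindersI.
- by move=> _; exists fset0, (fun=> setT); split=> //.
- by rewrite bigcup_const //; exists 0%N.
- by move=> _ [F [B [mB ->]]]; rewrite h1 // h2.
- by move=> _; rewrite -T0 h1 // big_seq_fset0 ltry.
Qed.
End Uniqueness.

Variables (mu : probability (measurableTypeR R) R) (P : probability Om R).
Hypothesis hP : product_law mu P.

Lemma product_law_cylinder F B : (forall k, measurable (B k)) ->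
  P (cylinder F B) = \prod_(k <- F) mu (B k).
Proof. exact: hP. Qed.

Definition translate (c : Zd d) (om : Om) : Om := fun k => om (k + c)%R.

Lemma measurable_translate c : measurable_fun setT (translate c).
Proof. by apply: measurable_to_config => k; exact: measurable_coord. Qed.

(** The image of [P] under a translation gives cylinders the same mass, every coordinate having law
    [mu], so it is [P] again. *)
Lemma integral_translate c (f : Om -> \bar R) : measurable_fun setT f ->
  (forall om, 0 <= f om) -> \int[P]_om f (translate c om) = \int[P]_om f om.
Proof.
move=> mf f0.
rewrite -[LHS](ge0_integral_pushforward (measurable_translate c) P (D := setT)) //.
apply: eq_measure_integral => [|ms A mA _]; first exact: measurable_translate.
move: A mA; apply: (product_law_unique (mu := mu)); last exact: product_law_cylinder.
move=> F B mB; rewrite /= /pushforward.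
have -> : translate c @^-1` cylinder F B =
    cylinder [fset (k + c)%R | k in F]%fset (fun k => B (k - c)%R).
  apply/seteqP; split=> om /=.
    by move=> h _ /imfsetP[k kF ->]; rewrite addrK; exact: h.
  by move=> h k kF; have := h (k + c)%R; rewrite addrK; apply; apply/imfsetP; exists k.
rewrite product_law_cylinder // big_imfset /=; last by move=> i j _ _ /addIr.
by apply: eq_bigr => k _; rewrite addrK.
Qed.

Definition glue (S : pred (Zd d)) (w : Om * Om) : Om := fun k => if S k then w.1 k else w.2 k.

Lemma measurable_glue S : measurable_fun setT (glue S).
Proof.
apply: measurable_to_config => k; rewrite /glue; case: (S k).
  exact: (measurableT_comp (measurable_coord k) measurable_fst).
exact: (measurableT_comp (measurable_coord k) measurable_snd).
Qed.

(** Gluing two independent copies of the configuration along [S] reproduces [P]. Then [f] sees only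
    the first copy and [g] only the second, and Tonelli's theorem factors the integral. *)
Lemma independent_integral (S : pred (Zd d)) (f g : Om -> \bar R) :
  measurable_fun setT f -> measurable_fun setT g ->
  (forall om, 0 <= f om) -> (forall om, 0 <= g om) ->
  (forall om om', (forall k, S k -> om k = om' k) -> f om = f om') ->
  (forall om om', (forall k, ~~ S k -> om k = om' k) -> g om = g om') ->
  \int[P]_om (f om * g om) = \int[P]_om f om * \int[P]_om g om.
Proof.
move=> mf mg f0 g0 fS gS.
have mfg : measurable_fun setT (fun om => f om * g om) by exact: emeasurable_funM.
transitivity (\int[pushforward (P \x P) (glue S)]_om (f om * g om)).
  apply: eq_measure_integral => [|mS A mA _]; first exact: measurable_glue.
  move: A mA; apply: (product_law_unique (mu := mu)); first exact: product_law_cylinder.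
  move=> F B mB; rewrite /= /pushforward.
  have -> : glue S @^-1` cylinder F B =
     cylinder [fset k in F | S k]%fset B `*` cylinder [fset k in F | ~~ S k]%fset B.
    apply/seteqP; split=> -[w w'] /=; rewrite /glue /=.
      move=> h; split=> k /=; rewrite !inE /= => /andP[kF Sk]; have := h k kF;
      by rewrite ?Sk ?(negPf Sk).
    move=> [h h'] k kF; case: ifP => Sk; first by apply: h; rewrite !inE kF Sk.
    by apply: h'; rewrite !inE kF Sk.
  rewrite product_measure1E; try exact: measurable_cylinder.
  rewrite [RHS](big_fsetID _ S) /=.
  by congr (_ * _); exact: hP.
rewrite ge0_integral_pushforward //; first last.
- by move=> om _; rewrite mule_ge0.
- exact: measurable_glue.
rewrite preimage_setT fubini_tonelli1; first last.
- by move=> w /=; rewrite mule_ge0.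
- exact: (measurableT_comp mfg (measurable_glue S)).
rewrite /fubini_F.
transitivity (\int[P]_w (f w * \int[P]_w' g w')).
  apply: eq_integral => w _; rewrite -ge0_integralZl //.
  apply: eq_integral => w' _ /=; congr (_ * _).
    by apply: fS => k Sk; rewrite /glue Sk.
  by apply: gS => k Sk; rewrite /glue (negPf Sk).
by rewrite ge0_integralZr // integral_ge0.
Qed.

End ProductLaw.

(** * Random counting functions and almost surely bounded potentials *)

Section RandomCounting.
Variables (R : realType) (d : nat).
Local Notation Om := (config R d).
Implicit Types (om : Om) (S : {fset Zd d}) (A : pred (Zd d)).

Lemma measurable_coordR k : measurable_fun setT (fun om : Om => om k : R).
Proof. exact: measurable_coord. Qed.

Lemma measurable_powk A k y x :
  measurable_fun setT (fun om : Om => powk om A k y x : R).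
Proof.
elim: k x => [|k IH] x; first exact: measurable_cst.
pose f om : R := if A x then \sum_(e <- units d)
  (powk om A k y x - powk om A k y (x + e)) + om x * powk om A k y x else 0.
apply: (eq_measurable_fun f) => [om _|].
  by rewrite /f powkS /restricted andersonE.
rewrite /f; case: (A x); last exact: measurable_cst.
apply: measurable_funD; last by apply: measurable_funM; [exact: measurable_coordR|exact: IH].
by apply: measurable_sum => e; apply: measurable_funB; exact: IH.
Qed.

Lemma measurable_ploc A p x : measurable_fun setT (fun om : Om => ploc om A p x : R).
Proof.
apply: measurable_sum => k; apply: measurable_funM; first exact: measurable_cst.
exact: measurable_powk.
Qed.

Lemma measurable_neig S E : measurable_fun setT (fun om : Om => (neig om S E)%:R : R).
Proof.
apply: (measurable_fun_cvg (h := fun n (om : Om) =>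
    \sum_(x <- S) ploc om (mem S) (step_poly E n) x)).
  by move=> n; apply: measurable_sum => x; exact: measurable_ploc.
by move=> om _; exact: neig_cvg.
Qed.

Lemma neig_local om om' S E : (forall k, k \in S -> om k = om' k) ->
  neig om S E = neig om' S E.
Proof.
move=> h; have [P [lam dS]] := symmetric_diagonalizes (tr_hmx om S).
rewrite /neig (count_eigenvaluesE E dS); apply/esym/count_eigenvaluesE.
suff -> : hmx om' S = hmx om S by exact: dS.
by apply/matrixP => i j; rewrite !mxE /kern h // (valP (enum_val i)).
Qed.

Lemma powk_translate (c : Zd d) om A k (y x : Zd d) :
  powk (translate c om) A k y x = powk om (fun z => A (z - c)) k (y + c) (x + c).
Proof.
elim: k x => [|k IH] x.
  by rewrite /powk /= /delta (inj_eq (addIr c)).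
rewrite !powkS /restricted addrK; case: (A x) => //.
rewrite !andersonE IH; congr (_ + _); apply: eq_bigr => e _.
by rewrite IH addrAC.
Qed.

Lemma in_box_translate (c a : Zd d) l x : (x + c \in box (a + c) l) = (x \in box a l).
Proof.
by apply/in_box/in_box => h i; have := h i; rewrite !mxE addrAC lerD2r ltrD2r.
Qed.

Lemma neig_translate (c : Zd d) om (a : Zd d) l E :
  neig (translate c om) (box a l) E = neig om (box (a + c) l) E.
Proof.
apply/eqP; rewrite -(eqr_nat R); apply/eqP.
apply: (@cvg_unique _ (@Rhausdorff R) _ _ _ _ (@neig_cvg R d (translate c om) (box a l) E)).
have -> : (fun n => \sum_(x <- box a l) ploc (translate c om) (mem (box a l)) (step_poly E n) x) =
    (fun n => \sum_(x <- box (a + c) l) ploc om (mem (box (a + c) l)) (step_poly E n) x).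
  apply/funext => n.
  pose tr (x : Zd d) : Zd d := x + c.
  have -> : box (a + c) l = [fset tr x | x in box a l]%fset.
    apply/fsetP => z; apply/idP/imfsetP => [zb|[x xb ->]]; last by rewrite in_box_translate.
    exists (z - c); last by rewrite /tr subrK.
    by have := in_box_translate c a l (z - c); rewrite subrK zb => /esym.
  rewrite [RHS]big_imfset /=; last by move=> i j _ _ /addIr.
  apply: eq_bigr => x _; apply: eq_bigr => k _; congr (_ * _).
  rewrite powk_translate; congr (powk _ _ _ _ _); apply/funext => z /=.
  apply/idP/imfsetP => [zb|[y yb ->]]; last by rewrite /tr addrK.
  by exists (z - c); rewrite /tr ?subrK.
exact: neig_cvg.
Qed.

Section AlmostSurelyBounded.
Variables (mu : probability (measurableTypeR R) R) (P : probability Om R).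
Hypotheses (hP : product_law mu P) (bmu : boundedly_supported mu).

(** A point outside the support has a ball of mass zero, hence lies in a null interval with rational
    ends. The sets [F n] enumerate these countably many intervals. *)
Lemma null_outside_support :
  exists2 M : R, 0 <= M & mu (~` `[- M, M]%classic) = 0%E.
Proof.
have [M0 [_ hM]] := bmu; pose M := Num.max 0 (M0 + 1).
have supM x : topological_support mu x -> `|x| <= M.
  by apply: hM; rewrite /M lt_max ltrDl ltr01 orbT.
exists M; first by rewrite le_max lexx.
pose I (ab : rat * rat) : set (measurableTypeR R) := `]ratr ab.1, ratr ab.2[%classic.
have mI ab : measurable (I ab) by exact: measurable_itv.
pose F n : set (measurableTypeR R) := if (choice.unpickle n : option (rat * rat)) is Some ab then
  (if mu (I ab) == 0%E then I ab else set0) else set0.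
have mF n : measurable (F n).
  by rewrite /F; case: choice.unpickle => // ab; case: ifP.
have F0 n : mu (F n) = 0%E.
  rewrite /F; case: choice.unpickle => [ab|]; last exact: measure0.
  by case: eqP => // _; exact: measure0.
have neg : mu.-negligible (\bigcup_n F n).
  by apply: negligible_bigcup => n; exists (F n); split=> //; exact: F0.
have sub : ~` `[- M, M]%classic `<=` \bigcup_n F n.
  move=> x /= xM.
  have nx : ~ topological_support mu x.
    by move=> /supM; rewrite ler_norml => h; apply: xM; rewrite in_itv.
  have [e e0 mue] : exists2 e, 0 < e & mu (ball x e) = 0%E.
    apply: contrapT => h; apply: nx => e e0; rewrite lt_neqAle measure_ge0 andbT.
    by apply/eqP => h0; apply: h; exists e.
  have xl : x - e < x by rewrite gtrBl.
  have xr : x < x + e by rewrite ltrDl.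
  have [a] := rat_in_itvoo xl; rewrite in_itv /= => /andP[a1 a2].
  have [b] := rat_in_itvoo xr; rewrite in_itv /= => /andP[b1 b2].
  have [n en] : exists n, choice.unpickle n = Some (a, b).
    by exists (choice.pickle (a, b)); exact: choice.pickleK.
  exists n => //; rewrite /F en ifT; last first.
    rewrite eq_le measure_ge0 andbT -mue; apply: le_measure; rewrite ?inE //.
      exact: measurable_ball.
    move=> z; rewrite /I /= in_itv /= => /andP[z1 z2].
    by rewrite /ball /= distrC ltr_distl; apply/andP; split; [exact: lt_trans z1|exact: lt_trans b2].
  by rewrite /I /= in_itv /= a2 b1.
apply/negligibleP; last exact: negligibleS neg.
by apply: measurableC; exact: measurable_itv.
Qed.

(** A countable intersection of coordinate events, hence measurable and, for suitable [M], of full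
    probability. The infinite-volume operator is studied on this event, where it is bounded. *)
Definition bounded_configs (M : R) : set Om := [set om | forall k, `|om k| <= M].

Lemma bounded_configsE M :
  bounded_configs M = \bigcap_n (if (choice.unpickle n : option (Zd d)) is Some k
    then (fun om : Om => om k) @^-1` `[- M, M]%classic else setT).
Proof.
apply/seteqP; split=> om h.
  move=> n _; case: choice.unpickle => // k /=; rewrite in_itv /= -ler_norml; exact: h.
move=> k; have := h (choice.pickle k) I; rewrite choice.pickleK /= in_itv /= -ler_norml; exact.
Qed.

Lemma measurable_bounded_configs M : measurable (bounded_configs M).
Proof.
rewrite bounded_configsE; apply: bigcapT_measurable => n; case: choice.unpickle => // k.
by rewrite -[X in measurable X]setTI; apply: measurable_coord => //; exact: measurable_itv.
Qed.

Lemma probability_bounded_configs : exists2 M : R, 0 <= M & P (bounded_configs M) = 1%E.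
Proof.
have [M M0 hM] := null_outside_support; exists M => //.
suff : P (~` bounded_configs M) = 0%E.
  move=> h; rewrite -[bounded_configs M]setCK probability_setC; last first.
    by apply: measurableC; exact: measurable_bounded_configs.
  by move: h => /= ->; rewrite sube0.
apply/negligibleP; first by apply: measurableC; exact: measurable_bounded_configs.
rewrite bounded_configsE setC_bigcap; apply: negligible_bigcup => n.
case: choice.unpickle => [k|]; last by rewrite setCT; exact: negligible_set0.
exists (cylinder [fset k]%fset (fun=> ~` `[- M, M]%classic)).
have mC : measurable (~` `[- M, M]%classic : set (measurableTypeR R)).
  by apply: measurableC; exact: measurable_itv.
split.
- exact: measurable_cylinder.
- by apply: etrans (hP [fset k]%fset (B := fun=> _) (fun=> mC)) _; rewrite big_seq_fset1.
- by move=> om /= h j; rewrite inE => /eqP ->.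
Qed.

End AlmostSurelyBounded.
End RandomCounting.

(** * Summable families and the inner product *)

Section SquareSummable.
Variables (R : realType) (T : choiceType).
Implicit Types (f g h phi psi : T -> R) (a : R).

Definition rsummable f : Prop := summable [set: T] (fun x => (f x)%:E).

(** The sum behind [inner], detached from products so that its linearity is proved once. *)
Definition tsum f : R :=
  fine (\esum_(x in [set: T]) ((fun x => (f x)%:E)^\+ x)%E) -
  fine (\esum_(x in [set: T]) ((fun x => (f x)%:E)^\- x)%E).

Lemma inner_tsum phi psi : inner phi psi = tsum (fun x => phi x * psi x).
Proof. by []. Qed.

Lemma rsummable_le f g : rsummable g -> (forall x, `|f x| <= g x) -> rsummable f.
Proof.
move=> sg fg; apply: le_lt_trans sg; apply: le_esum => x _.
by rewrite lee_fin (le_trans (fg x)) // ler_norm.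
Qed.

Lemma rsummableD f g : rsummable f -> rsummable g -> rsummable (fun x => f x + g x).
Proof. exact: summableD. Qed.

Lemma rsummable_norm f : rsummable f -> rsummable (fun x => `|f x|).
Proof.
move=> sf; apply: le_lt_trans sf; apply: le_esum => x _.
by rewrite /= normr_id.
Qed.

Lemma esumZ a f : 0 <= a -> (forall x, 0 <= f x) ->
  (\esum_(x in [set: T]) (a * f x)%:E = a%:E * \esum_(x in [set: T]) (f x)%:E)%E.
Proof.
rewrite le_eqVlt => /orP[/eqP <- _|a0 f0].
  by rewrite mul0e esum1 // => x _; rewrite mul0r.
have le b g : 0 < b -> (forall x, 0 <= g x) ->
   (\esum_(x in [set: T]) (b * g x)%:E <= b%:E * \esum_(x in [set: T]) (g x)%:E)%E.
  move=> b0 g0; apply: ge_ereal_sup => _ [F [finF FT] <-].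
  apply: (@le_trans _ _ (b%:E * \sum_(x \in F) (g x)%:E)%E).
    rewrite ge0_mule_fsumr; last by move=> x; rewrite lee_fin.
    by rewrite le_eqVlt; apply/orP; left; apply/eqP; apply: eq_fsbigr => x _; rewrite EFinM.
  rewrite lee_pmul2l // ?fin_numE //.
  by apply: ereal_sup_ubound; exists F.
apply/eqP; rewrite eq_le le //=.
(* The reverse inequality is the one just proved, for the scalar [a^-1] and the family [a * f]. *)
have := le a^-1 (fun x => a * f x); rewrite invr_gt0 => /(_ a0).
have -> : (fun x => (a^-1 * (a * f x))%:E) = (fun x => (f x)%:E).
  by apply/funext => x; rewrite mulKf // gt_eqF.
move=> h; have {}h := h (fun x => mulr_ge0 (ltW a0) (f0 x)).
have := lee_wpmul2l (ltW a0 : (0 <= a%:E)%E) h.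
by rewrite muleA -EFinM divff ?gt_eqF // mul1e.
Qed.

Lemma rsummableZ a f : rsummable f -> rsummable (fun x => a * f x).
Proof.
move=> sf; rewrite /rsummable /summable.
under eq_esum do rewrite abse_EFin normrM.
by rewrite esumZ //; apply: lte_mul_pinfty.
Qed.

Definition esumr f : R := fine (\esum_(x in [set: T]) (f x)%:E).

Lemma rsummable_fin f : rsummable f -> (forall x, 0 <= f x) ->
  (\esum_(x in [set: T]) (f x)%:E \is a fin_num)%E.
Proof.
move=> sf f0; have := sf; rewrite /rsummable summableE.
by congr (_ \is a fin_num); apply: eq_esum => x _; rewrite abse_EFin ger0_norm.
Qed.

(** Every splitting into nonnegative summable families computes the sum, not only the one into
    positive and negative parts. Additivity follows from this freedom, by the splitting
    [|f| - (|f| - f)]. *)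
Lemma tsumB g h : rsummable g -> rsummable h -> (forall x, 0 <= g x) ->
  (forall x, 0 <= h x) -> tsum (fun x => g x - h x) = esumr g - esumr h.
Proof.
move=> sg sh g0 h0.
have := @esumB R T [set: T] (fun x => (g x)%:E) (fun x => (h x)%:E) sg sh.
move=> /(_ (fun x _ => g0 x) (fun x _ => h0 x)).
have sgh : rsummable (fun x => g x - h x).
  by apply: (rsummable_le (rsummableD sg sh)) => x;
    rewrite (le_trans (ler_normB _ _)) // !ger0_norm.
have finp : (\esum_(x in [set: T]) ((fun x => (g x - h x)%:E)^\+ x)%E \is a fin_num)%E.
  have := summable_funepos sgh; rewrite summableE.
  by congr (_ \is a fin_num); apply: eq_esum => x _; rewrite gee0_abs.
have finn : (\esum_(x in [set: T]) ((fun x => (g x - h x)%:E)^\- x)%E \is a fin_num)%E.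
  have := summable_funeneg sgh; rewrite summableE.
  by congr (_ \is a fin_num); apply: eq_esum => x _; rewrite gee0_abs.
have fg := rsummable_fin sg g0; have fh := rsummable_fin sh h0.
move=> e; rewrite /tsum /esumr -!fineB //.
by congr fine; exact: e.
Qed.

Lemma esumrD g h : rsummable g -> rsummable h -> (forall x, 0 <= g x) ->
  (forall x, 0 <= h x) -> esumr (fun x => g x + h x) = esumr g + esumr h.
Proof.
move=> sg sh g0 h0; rewrite /esumr -fineD ?rsummable_fin // -esumD //;
  by move=> x _; rewrite lee_fin.
Qed.

Lemma tsum_split f : rsummable f -> tsum f = esumr (fun x => `|f x|) - esumr (fun x => `|f x| - f x).
Proof.
move=> sf; rewrite -tsumB; first by congr tsum; apply/funext => x; rewrite opprB addrC subrK.
- exact: rsummable_norm.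
- apply: (rsummable_le (rsummableZ 2 (rsummable_norm sf))) => x.
  by rewrite (le_trans (ler_normB _ _)) // normr_id mulr_natl.
- by [].
- by move=> x; rewrite subr_ge0 ler_norm.
Qed.

Lemma rsummable_neg f : rsummable f -> rsummable (fun x => `|f x| - f x).
Proof.
move=> sf; apply: (rsummable_le (rsummableZ 2 (rsummable_norm sf))) => x.
by rewrite (le_trans (ler_normB _ _)) // normr_id mulr_natl.
Qed.

Lemma tsumD f g : rsummable f -> rsummable g -> tsum (fun x => f x + g x) = tsum f + tsum g.
Proof.
move=> sf sg.
have nf := rsummable_norm sf; have ng := rsummable_norm sg.
have mf := rsummable_neg sf; have mg := rsummable_neg sg.
have p0 (k : T -> R) x : 0 <= `|k x| - k x by rewrite subr_ge0 ler_norm.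
rewrite !tsum_split ?opprD 1?addrACA //; last exact: rsummableD.
rewrite -tsum_split; last exact: rsummableD.
rewrite -opprD -!esumrD // -tsumB; first last.
- by move=> x; rewrite addr_ge0.
- by move=> x; rewrite addr_ge0.
- exact: rsummableD.
- exact: rsummableD.
by congr tsum; apply/funext => x; ring.
Qed.

Lemma tsum_ge0 f : (forall x, 0 <= f x) -> 0 <= tsum f.
Proof.
move=> f0; rewrite /tsum [X in _ - fine X]esum1 ?subr0.
  by apply: fine_ge0; apply: esum_ge0.
by move=> x _; rewrite funenegE -EFinN; apply/max_idPr; rewrite lee_fin oppr_le0.
Qed.

Lemma tsumN f : rsummable f -> tsum (fun x => - f x) = - tsum f.
Proof.
move=> sf; have sN : rsummable (fun x => - f x).
  by apply: (rsummable_le (rsummable_norm sf)) => x; rewrite normrN.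
apply/eqP; rewrite -addr_eq0 -tsumD //.
have -> : (fun x => - f x + f x) = fun=> 0 by apply/funext => x; rewrite addNr.
rewrite eq_le tsum_ge0 // andbT -oppr_ge0.
rewrite /tsum !esum1 ?subrr ?oppr0 // => x _; rewrite ?funeposE ?funenegE ?oppe0; exact/max_idPl.
Qed.

Lemma tsumZ a f : rsummable f -> tsum (fun x => a * f x) = a * tsum f.
Proof.
move=> sf.
have pos b : 0 <= b -> tsum (fun x => b * f x) = b * tsum f.
  move=> b0; rewrite (tsum_split sf) mulrBr.
  have eZ g : rsummable g -> (forall x, 0 <= g x) -> b * esumr g = esumr (fun x => b * g x).
    by move=> sg g0; rewrite /esumr esumZ // fineM // ?rsummable_fin.
  have sn := rsummable_norm sf; have sm := rsummable_neg sf.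
  rewrite !eZ //; last by move=> x; rewrite subr_ge0 ler_norm.
  rewrite -tsumB.
  - by congr tsum; apply/funext => x; ring.
  - exact/rsummableZ/rsummable_norm.
  - exact/rsummableZ/rsummable_neg.
  - by move=> x; rewrite mulr_ge0.
  - by move=> x; rewrite mulr_ge0 // subr_ge0 ler_norm.
have [a0|a0] := leP 0 a; first exact: pos.
rewrite -[a]opprK mulNr -pos ?oppr_ge0 ?ltW // -tsumN; last exact: rsummableZ.
by congr tsum; apply/funext => x; ring.
Qed.

Lemma tsum_le f g : rsummable f -> rsummable g -> (forall x, f x <= g x) -> tsum f <= tsum g.
Proof.
move=> sf sg fg; rewrite -subr_ge0 -tsumN // -tsumD //.
  by apply: tsum_ge0 => x; rewrite subr_ge0.
by apply: (rsummable_le (rsummable_norm sf)) => x; rewrite normrN.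
Qed.

Lemma tsum_reindex (e e' : T -> T) f : cancel e e' -> cancel e' e ->
  tsum (fun x => f (e x)) = tsum f.
Proof.
move=> ee' e'e; have be : set_bij [set: T] [set: T] e.
  by split=> // [x y _ _ /(can_inj ee')|y _] //; exists (e' y).
rewrite /tsum; congr (fine _ - fine _); apply/esym.
  apply: etrans (@reindex_esum R T T setT setT e ((fun x => (f x)%:E)^\+)%E be) _.
  by apply: eq_esum => x _; rewrite !funeposE.
apply: etrans (@reindex_esum R T T setT setT e ((fun x => (f x)%:E)^\-)%E be) _.
by apply: eq_esum => x _; rewrite !funenegE.
Qed.

Lemma rsummable_reindex (e e' : T -> T) f : cancel e e' -> cancel e' e ->
  rsummable f -> rsummable (fun x => f (e x)).
Proof.
move=> ee' e'e; have be : set_bij [set: T] [set: T] e.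
  by split=> // [x y _ _ /(can_inj ee')|y _] //; exists (e' y).
by rewrite /rsummable /summable
  (@reindex_esum R T T setT setT e (fun x => `|(f x)%:E|%E) be).
Qed.

Lemma esum_point (y : T) (F : T -> \bar R) : (0 <= F y)%E -> (forall x, x != y -> F x = 0%E) ->
  (\esum_(x in [set: T]) F x = F y)%E.
Proof.
move=> F0 Fy; rewrite (esumID [set y]); last first.
  by move=> x _; have [->|/Fy ->] := eqVneq x y.
rewrite setTI esum_set1 // esum1 ?adde0 // => x [_ /= /eqP]; exact: Fy.
Qed.

Lemma tsum_point (y : T) f : (forall x, x != y -> f x = 0) -> tsum f = f y.
Proof.
move=> fy; rewrite /tsum !(esum_point (y := y)) //.
- rewrite funeposE funenegE -!EFinN -!EFin_max /=; have [h|h] := leP 0 (f y).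
    by rewrite max_r ?oppr_le0 // subr0.
  by rewrite max_l ?oppr_ge0 ?ltW // sub0r opprK.
- by move=> x /fy; rewrite funenegE => ->; rewrite oppe0; exact/max_idPl.
- by move=> x /fy; rewrite funeposE => ->; exact/max_idPl.
Qed.

Lemma rsummable_point (y : T) f : (forall x, x != y -> f x = 0) -> rsummable f.
Proof.
move=> fy; rewrite /rsummable /summable (esum_point (y := y)) ?ltry //.
by move=> x /fy ->; rewrite abse0.
Qed.

Lemma rsummableM phi psi : l2 phi -> l2 psi -> rsummable (fun x => phi x * psi x).
Proof.
move=> h1 h2; apply: (rsummable_le (rsummableD h1 h2)) => x.
rewrite normrM -[phi x ^+ 2]real_normK ?num_real // -[psi x ^+ 2]real_normK ?num_real //.
move: (normr_ge0 (phi x)) (normr_ge0 (psi x)); set u := `|phi x|; set v := `|psi x|; nra.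
Qed.

Lemma l2D phi psi : l2 phi -> l2 psi -> l2 (fun x => phi x + psi x).
Proof.
move=> h1 h2; apply: (rsummable_le (rsummableZ 2 (rsummableD h1 h2))) => x.
rewrite ger0_norm ?sqr_ge0 //; have := sqr_ge0 (phi x - psi x).
by rewrite -subr_ge0 => h; rewrite -subr_ge0; apply: le_trans h _; rewrite le_eqVlt; apply/orP; left; apply/eqP; ring.
Qed.

Lemma l2_bounded (b : R) phi psi : l2 psi -> (forall x, `|phi x| <= b * `|psi x|) -> l2 phi.
Proof.
move=> h1 hb; apply: (rsummable_le (rsummableZ (b ^+ 2) h1)) => x.
rewrite ger0_norm ?sqr_ge0 // -[phi x ^+ 2]real_normK ?num_real //.
rewrite -[psi x ^+ 2]real_normK ?num_real // -exprMn.
by rewrite lerXn2r ?nnegrE // (le_trans _ (hb x)).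
Qed.

Lemma l2Z a psi : l2 psi -> l2 (fun x => a * psi x).
Proof. by move=> h; apply: (l2_bounded h (b := `|a|)) => x; rewrite normrM. Qed.

Lemma l20 : l2 (fun _ : T => 0 : R).
Proof.
by apply: le_lt_trans (ltry 0); rewrite esum1 // => x _; rewrite expr0n /= normr0.
Qed.

Lemma l2_reindex (e e' : T -> T) psi : cancel e e' -> cancel e' e ->
  l2 psi -> l2 (fun x => psi (e x)).
Proof. by move=> ee' e'e; exact: (rsummable_reindex (f := fun x => psi x ^+ 2) ee' e'e). Qed.

Lemma innerC phi psi : inner phi psi = inner psi phi.
Proof. by rewrite !inner_tsum; congr tsum; apply/funext => x; rewrite mulrC. Qed.

Lemma innerDl phi phi' psi : l2 phi -> l2 phi' -> l2 psi ->
  inner (fun x => phi x + phi' x) psi = inner phi psi + inner phi' psi.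
Proof.
move=> h1 h2 h3; rewrite !inner_tsum -tsumD; try exact: rsummableM.
by congr tsum; apply/funext => x; rewrite mulrDl.
Qed.

Lemma innerZl a phi psi : l2 phi -> l2 psi ->
  inner (fun x => a * phi x) psi = a * inner phi psi.
Proof.
move=> h1 h2; rewrite !inner_tsum -tsumZ; last exact: rsummableM.
by congr tsum; apply/funext => x; rewrite mulrA.
Qed.

Lemma innerDr phi psi psi' : l2 phi -> l2 psi -> l2 psi' ->
  inner phi (fun x => psi x + psi' x) = inner phi psi + inner phi psi'.
Proof. by move=> *; rewrite innerC innerDl // !(innerC phi). Qed.

Lemma innerZr a phi psi : l2 phi -> l2 psi ->
  inner phi (fun x => a * psi x) = a * inner phi psi.
Proof. by move=> *; rewrite innerC innerZl // innerC. Qed.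

Lemma inner_ge0 psi : 0 <= inner psi psi.
Proof. by rewrite inner_tsum tsum_ge0 // => x; rewrite -expr2 sqr_ge0. Qed.

Lemma inner_point y psi : inner (fun x => (x == y)%:R) psi = psi y.
Proof.
rewrite inner_tsum (tsum_point (y := y)) ?eqxx ?mul1r // => x /negPf ->.
by rewrite mul0r.
Qed.

Lemma l2_point y : l2 (fun x : T => (x == y)%:R : R).
Proof. by apply: (rsummable_point (y := y)) => x /negPf ->; rewrite expr0n. Qed.

Lemma inner_eq0 psi : l2 psi -> inner psi psi = 0 -> psi = fun=> 0.
Proof.
move=> h e; apply/funext => y; apply/eqP; rewrite -sqrf_eq0 eq_le sqr_ge0 andbT -e.
pose f x := psi y ^+ 2 * (x == y)%:R.
have <- : tsum f = psi y ^+ 2.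
  by rewrite (tsum_point (y := y)) /f ?eqxx ?mulr1 // => x /negPf ->; rewrite mulr0.
rewrite inner_tsum; apply: tsum_le; last first.
- by move=> x; rewrite /f; case: eqP => [->|_]; rewrite ?mulr1 -?expr2 // mulr0 sqr_ge0.
- exact: rsummableM.
- by apply: (rsummable_point (y := y)) => x /negPf; rewrite /f => ->; rewrite mulr0.
Qed.

End SquareSummable.

(** * The Anderson operator with bounded potential *)

Section BoundedAnderson.
Variables (R : realType) (d : nat) (om : Zd d -> R) (M : R).
Hypothesis omM : forall k, `|om k| <= M.
Implicit Types (phi psi u v : Zd d -> R) (e : Zd d).
Local Notation H := (anderson om).
Local Notation D := (#|` units d|%:R : R).

Lemma l2_sum (I : Type) (r : seq I) (F : I -> Zd d -> R) :
  (forall i, l2 (F i)) -> l2 (fun x => \sum_(i <- r) F i x).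
Proof.
move=> h; elim: r => [|i r IH].
  by under eq_fun do rewrite big_nil; exact: l20.
rewrite (_ : (fun _ => _) = fun x => F i x + \sum_(j <- r) F j x); first exact: l2D.
by apply/funext => x; rewrite big_cons.
Qed.

Lemma inner_sumr (I : Type) (r : seq I) (F : I -> Zd d -> R) phi :
  l2 phi -> (forall i, l2 (F i)) ->
  inner phi (fun x => \sum_(i <- r) F i x) = \sum_(i <- r) inner phi (F i).
Proof.
move=> hp h; elim: r => [|i r IH].
  rewrite big_nil (_ : (fun _ => _) = fun x => 0 * phi x).
    by rewrite innerZr // mul0r.
  by apply/funext => x; rewrite big_nil mul0r.
rewrite big_cons -IH (_ : (fun _ => _) = fun x => F i x + \sum_(j <- r) F j x).
  by rewrite innerDr //; exact: l2_sum.
by apply/funext => x; rewrite big_cons.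
Qed.

Lemma l2_translate e psi : l2 psi -> l2 (fun x => psi (x + e)).
Proof. by apply: (l2_reindex (e' := fun x => x - e)) => x; rewrite ?addrK ?subrK. Qed.

Lemma inner_translate e phi psi :
  inner (fun x => phi (x - e)) psi = inner phi (fun x => psi (x + e)).
Proof.
rewrite !inner_tsum -(tsum_reindex (e := fun x => x + e) (e' := fun x => x - e)
  (fun x => phi (x - e) * psi x)); try by move=> x; rewrite ?addrK ?subrK.
by congr tsum; apply/funext => x; rewrite addrK.
Qed.

Lemma anderson_hopping psi :
  H psi = fun x => (D + om x) * psi x + (-1) * \sum_(e <- units d) psi (x + e).
Proof.
apply/funext => x; rewrite andersonE big_split /= sumrN.
have -> : \sum_(e <- units d) psi x = D * psi x.
  by rewrite big_const_seq count_predT iter_addr_0 mulr_natl.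
by ring.
Qed.

Lemma l2_potential psi : l2 psi -> l2 (fun x => (D + om x) * psi x).
Proof.
move=> h; apply: (l2_bounded (b := D + M) h) => x; rewrite normrM ler_wpM2r //.
by rewrite (le_trans (ler_normD _ _)) // ger0_norm // lerD2l.
Qed.

Lemma l2_hopping psi : l2 psi -> l2 (fun x => \sum_(e <- units d) psi (x + e)).
Proof. by move=> h; apply: l2_sum => e; exact: l2_translate. Qed.

Lemma l2_anderson psi : l2 psi -> l2 (H psi).
Proof.
move=> h; rewrite anderson_hopping; apply: l2D; first exact: l2_potential.
by apply: l2Z; exact: l2_hopping.
Qed.

Lemma inner_anderson phi psi : l2 phi -> l2 psi -> inner phi (H psi) =
  inner phi (fun x => (D + om x) * psi x) -
  \sum_(e <- units d) inner phi (fun x => psi (x + e)).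
Proof.
move=> h1 h2; rewrite anderson_hopping innerDr //; first last.
- by apply: l2Z; exact: l2_hopping.
- exact: l2_potential.
rewrite innerZr //; last exact: l2_hopping.
rewrite inner_sumr // ?mulN1r // => e; exact: l2_translate.
Qed.

Lemma anderson_sym phi psi : l2 phi -> l2 psi -> inner phi (H psi) = inner (H phi) psi.
Proof.
move=> h1 h2; rewrite [RHS]innerC !inner_anderson //; congr (_ - _).
  by rewrite !inner_tsum; congr tsum; apply/funext => x; ring.
transitivity (\sum_(e <- [seq - e | e <- units d]) inner phi (fun x => psi (x + e))).
  apply: perm_big; apply: uniq_perm.
  - exact: fset_uniq.
  - by rewrite map_inj_uniq ?fset_uniq //; exact: oppr_inj.
  - move=> e; apply/idP/mapP => [eU|[e' eU ->]]; last by rewrite mem_unitsN.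
    by exists (- e); rewrite ?opprK ?mem_unitsN.
rewrite big_map; apply: eq_bigr => e _.
by rewrite -(inner_translate e psi phi) innerC.
Qed.

(** The translate [t] has the same norm as [u], and the squared norms of [u + t] and [u - t] are
    nonnegative. *)
Lemma inner_translate_le e u : l2 u -> `|inner u (fun x => u (x + e))| <= inner u u.
Proof.
move=> h; have h' := l2_translate e h; set t := fun x => _ in h' *.
have ett : inner t t = inner u u.
  rewrite !inner_tsum -[RHS](tsum_reindex (e := fun x => x + e) (e' := fun x => x - e)) //;
  by move=> x; rewrite ?addrK ?subrK.
have sq (a : R) : inner (fun x => u x + a * t x) (fun x => u x + a * t x) =
    inner u u + 2 * a * inner u t + a ^+ 2 * inner u u.
  have ha : l2 (fun x => a * t x) by exact: l2Z.
  have hs := l2D h ha.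
  by rewrite innerDl // !innerDr // !innerZl // !innerZr // ett (innerC t u); ring.
have := inner_ge0 (fun x => u x + 1 * t x); have := inner_ge0 (fun x => u x + (-1) * t x).
by rewrite !sq ler_norml => h1 h2; apply/andP; split; lra.
Qed.

(** A bound on the quadratic form is enough: it is what confines the spectral resolution to a
    bounded interval. *)
Lemma anderson_bound u : l2 u -> `|inner u (H u)| <= (2 * D + M) * inner u u.
Proof.
move=> h; rewrite inner_anderson //.
have i0 := inner_ge0 u.
have h1 : `|inner u (fun x => (D + om x) * u x)| <= (D + M) * inner u u.
  rewrite inner_tsum ler_norml -!mulNr inner_tsum; have su := rsummableM h h.
  have sp := rsummableM h (l2_potential h).
  have hD x : `|D + om x| <= D + M.
    by rewrite (le_trans (ler_normD _ _)) // ger0_norm // lerD2l.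
  rewrite -!tsumZ //; apply/andP; split; apply: tsum_le => //; try exact: rsummableZ.
    move=> x; rewrite [leRHS]mulrCA; have := hD x; rewrite ler_norml => /andP[h1 _].
    by rewrite ler_wpM2r // -expr2 sqr_ge0.
  move=> x; rewrite [leLHS]mulrCA; have := hD x; rewrite ler_norml => /andP[_ h1].
  by rewrite ler_wpM2r // -expr2 sqr_ge0.
have h2 : `|\sum_(e <- units d) inner u (fun x => u (x + e))| <= D * inner u u.
  rewrite (le_trans (ler_norm_sum _ _ _)) //.
  rewrite [leRHS](_ : _ = \sum_(e <- units d) inner u u); last first.
    by rewrite big_const_seq count_predT iter_addr_0 mulr_natl.
  by apply: ler_sum => e _; exact: inner_translate_le.
by rewrite (le_trans (ler_normB _ _)) // (le_trans (lerD h1 h2)) // le_eqVlt;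
  apply/orP; left; apply/eqP; ring.
Qed.

End BoundedAnderson.

(** * The mean of a finite measure through its distribution function *)

Section StepIntegral.
Local Open Scope ereal_scope.
Variables (R : realType) (nu : {measure set (measurableTypeR R) -> \bar R}).
Hypothesis fin_nu : nu setT < +oo.

Lemma measurable_ident : measurable_fun setT (fun x : measurableTypeR R => x%:E).
Proof. exact/measurable_EFinP. Qed.

Lemma integrable_ident : \int[nu]_x (x ^+ 2)%:E < +oo ->
  nu.-integrable setT (fun x : measurableTypeR R => x%:E).
Proof.
move=> h.
have msq : measurable_fun setT (fun x : measurableTypeR R => (x ^+ 2)%:E).
  by apply/measurable_EFinP; exact: measurable_funX.
have i2 : nu.-integrable setT (fun x : measurableTypeR R => (x ^+ 2)%:E).
  apply/integrableP; split=> //.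
  under eq_integral do rewrite gee0_abs ?lee_fin ?sqr_ge0 //.
  exact: h.
have i1 : nu.-integrable setT (fun=> 1).
  apply/integrableP; split; first exact: measurable_cst.
  by under eq_integral do rewrite abse1; rewrite integral_cst // mul1e.
apply: (le_integrable _ _ _ (integrableD _ i1 i2)) => //; first exact: measurable_ident.
move=> x _ /=; rewrite lee_fin; apply: le_trans (ler_norm _).
rewrite -[(x ^+ 2)%R]real_normK ?num_real // -subr_ge0.
have -> : (1 + `|x| ^+ 2 - `|x| = (`|x| - 2^-1) ^+ 2 + 3 / 4)%R by field.
by rewrite addr_ge0 ?sqr_ge0.
Qed.

Variables (n h : R) (G : R -> R).
Hypotheses (nuT : nu setT = n%:E) (nuG : forall E, nu `]-oo, E]%classic = (G E)%:E)
  (nu2 : \int[nu]_x (x ^+ 2)%:E < +oo) (nuh : \int[nu]_x x%:E = h%:E).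

Let int_id (D : set (measurableTypeR R)) : measurable D ->
  nu.-integrable D (fun x : measurableTypeR R => x%:E).
Proof. by move=> mD; apply: (integrableS measurableT mD _ (integrable_ident nu2)). Qed.

Let int_cst (D : set (measurableTypeR R)) (b : R) : measurable D ->
  nu.-integrable D (fun=> b%:E).
Proof.
move=> mD; apply: (integrableS measurableT mD) => //.
apply/integrableP; split; first exact: measurable_cst.
by rewrite integral_cst // lte_mul_pinfty.
Qed.

Lemma integral_ident_le (D : set (measurableTypeR R)) (b : R) : measurable D ->
  (forall x, D x -> (x <= b)%R) -> \int[nu]_(x in D) x%:E <= b%:E * nu D.
Proof.
move=> mD Db; rewrite -integral_cst //; apply: le_integral => //.
- exact: int_id.
- exact: int_cst.
- by move=> x /[!inE] Dx; rewrite lee_fin Db.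
Qed.

Lemma integral_ident_ge (D : set (measurableTypeR R)) (b : R) : measurable D ->
  (forall x, D x -> (b <= x)%R) -> b%:E * nu D <= \int[nu]_(x in D) x%:E.
Proof.
move=> mD Db; rewrite -integral_cst //; apply: le_integral => //.
- exact: int_cst.
- exact: int_id.
- by move=> x /[!inE] Dx; rewrite lee_fin Db.
Qed.

Lemma integral_ident_restrict (D : set (measurableTypeR R)) : measurable D ->
  nu (~` D) = 0 -> \int[nu]_(x in D) x%:E = h%:E.
Proof.
move=> mD D0; rewrite -nuh [RHS](negligible_integral (N := ~` D)) //.
- by rewrite setTD setCK.
- exact: measurableC.
- exact: int_id.
Qed.

Let mray (b : R) : measurable (`]-oo, b]%classic : set (measurableTypeR R)).
Proof. exact: measurable_itv. Qed.

Let measureB (A B : set (measurableTypeR R)) : measurable A -> measurable B ->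
  nu (A `\` B) = nu A - nu (A `&` B).
Proof.
move=> mA mB; apply: measureD => //; apply: le_lt_trans fin_nu.
by apply: le_measure; rewrite ?inE.
Qed.

Lemma ray_null b : G b = n -> nu (~` `]-oo, b]%classic) = 0.
Proof.
move=> Gb; have := measureB measurableT (mray b).
rewrite setTD setTI nuT nuG Gb => ->.
by rewrite -EFinB subrr.
Qed.

Lemma mean_le b : G b = n -> (h <= b * n)%R.
Proof.
move=> Gb; have N0 := ray_null Gb.
rewrite -lee_fin EFinM -(integral_ident_restrict (mray b) N0) -Gb -nuG.
by apply: integral_ident_le => // x /=; rewrite in_itv.
Qed.

Lemma mean_ge b : G b = 0%R -> (b * n <= h)%R.
Proof.
move=> Gb; have mC : measurable (~` `]-oo, b]%classic : set (measurableTypeR R)).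
  exact: measurableC.
have N0 : nu (~` ~` `]-oo, b]%classic) = 0 by rewrite setCK nuG Gb.
have nuC : nu (~` `]-oo, b]%classic) = n%:E.
  have := measureB measurableT (mray b).
  by rewrite setTD setTI nuT nuG Gb => ->; rewrite sube0.
rewrite -lee_fin EFinM -(integral_ident_restrict mC N0) -nuC.
apply: integral_ident_ge => // x /=; rewrite in_itv /= => /negP.
by rewrite -ltNge => /ltW.
Qed.

Lemma measure_itv_cdf a b : (a <= b)%R -> nu `]a, b]%classic = (G b - G a)%:E.
Proof.
move=> ab; have e : `]-oo, b]%classic `\` `]-oo, a]%classic = `]a, b]%classic.
  apply/seteqP; split=> x /=; rewrite !in_itv /=.
    by move=> [-> /negP]; rewrite -ltNge => ->.
  by move=> /andP[ax ->]; split=> //; apply/negP; rewrite -ltNge.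
have := measureB (mray b) (mray a).
rewrite e nuG => ->.
rewrite (_ : _ `&` _ = `]-oo, a]%classic) ?nuG //.
apply/seteqP; split=> x /=; rewrite !in_itv /=; first by case.
by move=> xa; split=> //; exact: le_trans ab.
Qed.

(** Lower and upper Stieltjes sums of the identity bracket the mean, and they differ by at most the
    mesh times the total mass. *)
Lemma mean_step (s : nat -> R) N (dl : R) :
  (forall i, s i <= s i.+1)%R -> (forall i, s i.+1 - s i <= dl)%R ->
  G (s 0%N) = 0%R -> G (s N) = n ->
  (`|h - \sum_(i < N) s i.+1 * (G (s i.+1) - G (s i))| <= dl * n)%R.
Proof.
move=> smono sdl G0 GN.
have s0k k : (s 0%N <= s k)%R by elim: k => // k /le_trans; apply.
have mI a b : measurable (`]a, b]%classic : set (measurableTypeR R)).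
  exact: measurable_itv.
have Gmono i : (0 <= G (s i.+1) - G (s i))%R.
  by rewrite -lee_fin -measure_itv_cdf.
have bounds k : (\sum_(i < k) s i * (G (s i.+1) - G (s i)))%:E <=
     \int[nu]_(x in `]s 0%N, s k]) x%:E <= (\sum_(i < k) s i.+1 * (G (s i.+1) - G (s i)))%:E.
  elim: k => [|k /andP[IH1 IH2]].
    by rewrite !big_ord0 set_itv_ge ?bnd_simp ?ltxx // integral_set0 lexx.
  have -> : `]s 0%N, s k.+1]%classic = `]s 0%N, s k]%classic `|` `]s k, s k.+1]%classic.
    apply/seteqP; split=> x /=; rewrite !in_itv /=.
      by move=> /andP[h1 h2]; have [xk|xk] := leP x (s k); [left; rewrite h1|right].
    by move=> [] /andP[h1 h2]; rewrite ?h1 ?h2 ?(le_trans h2) ?(le_lt_trans _ h1).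
  rewrite integral_setU //; last first.
    apply/disj_set2P; apply/seteqP; split=> x //= []; rewrite !in_itv /=.
    by move=> /andP[_ h1] /andP[h2 _]; move: (le_lt_trans h1 h2); rewrite ltxx.
  rewrite !big_ord_recr /= !EFinD !EFinM -measure_itv_cdf //; apply/andP; split.
    apply: leeD => //; apply: integral_ident_ge => // x /=.
    by rewrite in_itv /= => /andP[/ltW].
  apply: leeD => //; apply: integral_ident_le => // x /=.
  by rewrite in_itv /= => /andP[].
have N0 : nu (~` `]s 0%N, s N]%classic) = 0.
  have := measureB measurableT (mI (s 0%N) (s N)).
  rewrite setTD setTI nuT measure_itv_cdf // G0 GN subr0 => ->.
  by rewrite -EFinB subrr.
have := bounds N; rewrite (integral_ident_restrict (mI _ _) N0) !lee_fin => /andP[b1 b2].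
have gap : (\sum_(i < N) s i.+1 * (G (s i.+1) - G (s i)) -
            \sum_(i < N) s i * (G (s i.+1) - G (s i)) <= dl * n)%R.
  have tele : n = (\sum_(i < N) (G (s i.+1) - G (s i)))%R.
    rewrite -(big_mkord xpredT (fun i => G (s i.+1) - G (s i))%R).
    by rewrite (telescope_sumr (fun i => G (s i))) // GN G0 subr0.
  rewrite -sumrB tele mulr_sumr; apply: ler_sum => i _; rewrite -mulrBl.
  by rewrite ler_wpM2r.
have n0 : (0 <= dl * n)%R.
  apply: le_trans gap; rewrite subr_ge0; apply: ler_sum => i _.
  by rewrite ler_wpM2r.
by rewrite ler_norml; apply/andP; split; lra.
Qed.
End StepIntegral.

(** * Spectral projections and step functions of the operator *)

Lemma sym_form_expand (R : realType) (T : choiceType) (a : R) (u v : T -> R)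
    (A : (T -> R) -> T -> R) : A (fun x => u x + a * v x) = (fun x => A u x + a * A v x) ->
  (forall psi, l2 psi -> l2 (A psi)) ->
  (forall phi psi, l2 phi -> l2 psi -> inner phi (A psi) = inner (A phi) psi) ->
  l2 u -> l2 v -> inner (fun x => u x + a * v x) (A (fun x => u x + a * v x)) =
    inner u (A u) + 2 * a * inner u (A v) + a ^+ 2 * inner v (A v).
Proof.
move=> -> Al2 Asym hu hv; have hav := l2Z a hv.
have hAu := Al2 _ hu; have hAv := Al2 _ hv; have haAv := l2Z a hAv.
rewrite (innerDl hu hav (l2D hAu haAv)) (innerDr hu hAu haAv) (innerDr hav hAu haAv).
rewrite (innerZl a hv hAu) (innerZl a hv haAv) (innerZr a hu hAv) (innerZr a hv hAv).
by rewrite (Asym v u hv hu) (innerC (A v) u); ring.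
Qed.

Section SpectralProjections.
Variables (R : realType) (d : nat) (om : Zd d -> R) (M : R).
Hypothesis omM : forall k, `|om k| <= M.
Variable Q : R -> (Zd d -> R) -> (Zd d -> R).
Local Notation H := (anderson om).
Hypothesis HQ : spectral_resolution H Q.
Implicit Types (phi psi u v : Zd d -> R) (E a b : R).
Local Notation R0 := (2 * #|` units d|%:R + M).

Lemma proj_l2 E psi : l2 psi -> l2 (Q E psi).
Proof. by have [h _ _] := HQ; have [h1 _ _ _] := h E; exact: h1. Qed.

Lemma proj_linear E a phi psi : l2 phi -> l2 psi ->
  Q E (fun x => a * phi x + psi x) = (fun x => a * Q E phi x + Q E psi x).
Proof. by have [h _ _] := HQ; have [_ h1 _ _] := h E; exact: h1. Qed.

Lemma proj_sym E phi psi : l2 phi -> l2 psi -> inner phi (Q E psi) = inner (Q E phi) psi.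
Proof. by have [h _ _] := HQ; have [_ _ _ h1] := h E; exact: h1. Qed.

Lemma inner_ext phi psi : (forall u, l2 u -> inner u phi = inner u psi) -> phi = psi.
Proof.
move=> h; apply/funext => y.
by rewrite -(inner_point y phi) -(inner_point y psi) h //; exact: l2_point.
Qed.

Lemma proj_le E E' psi : E <= E' -> l2 psi -> Q E (Q E' psi) = Q E psi.
Proof. by have [_ h _] := HQ; exact: h. Qed.

Lemma proj_ge E E' psi : E <= E' -> l2 psi -> Q E' (Q E psi) = Q E psi.
Proof.
move=> le h; apply: inner_ext => u hu.
rewrite (proj_sym E' hu (proj_l2 E h)) (proj_sym E (proj_l2 E' hu) h).
by rewrite (proj_le le hu) -(proj_sym E hu h).
Qed.

Lemma proj0 E : Q E (fun=> 0) = fun=> 0.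
Proof.
have := @proj_linear E 0 (fun=> 0) (fun=> 0) (l20 _ _) (l20 _ _).
have -> : (fun x : Zd d => 0 * 0 + 0) = (fun=> 0 : R).
  by apply/funext => x; rewrite mul0r addr0.
move=> e; have := proj_linear E (-1) (l20 R (Zd d)) (l20 R (Zd d)).
have -> : (fun x : Zd d => -1 * 0 + 0) = (fun=> 0 : R).
  by apply/funext => x; rewrite mulr0 addr0.
by move=> ->; apply/funext => x; rewrite mulN1r addNr.
Qed.

Lemma projZ E a psi : l2 psi -> Q E (fun x => a * psi x) = fun x => a * Q E psi x.
Proof.
move=> h; have := proj_linear E a h (l20 R (Zd d)); rewrite proj0.
have -> : (fun x : Zd d => a * psi x + 0) = (fun x => a * psi x).
  by apply/funext => x; rewrite addr0.
by move=> ->; apply/funext => x; rewrite addr0.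
Qed.

Lemma projD E phi psi : l2 phi -> l2 psi ->
  Q E (fun x => phi x + psi x) = fun x => Q E phi x + Q E psi x.
Proof.
move=> h1 h2; have := proj_linear E 1 h1 h2.
have -> : (fun x : Zd d => 1 * phi x + psi x) = (fun x => phi x + psi x).
  by apply/funext => x; rewrite mul1r.
by move=> ->; apply/funext => x; rewrite mul1r.
Qed.

Definition cdf_at v E : R := inner v (Q E v).

Lemma cdf_atE v E : l2 v -> cdf_at v E = inner (Q E v) (Q E v).
Proof.
by move=> h; rewrite /cdf_at -[in LHS](proj_le (lexx E) h) proj_sym // ; exact: proj_l2.
Qed.

Section Mean.
Variable v : Zd d -> R.
Hypothesis hv : l2 v.

Let nuP : exists nu : {measure set (measurableTypeR R) -> \bar R},
  [/\ nu setT = (inner v v)%:E,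
   forall E, nu `]-oo, E]%classic = (cdf_at v E)%:E,
   (\int[nu]_x (x ^+ 2)%:E < +oo)%E & (\int[nu]_x x%:E = (inner v (H v))%:E)%E].
Proof.
have [_ _ h] := HQ; have [nu [h1 h2 h3 h4]] := h v hv.
have hH := l2_anderson omM hv.
by exists nu; split=> //; [exact/h3|exact: h4].
Qed.

Lemma form_le b : Q b v = v -> inner v (H v) <= b * inner v v.
Proof.
move=> e; have [nu [n1 n2 n3 n4]] := nuP.
apply: (mean_le _ n1 n2 n3 n4); first by rewrite n1 ltry.
by rewrite /cdf_at e.
Qed.

Lemma form_ge b : Q b v = (fun=> 0) -> b * inner v v <= inner v (H v).
Proof.
move=> e; have [nu [n1 n2 n3 n4]] := nuP.
apply: (mean_ge _ n1 n2 n3 n4); first by rewrite n1 ltry.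
by rewrite /cdf_at e inner_tsum (tsum_point (y := 0)) => [|x _]; rewrite mulr0.
Qed.

Lemma form_step (s : nat -> R) N (dl : R) :
  (forall i, s i <= s i.+1) -> (forall i, s i.+1 - s i <= dl) ->
  Q (s 0%N) v = (fun=> 0) -> Q (s N) v = v ->
  `|inner v (H v) - \sum_(i < N) s i.+1 * (cdf_at v (s i.+1) - cdf_at v (s i))|
    <= dl * inner v v.
Proof.
move=> smono sdl e0 eN; have [nu [n1 n2 n3 n4]] := nuP.
apply: (mean_step _ n1 n2 n3 n4) => //; first by rewrite n1 ltry.
  by rewrite /cdf_at e0 inner_tsum (tsum_point (y := 0)) => [|x _]; rewrite mulr0.
by rewrite /cdf_at eN.
Qed.

End Mean.

(** For u = [Q a psi] the spectral measure bounds the form by a |u|^2, while [anderson_bound] keeps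
    it above -R0 |u|^2; as a < -R0, u vanishes. The complement of [Q b] is treated likewise in
    [proj_above]. *)
Lemma proj_below a psi : a < - R0 -> l2 psi -> Q a psi = fun=> 0.
Proof.
move=> aR h; have hu := proj_l2 a h; apply: inner_eq0 => //.
have := form_le hu (proj_le (lexx a) h).
have := anderson_bound omM hu; rewrite ler_norml => /andP[h1 _] h2.
have u0 := inner_ge0 (Q a psi).
apply/eqP; rewrite eq_le u0 andbT leNgt; apply/negP => u1.
by have := le_trans h1 h2; rewrite -mulNr ler_pM2r // leNgt aR.
Qed.

Lemma proj_above b psi : R0 < b -> l2 psi -> Q b psi = psi.
Proof.
move=> bR h; have hQ := proj_l2 b h.
pose w := fun x => (-1) * Q b psi x + psi x.
have hw : l2 w by apply: l2D => //; exact: l2Z.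
have Qw : Q b w = fun=> 0.
  rewrite proj_linear // proj_le //; apply/funext => x; ring.
suff w0 : w = fun=> 0.
  apply/funext => x; have /(congr1 (@^~ x)) := w0; rewrite /w /= => e.
  by apply/eqP; rewrite eq_sym -subr_eq0 -e; apply/eqP; ring.
apply: inner_eq0 => //.
have := form_ge hw Qw.
have := anderson_bound omM hw; rewrite ler_norml => /andP[_ h1] h2.
have u0 := inner_ge0 w.
apply/eqP; rewrite eq_le u0 andbT leNgt; apply/negP => u1.
by have := le_trans h2 h1; rewrite ler_pM2r // leNgt bR.
Qed.

Section Mesh.
Variables (s : nat -> R) (N : nat) (dl : R).
Hypotheses (smono : forall i, s i <= s i.+1) (sdl : forall i, s i.+1 - s i <= dl)
  (s0 : s 0%N < - R0) (sN : R0 < s N).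

Let s_le i j : (i <= j)%N -> s i <= s j.
Proof.
move=> ij; rewrite -(subnK ij); elim: (j - i)%N => // k IH.
by rewrite addSn (le_trans IH).
Qed.

(** The spectral projection of the interval []s i, s i.+1]]. *)
Definition gap_proj i psi : Zd d -> R := fun x => Q (s i.+1) psi x + (-1) * Q (s i) psi x.

Lemma gap_proj_l2 i psi : l2 psi -> l2 (gap_proj i psi).
Proof. by move=> h; apply: l2D; [|apply: l2Z]; exact: proj_l2. Qed.

Lemma inner_gap_proj i phi psi : l2 phi -> l2 psi ->
  inner phi (gap_proj i psi) = inner phi (Q (s i.+1) psi) - inner phi (Q (s i) psi).
Proof.
move=> h1 h2; have lA := proj_l2 (s i.+1) h2; have lB := proj_l2 (s i) h2.
by rewrite (innerDr h1 lA (l2Z (-1) lB)) (innerZr (-1) h1 lB) mulN1r.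
Qed.

Lemma gap_proj_sym i phi psi : l2 phi -> l2 psi ->
  inner phi (gap_proj i psi) = inner (gap_proj i phi) psi.
Proof.
move=> h1 h2; rewrite [RHS]innerC !inner_gap_proj //.
by congr (_ - _); rewrite (proj_sym _ h1 h2) innerC.
Qed.

Lemma proj_gap_proj E k psi : l2 psi ->
  Q E (gap_proj k psi) = fun x => Q E (Q (s k.+1) psi) x + (-1) * Q E (Q (s k) psi) x.
Proof.
move=> h; have lA := proj_l2 (s k.+1) h; have lB := proj_l2 (s k) h.
by rewrite (projD E lA (l2Z (-1) lB)) (projZ E (-1) lB).
Qed.

Lemma gap_projK i j psi : l2 psi ->
  gap_proj i (gap_proj j psi) = if i == j then gap_proj i psi else fun=> 0.
Proof.
move=> h; apply/funext => x; rewrite {1}/gap_proj !proj_gap_proj //.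
have [ij|ji|<-] := ltngtP i j.
- have h1 := s_le ij; have h2 := s_le (ltnW ij).
  have h3 : s i.+1 <= s j.+1 by rewrite s_le // ltnW.
  have h4 : s i <= s j.+1 by rewrite s_le // leqW // ltnW.
  by rewrite (proj_le h3 h) (proj_le h1 h) (proj_le h4 h) (proj_le h2 h); ring.
- have h1 := s_le ji; have h2 := s_le (ltnW ji).
  have h3 : s j.+1 <= s i.+1 by rewrite s_le // ltnW.
  have h4 : s j <= s i.+1 by rewrite s_le // leqW // ltnW.
  by rewrite (proj_ge h3 h) (proj_ge h1 h) (proj_ge h4 h) (proj_ge h2 h); ring.
- rewrite (proj_le (lexx _) h) (proj_le (lexx _) h) (proj_le (smono i) h).
  by rewrite (proj_ge (smono i) h) /gap_proj; ring.
Qed.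

Lemma gap_proj_sum psi : l2 psi -> (fun x => \sum_(i < N) gap_proj i psi x) = psi.
Proof.
move=> h; apply/funext => x.
rewrite /gap_proj -(big_mkord xpredT (fun i => Q (s i.+1) psi x + -1 * Q (s i) psi x)).
under eq_bigr do rewrite mulN1r.
rewrite (telescope_sumr (fun i => Q (s i) psi x)) //.
by rewrite proj_above // proj_below // subr0.
Qed.

(* The functional calculus of the simple function taking the value [f (s i.+1)]
   on [`]s i, s i.+1]]. *)
Definition step_op (f : R -> R) psi : Zd d -> R :=
  fun x => \sum_(i < N) f (s i.+1) * gap_proj i psi x.

Lemma step_op_l2 f psi : l2 psi -> l2 (step_op f psi).
Proof. by move=> h; apply: l2_sum => i; apply: l2Z; exact: gap_proj_l2. Qed.

Lemma step_op_sym f phi psi : l2 phi -> l2 psi ->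
  inner phi (step_op f psi) = inner (step_op f phi) psi.
Proof.
move=> h1 h2; rewrite inner_sumr //; last by move=> i; apply: l2Z; exact: gap_proj_l2.
rewrite [RHS]innerC inner_sumr //; last by move=> i; apply: l2Z; exact: gap_proj_l2.
apply: eq_bigr => i _; have hp := gap_proj_l2.
rewrite (innerZr _ h1 (hp i _ h2)) (innerZr _ h2 (hp i _ h1)).
by rewrite (gap_proj_sym i h1 h2) innerC.
Qed.

Lemma inner_step_op f v : l2 v -> inner v (step_op f v) =
  \sum_(i < N) f (s i.+1) * (cdf_at v (s i.+1) - cdf_at v (s i)).
Proof.
move=> h; rewrite inner_sumr //; last by move=> i; apply: l2Z; exact: gap_proj_l2.
apply: eq_bigr => i _.
by rewrite (innerZr _ h (gap_proj_l2 i h)) inner_gap_proj.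
Qed.

Lemma proj_sum E (I : Type) (r : seq I) (F : I -> Zd d -> R) : (forall i, l2 (F i)) ->
  Q E (fun x => \sum_(i <- r) F i x) = fun x => \sum_(i <- r) Q E (F i) x.
Proof.
move=> hF; elim: r => [|i r IH].
  rewrite (_ : (fun x => \sum_(i <- [::]) F i x) = fun=> 0).
    by rewrite proj0; apply/funext => x; rewrite big_nil.
  by apply/funext => x; rewrite big_nil.
rewrite (_ : (fun x => \sum_(j <- i :: r) F j x) = fun x => F i x + \sum_(j <- r) F j x).
  by rewrite (projD E (hF i) (l2_sum r hF)) IH; apply/funext => x; rewrite big_cons.
by apply/funext => x; rewrite big_cons.
Qed.

Lemma gap_proj_step_op (i : 'I_N) g psi : l2 psi ->
  gap_proj i (step_op g psi) = fun x => g (s i.+1) * gap_proj i psi x.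
Proof.
move=> h; apply/funext => x.
have lg (j : 'I_N) : l2 (fun x => g (s j.+1) * gap_proj j psi x).
  by apply: l2Z; exact: gap_proj_l2.
rewrite {1}/gap_proj /step_op !proj_sum // mulN1r -sumrB (bigD1 i) //=.
have e (j : 'I_N) : Q (s i.+1) (fun x => g (s j.+1) * gap_proj j psi x) x -
   Q (s i) (fun x => g (s j.+1) * gap_proj j psi x) x =
   g (s j.+1) * (gap_proj i (gap_proj j psi)) x.
  have lp := gap_proj_l2 j h.
  by rewrite (projZ _ _ lp) (projZ _ _ lp) -mulrBr [in RHS]/gap_proj mulN1r.
rewrite e gap_projK // eqxx big1 ?addr0 // => j ji.
by rewrite e gap_projK // eq_sym (_ : (j == i :> nat) = false) ?mulr0 //; exact/negbTE.
Qed.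

Lemma step_op_comp f g psi : l2 psi ->
  step_op f (step_op g psi) = step_op (fun t => f t * g t) psi.
Proof.
move=> h; apply/funext => x; apply: eq_bigr => i _.
by rewrite gap_proj_step_op // mulrA.
Qed.

Lemma step_op1 psi : l2 psi -> step_op (fun=> 1) psi = psi.
Proof.
move=> h; rewrite -[RHS]gap_proj_sum //; apply/funext => x.
by apply: eq_bigr => i _; rewrite mul1r.
Qed.

Lemma cdf_at_gap v i : l2 v -> 0 <= cdf_at v (s i.+1) - cdf_at v (s i).
Proof.
move=> h; rewrite /cdf_at -inner_gap_proj //.
have := gap_projK i i h; rewrite eqxx => <-.
by rewrite (gap_proj_sym _ h (gap_proj_l2 i h)) inner_ge0.
Qed.

Lemma sum_cdf_at_gap v : l2 v -> \sum_(i < N) (cdf_at v (s i.+1) - cdf_at v (s i)) = inner v v.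
Proof.
move=> h; transitivity (inner v (step_op (fun=> 1) v)); last by rewrite step_op1.
by rewrite inner_step_op //; apply: eq_bigr => i _; rewrite mul1r.
Qed.

Lemma anderson_step_op v : l2 v ->
  `|inner v (H v) - inner v (step_op id v)| <= dl * inner v v.
Proof.
move=> h; rewrite inner_step_op //; apply: form_step => //.
- exact: proj_below.
- exact: proj_above.
Qed.

Lemma step_op_linear f a u v : l2 u -> l2 v ->
  step_op f (fun x => u x + a * v x) = fun x => step_op f u x + a * step_op f v x.
Proof.
move=> hu hv; have hav := l2Z a hv; apply/funext => x.
rewrite /step_op mulr_sumr -big_split /=; apply: eq_bigr => i _.
by rewrite /gap_proj !(projD _ hu hav) !(projZ _ a hv); ring.
Qed.

(** Polarization: spectral measures control diagonal forms only, whereas powers of [H] need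
    off-diagonal ones. The diagonal bounds for [u + v] and [u - v] are combined, and the cross terms
    [inner u v] cancel. *)
Lemma anderson_step_op2 u v : l2 u -> l2 v ->
  `|inner u (H v) - inner u (step_op id v)| <= dl * (inner u u + inner v v) / 2.
Proof.
move=> hu hv.
pose q w := inner w (H w) - inner w (step_op id w).
have l2a a : l2 (fun x => u x + a * v x) by apply: l2D => //; exact: l2Z.
have Hlin a : H (fun x => u x + a * v x) = fun x => H u x + a * H v x.
  apply/funext => x; rewrite [RHS]addrC -anderson_linear.
  by congr (anderson om _ x); apply/funext => y; rewrite addrC.
have expand a : q (fun x => u x + a * v x) =
    q u + 2 * a * (inner u (H v) - inner u (step_op id v)) + a ^+ 2 * q v.
  rewrite /q (sym_form_expand (Hlin a) (@l2_anderson _ _ _ _ omM) (@anderson_sym _ _ _ _ omM)) //.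
  rewrite (sym_form_expand (step_op_linear id a hu hv) (@step_op_l2 id) (@step_op_sym id)) //.
  by ring.
have ex2 a : inner (fun x => u x + a * v x) (fun x => u x + a * v x) =
    inner u u + 2 * a * inner u v + a ^+ 2 * inner v v.
  exact: (@sym_form_expand _ _ _ _ _ id).
have := anderson_step_op (l2a 1); have := anderson_step_op (l2a (-1)).
rewrite -/(q _) -/(q _) !expand !ex2 !ler_norml => /andP[a1 a2] /andP[b1 b2].
by apply/andP; split; lra.
Qed.
End Mesh.
End SpectralProjections.

(** * Polynomials of the operator against the spectral measure at the origin *)

Section PolynomialBound.
Variables (R : realType) (d : nat) (om : Zd d -> R) (M : R).
Hypothesis omM : forall k, `|om k| <= M.
Variable Q : R -> (Zd d -> R) -> (Zd d -> R).
Local Notation H := (anderson om).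
Hypothesis HQ : spectral_resolution H Q.
Local Notation R0 := (2 * #|` units d|%:R + M).
Local Notation d0 := (@delta0 R d).
Local Notation x_ k := (powk om xpredT k 0).

Lemma l2_powk k : l2 (x_ k).
Proof.
elim: k => [|k IH]; first exact: l2_point.
by rewrite (_ : x_ k.+1 = H (x_ k)) //; exact: (l2_anderson omM).
Qed.

(** The factors of [H^k] are replaced by the step operator one at a time. With j factors replaced,
    the vector on the left has squared norm at most C^(2j), and [anderson_step_op2] gives the
    summand. Apart from the bound [C] on the nodes, the total does not depend on the mesh. *)
Fixpoint telescope_error (C : R) k j : R :=
  if k is k'.+1 then (C ^+ (j * 2) + inner (x_ k') (x_ k')) / 2 + telescope_error C k' j.+1
  else 0.

Section FixedMesh.
Variables (s : nat -> R) (N : nat) (dl C : R).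
Hypotheses (smono : forall i, s i <= s i.+1) (sdl : forall i, s i.+1 - s i <= dl)
  (s0 : s 0%N < - R0) (sN : R0 < s N) (sC : forall i, (i <= N)%N -> `|s i| <= C).
Local Notation Y f := (step_op Q s N f d0).

Let dl_ge0 : 0 <= dl.
Proof. by apply: le_trans (sdl 0%N); rewrite subr_ge0. Qed.

Let d0l2 : l2 d0.
Proof. exact: l2_point. Qed.

Let Yl2 f : l2 (Y f).
Proof. exact: (step_op_l2 HQ). Qed.

Let inner_Y f g : inner (Y f) (Y g) = inner d0 (Y (fun t => f t * g t)).
Proof. by rewrite -(step_op_sym HQ) // (step_op_comp HQ _ smono). Qed.

Lemma inner_step_op_le (f : R -> R) B : (forall i, (i <= N)%N -> f (s i) <= B) ->
  inner d0 (Y f) <= B.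
Proof.
move=> fB; rewrite (inner_step_op HQ) //.
have e1 : inner d0 d0 = 1 by rewrite inner_point /delta0 eqxx.
rewrite -[B]mulr1 -e1 -(sum_cdf_at_gap omM HQ s0 sN d0l2) mulr_sumr.
apply: ler_sum => i _; apply: ler_wpM2r; first exact: (cdf_at_gap HQ smono).
exact/fB/ltn_ord.
Qed.

Lemma telescope_error_bound k j :
  `|inner (Y (fun t => t ^+ j)) (x_ k) - inner (Y (fun t => t ^+ (j + k))) d0|
    <= dl * telescope_error C k j.
Proof.
elim: k j => [|k IH] j /=; first by rewrite addn0 subrr normr0 mulr0.
have e : inner (Y (fun t => t ^+ j.+1)) (x_ k) = inner (Y (fun t => t ^+ j)) (step_op Q s N id (x_ k)).
  rewrite (step_op_sym HQ) //; last exact: l2_powk.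
  rewrite (step_op_comp HQ _ smono) // (_ : (fun t : R => t ^+ j.+1) = fun t => id t * t ^+ j) //.
  by apply/funext => t; rewrite exprS.
have := IH j.+1; rewrite e addSnnS => h1.
have := anderson_step_op2 omM HQ smono sdl s0 sN (Yl2 (fun t => t ^+ j)) (l2_powk k).
rewrite -[H (x_ k)]/(x_ k.+1) => h2.
have h3 : inner (Y (fun t => t ^+ j)) (Y (fun t => t ^+ j)) <= C ^+ (j * 2).
  rewrite inner_Y; apply: inner_step_op_le => i iN; rewrite -exprD addnn -muln2.
  apply: le_trans (ler_norm _) _; rewrite normrX; apply: lerXn2r => //; rewrite ?nnegrE //.
  - exact: le_trans (sC iN).
  - exact: sC.
have h4 : dl * (inner (Y (fun t => t ^+ j)) (Y (fun t => t ^+ j)) + inner (x_ k) (x_ k)) / 2 <=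
    dl * ((C ^+ (j * 2) + inner (x_ k) (x_ k)) / 2).
  by rewrite -mulrA ler_wpM2l // ler_wpM2r // lerD2r.
rewrite mulrDr (le_trans (ler_distD (inner (Y (fun t => t ^+ j)) (step_op Q s N id (x_ k))) _ _)) //.
by apply: lerD => //; exact: le_trans h2 h4.
Qed.

Lemma powk_step_op k : `|x_ k 0 - inner d0 (Y (fun t => t ^+ k))| <= dl * telescope_error C k 0.
Proof.
have := telescope_error_bound k 0; rewrite add0n [inner (Y (fun t => t ^+ k)) d0]innerC.
rewrite (_ : Y (fun t => t ^+ 0) = d0); first by rewrite inner_point.
by rewrite (_ : (fun t : R => t ^+ 0) = fun=> 1) // (step_op1 omM HQ s0 sN).
Qed.

Lemma ploc_step_op (p : {poly R}) :
  `|ploc om xpredT p 0 - inner d0 (Y (fun t => p.[t]))|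
    <= dl * \sum_(k < size p) `|p`_k| * telescope_error C k 0.
Proof.
rewrite (_ : inner d0 (Y (fun t => p.[t])) =
   \sum_(k < size p) p`_k * inner d0 (Y (fun t => t ^+ k))); last first.
  rewrite (inner_step_op HQ) //; under eq_bigr do rewrite horner_coef mulr_suml.
  rewrite exchange_big /=; apply: eq_bigr => k _; rewrite (inner_step_op HQ) // mulr_sumr.
  by apply: eq_bigr => i _; rewrite mulrA.
rewrite /ploc -sumrB mulr_sumr (le_trans (ler_norm_sum _ _ _)) //.
apply: ler_sum => k _; rewrite -mulrBr normrM mulrCA ler_wpM2l //.
exact: powk_step_op.
Qed.

(** On the mesh everything is a finite sum against the increments of [cdf_at], which are nonnegative
    of total mass one, so an inequality at the nodes can be summed. The last term pays for passing
    from step functions to [p] of [H]. *)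
Lemma cdf_le_ploc (p : {poly R}) (a b : R) K : (K <= N)%N ->
  (forall i, (i <= N)%N -> a * (nat_of_bool (s i <= s K))%:R + b <= p.[s i]) ->
  a * cdf_at Q d0 (s K) + b <= ploc om xpredT p 0
    + dl * \sum_(k < size p) `|p`_k| * telescope_error C k 0.
Proof.
move=> KN hp.
have := ploc_step_op p; rewrite ler_norml => /andP[h _].
suff : a * cdf_at Q d0 (s K) + b <= inner d0 (Y (fun t => p.[t])) by move: h; lra.
have e1 : inner d0 d0 = 1 by rewrite inner_point /delta0 eqxx.
have gap0 i : 0 <= cdf_at Q d0 (s i.+1) - cdf_at Q d0 (s i) by exact: (cdf_at_gap HQ smono).
have smn i j : (i <= j)%N -> s i <= s j.
  by move=> ij; rewrite -(subnK ij); elim: (j - i)%N => // n; rewrite addSn => /le_trans ->.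
rewrite (inner_step_op HQ) //.
apply: (@le_trans _ _ (\sum_(i < N) (a * (nat_of_bool (s i.+1 <= s K))%:R + b) *
    (cdf_at Q d0 (s i.+1) - cdf_at Q d0 (s i)))); last first.
  by apply: ler_sum => i _; apply: ler_wpM2r => //; exact/hp/ltn_ord.
under eq_bigr do rewrite mulrDl.
rewrite big_split /= -mulr_sumr (sum_cdf_at_gap omM HQ s0 sN d0l2) e1 mulr1 lerD2r.
under eq_bigr do rewrite -mulrA.
rewrite -mulr_sumr le_eqVlt; apply/orP; left; apply/eqP; congr (_ * _).
have g0 i : s i = s i.+1 -> cdf_at Q d0 (s i.+1) - cdf_at Q d0 (s i) = 0.
  by move=> <-; rewrite subrr.
have c0 : cdf_at Q d0 (s 0%N) = 0.
  by rewrite /cdf_at (proj_below omM HQ s0 d0l2) inner_tsum (tsum_point (y := 0)) ?mulr0 // => x _; rewrite mulr0.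
have -> : cdf_at Q d0 (s K) = \sum_(i < K) (cdf_at Q d0 (s i.+1) - cdf_at Q d0 (s i)).
  rewrite -(big_mkord xpredT (fun i => cdf_at Q d0 (s i.+1) - cdf_at Q d0 (s i))).
  by rewrite (telescope_sumr (fun i => cdf_at Q d0 (s i))) // c0 subr0.
rewrite (big_ord_widen _ (fun i => cdf_at Q d0 (s i.+1) - cdf_at Q d0 (s i)) KN) big_mkcond.
apply: eq_bigr => i _; have [iK|Ki] := ltnP i K; first by rewrite smn // mul1r.
(* The nodes need not be distinct: one beyond index [K] may still equal [s K], but then its gap is
   empty and carries no mass. *)
have [le|_] := boolP (s i.+1 <= s K); last by rewrite mul0r.
rewrite mul1r; apply/esym/g0/le_anti; rewrite smono /=.
by rewrite (le_trans le) // smn.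
Qed.

End FixedMesh.

(* On a mesh of step [1/n] with node [E], simple functions see the jump of the
   indicator of []-oo, E]] exactly, so only the replacement of [H^k] by [step_op]
   costs an error, of order [1/n]. *)
Lemma spectral_cdf_le E (p : {poly R}) (a b : R) :
  (forall t : R, `|t| <= 2 * `|E| + `|R0| + 1 -> a * (nat_of_bool (t <= E))%:R + b <= p.[t]) ->
  a * cdf_at Q d0 E + b <= ploc om xpredT p 0.
Proof.
(* As [c] is an integer, [E] and both ends E - c and E + c are nodes of every mesh of step 1/(n+1);
   the size of [c] makes the mesh cover the spectrum. *)
have [c /andP[cP cP']] : exists c : nat, `|E| + `|R0| < c%:R <= `|E| + `|R0| + 1.
  exists (Num.truncn (`|E| + `|R0|)).+1.
  have /andP[h1 h2] := truncn_itv (addr_ge0 (normr_ge0 E) (normr_ge0 R0)).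
  by rewrite h2 -natr1 lerD2r.
pose C : R := `|E| + c%:R.
move=> hp0; have {hp0} hp t : `|t| <= C -> a * (nat_of_bool (t <= E))%:R + b <= p.[t].
  by move=> tC; apply: hp0; apply: le_trans tC _; rewrite /C; lra.
set T := \sum_(k < size p) `|p`_k| * telescope_error C k 0.
have main n : a * cdf_at Q d0 E + b <= ploc om xpredT p 0 + n.+1%:R^-1 * T.
  pose K := (n.+1 * c)%N; pose N := (K + K)%N.
  pose s (i : nat) : R := E + (i%:R - K%:R) / n.+1%:R.
  have n0 : 0 < n.+1%:R :> R by [].
  have sS i : s i.+1 = s i + n.+1%:R^-1 by rewrite /s -natr1; ring.
  have sK : s K = E by rewrite /s subrr mul0r addr0.
  have s0 : s 0%N = E - c%:R by rewrite /s sub0r mulNr /K natrM mulrC mulKf // gt_eqF.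
  have sN : s N = E + c%:R by rewrite /s /N natrD addrK /K natrM mulrC mulKf // gt_eqF.
  have smn i j : (i <= j)%N -> s i <= s j.
    by move=> ij; rewrite /s lerD2l ler_pM2r ?invr_gt0 // lerD2r ler_nat.
  have sC i : (i <= N)%N -> `|s i| <= C.
    move=> iN; rewrite ler_norml; have := smn _ _ iN; have := smn _ _ (leq0n i).
    rewrite s0 sN /C; have := ler_norm E; have := ler_norm (- E); rewrite normrN => *.
    by apply/andP; split; lra.
  rewrite -{1}sK; apply: (@cdf_le_ploc s N n.+1%:R^-1 C) => //.
  - by move=> i; rewrite sS lerDl.
  - by move=> i; rewrite sS addrAC subrr add0r.
  - rewrite s0; have := ler_norm E; have := ler_norm R0; lra.
  - rewrite sN; have := ler_norm (- E); have := ler_norm R0; rewrite normrN; lra.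
  - exact: leq_addr.
  - by move=> i iN; rewrite sK; apply/hp/sC.
apply/ler_addgt0Pr => e e0.
have [n _ /(_ n (leqnn n)) /= nP] := near_natr_gt (`|T| / e).
apply: le_trans (main n) _; rewrite lerD2l (le_trans (ler_norm _)) // normrM ger0_norm //.
rewrite mulrC ler_pdivrMr // mulrC -ler_pdivrMr // (le_trans (ltW nP)) // ler_nat //.
Qed.

Lemma cdf_at_ge0 E : 0 <= cdf_at Q d0 E.
Proof. by rewrite (cdf_atE HQ) ?inner_ge0 //; exact: l2_point. Qed.

Lemma cdf_at_le1 E : cdf_at Q d0 E <= 1.
Proof.
have := @spectral_cdf_le E 1%:P 1 0; rewrite mul1r addr0 => /(_ _)/le_trans; apply.
  by move=> t _; rewrite mul1r addr0 hornerC; case: (t <= E).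
by rewrite /ploc polyC1 size_poly1 big_ord1 coef1 mul1r /powk /= /delta eqxx.
Qed.

Lemma cdf_at_mono E E' : E <= E' -> cdf_at Q d0 E <= cdf_at Q d0 E'.
Proof.
have [_ _ h] := HQ; have [nu [_ n2 _ _]] := h d0 (@l2_point _ _ _).
move=> le; rewrite -lee_fin /cdf_at -!n2; apply: le_measure; rewrite ?inE.
- exact: measurable_itv.
- exact: measurable_itv.
- by move=> t /=; rewrite !in_itv /= => /le_trans; apply.
Qed.

Lemma cdf_at_right_cvg E : cdf_at Q d0 (E + n.+1%:R^-1) @[n --> \oo] --> cdf_at Q d0 E.
Proof.
have [_ _ h] := HQ; have [nu [n1 n2 _ _]] := h d0 (@l2_point _ _ _).
pose F n : set (measurableTypeR R) := `]-oo, E + n.+1%:R^-1]%classic.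
have e : \bigcap_n F n = `]-oo, E]%classic.
  apply/seteqP; split=> t /=; rewrite in_itv /=.
    move=> ht; apply/ler_addgt0Pr => e e0.
    have [n _ /(_ n (leqnn n)) /= nP] := near_natr_gt e^-1.
    have := ht n I; rewrite /F /= in_itv /= => /le_trans; apply; rewrite lerD2l.
    rewrite -[leRHS]invrK lef_pV2 ?posrE ?invr_gt0 //.
    by rewrite (le_trans (ltW nP)) // ler_nat.
  by move=> tE n _; rewrite /F /= in_itv /= (le_trans tE) // lerDl.
have mF n : measurable (F n) by exact: measurable_itv.
have c : nu (F n) @[n --> \oo] --> nu (\bigcap_n F n).
  apply: nonincreasing_cvg_mu => //.
  - by rewrite n2 ltry.
  - by rewrite e; exact: measurable_itv.
  - apply/nonincreasing_seqP => n; rewrite subsetEset => t; rewrite /F /= !in_itv /=.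
    move=> /le_trans; apply; rewrite lerD2l lef_pV2 ?posrE // ler_nat //.
rewrite e n2 in c; apply: cvg_trans (fine_cvg c); apply: near_eq_cvg.
by apply: nearW => n /=; rewrite n2.
Qed.

End PolynomialBound.

(** * Expectations of bounded functions on an event of full probability *)

Section BoundedExpectation.
Import HBNNSimple.
Variables (R : realType) (dT : measure_display) (T : measurableType dT).
Variables (P : probability T R) (D : set T).
Hypotheses (mD : measurable D) (PD : P D = 1%E).
Implicit Types (f g : T -> R).

(** [D] will be the event of bounded configurations: measurability of the spectral data in the
    configuration is established there only. *)
Definition bounded_on f : Prop :=
  measurable_fun D f /\ exists c, forall x, D x -> `|f x| <= c.

Lemma bounded_onI f c : measurable_fun D f -> (forall x, D x -> `|f x| <= c) -> bounded_on f.
Proof. by move=> mf h; split=> //; exists c. Qed.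

Lemma bounded_onD f g : bounded_on f -> bounded_on g -> bounded_on (fun x => f x + g x).
Proof.
move=> [mf [c hc]] [mg [c' hc']]; apply: (@bounded_onI _ (c + c')).
  exact: measurable_funD.
by move=> x Dx; rewrite (le_trans (ler_normD _ _)) // lerD ?hc ?hc'.
Qed.

Lemma bounded_on_cst a : bounded_on (fun=> a).
Proof. by apply: (@bounded_onI _ `|a|) => //; exact: measurable_cst. Qed.

Lemma bounded_onM f g : bounded_on f -> bounded_on g -> bounded_on (fun x => f x * g x).
Proof.
move=> [mf [c hc]] [mg [c' hc']]; apply: (@bounded_onI _ (c * c')).
  exact: measurable_funM.
by move=> x Dx; rewrite normrM ler_pM ?hc ?hc'.
Qed.

Lemma bounded_onZ a f : bounded_on f -> bounded_on (fun x => a * f x).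
Proof. by move=> h; apply: bounded_onM => //; exact: bounded_on_cst. Qed.

Lemma bounded_on_sum (I : Type) (r : seq I) (f : I -> T -> R) :
  (forall i, bounded_on (f i)) -> bounded_on (fun x => \sum_(i <- r) f i x).
Proof.
move=> h; elim: r => [|i r IH].
  by under eq_fun do rewrite big_nil; exact: bounded_on_cst.
by under eq_fun do rewrite big_cons; exact: bounded_onD.
Qed.

Lemma bounded_on_integrable f : bounded_on f -> P.-integrable D (EFin \o f).
Proof.
move=> [mf [c hc]]; apply: measurable_bounded_integrable => //.
  by apply: (@le_lt_trans _ _ 1%E); rewrite ?ltry // -PD.
by exists c; split; [exact: num_real|move=> t ct x Dx; exact: le_trans (hc x Dx) (ltW ct)].
Qed.

Local Notation Ex f := (\int[P]_(x in D) f x)%R.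

Lemma expectation_bounded_sum (I : Type) (r : seq I) (f : I -> T -> R) :
  (forall i, bounded_on (f i)) ->
  Ex (fun x => \sum_(i <- r) f i x) = \sum_(i <- r) Ex (f i).
Proof.
move=> h; elim: r => [|i r IH].
  by under eq_Rintegral do rewrite big_nil; rewrite Rintegral_cst // mul0r big_nil.
under eq_Rintegral do rewrite big_cons; rewrite big_cons -IH RintegralD //.
  exact: bounded_on_integrable.
by apply: bounded_on_integrable; exact: bounded_on_sum.
Qed.

Lemma expectation_bounded_affine a b f : bounded_on f ->
  Ex (fun x => a * f x + b) = a * Ex f + b.
Proof.
move=> h; rewrite RintegralD //.
- rewrite RintegralZl //; last exact: bounded_on_integrable.
  by rewrite Rintegral_cst // [fine _](_ : _ = 1) ?mulr1 //; exact: (congr1 fine PD).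
- by apply: bounded_on_integrable; exact: bounded_onZ.
- by apply: bounded_on_integrable; exact: bounded_on_cst.
Qed.

Lemma le_expectation_bounded f g : bounded_on f -> bounded_on g ->
  (forall x, D x -> f x <= g x) -> Ex f <= Ex g.
Proof. by move=> hf hg; apply: le_Rintegral => //; exact: bounded_on_integrable. Qed.

Lemma expectation_bounded_dist f g c : bounded_on f -> bounded_on g ->
  (forall x, D x -> `|f x - g x| <= c) -> `|Ex f - Ex g| <= c.
Proof.
move=> hf hg h.
have half k k' : bounded_on k -> bounded_on k' -> (forall x, D x -> k x <= k' x + c) ->
    Ex k <= Ex k' + c.
  move=> hk hk' hkk; rewrite -[Ex k' in leRHS]mul1r -(expectation_bounded_affine 1 c hk').
  apply: le_expectation_bounded => //; last by move=> x Dx; rewrite mul1r hkk.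
  by apply: bounded_onD; [exact: bounded_onZ|exact: bounded_on_cst].
rewrite ler_distl lerBlDr; apply/andP; split; apply: half => // x Dx;
  by have := h x Dx; rewrite ler_distl => /andP[] => *; lra.
Qed.

Lemma expectation_bounded_cvg (f : nat -> T -> R) g c :
  (forall n, measurable_fun D (f n)) -> (forall n x, D x -> `|f n x| <= c) ->
  (forall x, D x -> f n x @[n --> \oo] --> g x) ->
  bounded_on g /\ Ex (f n) @[n --> \oo] --> Ex g.
Proof.
move=> mf fc fg.
have mg : measurable_fun D g by apply: measurable_fun_cvg fg.
have bg : bounded_on g.
  apply: (@bounded_onI _ c) => // x Dx.
  have cg : `|f n x| @[n --> \oo] --> `|g x| by apply: cvg_norm; exact: fg.
  by apply: (cvgr_to_le cg); apply: nearW => n; exact: fc.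
split=> //; rewrite /Rintegral; apply: fine_cvg.
rewrite fineK; last exact/integrable_fin_num/bounded_on_integrable.
have [] := @dominated_convergence _ _ _ P D mD (fun n x => (f n x)%:E) (EFin \o g) (cst c%:E).
- by move=> n; exact/measurable_EFinP.
- exact/measurable_EFinP.
- by apply: aeW => x Dx; apply: cvg_EFin; [exact: nearW|exact: fg].
- by apply: (bounded_on_integrable (bounded_on_cst c)).
- by apply: aeW => x n Dx; rewrite /= lee_fin; exact: fc.
by [].
Qed.

(* [f] need not be measurable outside [D]. *)
Lemma integral_full_measure f : (forall x, 0 <= f x) -> bounded_on f ->
  (\int[P]_x (f x)%:E)%E = (Ex f)%:E.
Proof.
move=> f0 hf; have [mf _] := hf.
rewrite /Rintegral fineK; last exact/integrable_fin_num/bounded_on_integrable.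
have PD0 : P (~` D) = 0%E by rewrite probability_setC // -[1%E]PD subee // PD.
apply/eqP; rewrite eq_le; apply/andP; split.
  (* A simple function below [f] is measurable everywhere, so its integral may be restricted to [D];
     the supremum inherits the bound. *)
  rewrite ge0_integralTE; last by move=> x; rewrite lee_fin.
  apply: ge_ereal_sup => _ [h /= hf' <-].
  have -> : sintegral P h = (\int[P]_x (h x)%:E)%E.
    by rewrite integral_nnsfun // patch_setT.
  have mh : measurable_fun setT (fun x => (h x)%:E) by exact/measurable_EFinP.
  rewrite (@ge0_negligible_integral _ _ _ _ _ (~` D)) //; last first.
  - by move=> x _; rewrite lee_fin.
  - exact: measurableC.
  rewrite setTD setCK; apply: ge0_le_integral => //.
  - by move=> x _; rewrite lee_fin.
  - by apply: measurable_funS mh.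
  - exact/measurable_EFinP.
rewrite integral_mkcond !ge0_integralTE; first last.
- by move=> x; apply: erestrict_ge0 => y _; rewrite lee_fin.
- by move=> x; rewrite lee_fin.
apply: ereal_sup_le => _ [h /= hf' <-]; exists h => // x.
apply: le_trans (hf' x) _; rewrite /patch; case: ifP => // _.
by rewrite lee_fin.
Qed.

End BoundedExpectation.

(** * Stationarity and boundedness of polynomial matrix elements *)

Section AlmostSureExpectation.
Variables (R : realType) (d : nat).
Local Notation Om := (config R d).
Variables (mu : probability (measurableTypeR R) R) (P : probability Om R).
Hypothesis hP : product_law mu P.
Variable M : R.
Hypotheses (M0 : 0 <= M) (PM : P (bounded_configs M) = 1%E).
Local Notation D := (bounded_configs M : set Om).
Local Notation Ex f := (\int[P]_(om in D) f om)%R.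
Implicit Types (f g : Om -> R) (p : {poly R}) (om : Om).
Let mD : measurable D := measurable_bounded_configs M.
Local Notation R0 := (2 * #|` units d|%:R + M).

Lemma bounded_configs_translate c om : D (translate c om) = D om.
Proof.
apply/propext; split=> h k; last exact: h.
by have := h (k - c); rewrite /translate subrK.
Qed.

Lemma expectation_translate c f : bounded_on D f ->
  Ex (fun om => f (translate c om)) = Ex f.
Proof.
move=> hf; have [mf [b hb]] := hf.
have mt : measurable_fun D (fun om => f (translate c om)).
  apply: (measurable_comp mD) mf _ => //.
  - by move=> _ [om Dom <-]; rewrite bounded_configs_translate.
  - by apply: (measurable_funS (E := setT)) => //; exact: measurable_translate.
have ht : bounded_on D (fun om => f (translate c om)).
  by apply: (bounded_onI mt) => om Dom; apply: hb; rewrite bounded_configs_translate.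
(* Adding the bound [b] makes the integrand nonnegative on [D], as [integral_translate] requires. *)
suff : Ex (fun om => 1 * f (translate c om) + b) = Ex (fun om => 1 * f om + b).
  by rewrite !(expectation_bounded_affine mD PM) // !mul1r => /addIr.
rewrite /Rintegral; congr fine; rewrite integral_mkcond [RHS]integral_mkcond.
rewrite -(integral_translate hP c (f := (fun om => (1 * f om + b)%:E) \_ D)).
- apply: eq_integral => om _; rewrite /patch.
  have -> : (translate c om \in D) = (om \in D).
    by apply/idP/idP; rewrite !inE bounded_configs_translate.
  by [].
- apply/(measurable_restrictT _ mD); apply/measurable_EFinP; apply: measurable_funD => //.
  exact: measurable_funM.
- move=> om; apply: erestrict_ge0 => x Dx; rewrite lee_fin mul1r -lerBlDr sub0r.
  by have := hb x Dx; rewrite ler_norml => /andP[].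
Qed.

Lemma powk_bound A k y x om : D om -> `|powk om A k y x| <= R0 ^+ k.
Proof.
move=> Dom; elim: k x => [|k IH] x.
  by rewrite expr0 /powk /= /delta; case: (x == y); rewrite ?normr1 ?normr0.
have R0_ge0 : 0 <= R0 by rewrite addr_ge0.
rewrite powkS /restricted; case: (A x); last by rewrite normr0 exprn_ge0.
rewrite andersonE (le_trans (ler_normD _ _)) // exprS mulrDl lerD //; last first.
  by rewrite normrM ler_pM.
rewrite (le_trans (ler_norm_sum _ _ _)) // -mulrA.
apply: (@le_trans _ _ (\sum_(e <- units d) (R0 ^+ k + R0 ^+ k))).
  by apply: ler_sum => e _; rewrite (le_trans (ler_normB _ _)) // lerD.
by rewrite big_const_seq count_predT iter_addr_0 -mulr_natl le_eqVlt; apply/orP; left; apply/eqP; ring.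
Qed.

Lemma ploc_bound A p x om : D om ->
  `|ploc om A p x| <= \sum_(k < size p) `|p`_k| * R0 ^+ k.
Proof.
move=> Dom; rewrite (le_trans (ler_norm_sum _ _ _)) // ler_sum // => k _.
by rewrite normrM ler_wpM2l // powk_bound.
Qed.

Lemma bounded_on_ploc A p x : bounded_on D (fun om => ploc om A p x).
Proof.
apply: (bounded_onI (c := \sum_(k < size p) `|p`_k| * R0 ^+ k)).
  exact: measurable_funS (measurable_ploc _ _ _).
by move=> om; exact: ploc_bound.
Qed.

Lemma expectation_ploc_translate p x :
  Ex (fun om => ploc om xpredT p x) = Ex (fun om => ploc om xpredT p 0).
Proof.
rewrite -(expectation_translate x (bounded_on_ploc xpredT p 0)).
apply: eq_Rintegral => om _; apply: eq_bigr => k _.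
by rewrite powk_translate add0r.
Qed.

End AlmostSureExpectation.

(** * From inequalities for polynomials to values at half-lines *)

Section StepPolynomialFunctional.
Variable R : realType.
Implicit Types (E e C : R) (n : nat).

Lemma step_poly_bounds E e C n t : 0 < e -> `|E| < n%:R -> C + 2 * `|E| <= n%:R -> `|t| <= C ->
  (1 - n%:R^-1) * (nat_of_bool (t <= E))%:R <= (step_poly E n).[t]
    <= (nat_of_bool (t <= E + e))%:R + 4 / (n%:R * e).
Proof.
move=> e0 En Cn; rewrite ler_norml => /andP[t1 t2].
have n0 : 0 < n%:R :> R by exact: le_lt_trans En.
have a1 := ler_norm E; have a2 := ler_norm (- E); rewrite normrN in a2.
have hn : - n%:R <= t by have := normr_ge0 E; lra.
have hn2 : t <= n%:R + 2 * E by lra.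
have h01 : 0 <= (step_poly E n).[t] <= 1 by apply: step_poly01; rewrite ?hn.
have [p0 p1] := andP h01; apply/andP; split.
  have [le|gt] := leP t E; last by rewrite mulr0.
  by rewrite mulr1 step_poly_ge // hn.
have q0 : 0 <= 4 / (n%:R * e) by rewrite divr_ge0 // mulr_ge0 ?ltW.
have [le|gt] := leP t (E + e); first by rewrite (le_trans p1) // lerDl.
by rewrite add0r step_poly_le // (ltW gt).
Qed.

Variables (v : {poly R} -> R) (g C : R -> R) (dl : R).
Hypotheses (dl0 : 0 <= dl) (vN : forall p, v (- p) = - v p)
  (g01 : forall E, 0 <= g E <= 1)
  (gc : forall E, g (E + n.+1%:R^-1) @[n --> \oo] --> g E)
  (vg : forall E (p : {poly R}) a b,
    (forall t, `|t| <= C E -> a * (nat_of_bool (t <= E))%:R + b <= p.[t]) ->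
    a * g E + b - `|a| * dl <= v p).

(** The step polynomial is nearly above the indicator of []-oo, E]] but nearly below only that of
    []-oo, E + e]]; right continuity of [g] removes [e]. The abstract [v] serves twice: for the
    spectral measure of one configuration with [dl = 0], and for the mean finite-volume density with
    [dl = d / m]. *)
Lemma step_poly_functional E eps : 0 < eps ->
  \forall n \near \oo, `|v (step_poly E n) - g E| <= dl + eps.
Proof.
move=> eps0.
have [k [ek0 gk]] : exists k : nat, 0 < (k.+1%:R^-1 : R) /\ g (E + k.+1%:R^-1) <= g E + eps / 2.
  have e2 : 0 < eps / 2 by rewrite divr_gt0.
  have [k _ hk] := (cvgrPdist_le _ _).1 (@gc E) _ e2; exists k; split=> //.
  by have := hk k (leqnn k); rewrite /= ler_distlC => /andP[_].
set e := (k.+1%:R^-1 : R) in ek0 gk *.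
near=> n.
have En : `|E| < n%:R by near: n; exact: near_natr_gt.
have Cn : C E + 2 * `|E| <= n%:R by near: n; exact: near_natr_ge.
have Een : C (E + e) + 2 * `|E| <= n%:R by near: n; exact: near_natr_ge.
have n1 : 1 <= n%:R :> R by near: n; exact: near_natr_ge.
have n0 : 0 < n%:R :> R by exact: lt_le_trans n1.
have i1 : n%:R^-1 <= 1 :> R by rewrite invf_le1.
have i0 : 0 <= n%:R^-1 :> R by rewrite invr_ge0 ltW.
have ie : n%:R^-1 <= eps.
  by rewrite -[eps]invrK lef_pV2 ?posrE ?invr_gt0 //; near: n; exact: near_natr_ge.
have i2 : 4 / (n%:R * e) <= eps / 2.
  rewrite ler_pdivrMr ?mulr_gt0 // mulrCA -ler_pdivrMr ?mulr_gt0 ?divr_gt0 //.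
  by near: n; exact: near_natr_ge.
have lo : (1 - n%:R^-1) * g E + 0 - `|1 - n%:R^-1| * dl <= v (step_poly E n).
  apply: vg => t tC; rewrite addr0.
  by have /andP[] := step_poly_bounds ek0 En Cn tC.
have up : - 1 * g (E + e) + (- (4 / (n%:R * e))) - `|- 1| * dl <= v (- step_poly E n).
  apply: vg => t tC; rewrite hornerN mulN1r -opprD lerN2.
  by have /andP[] := step_poly_bounds ek0 En Een tC.
rewrite vN normrN1 in up; rewrite ger0_norm ?subr_ge0 // in lo.
have [g0 g1] := andP (g01 E).
have h1 : n%:R^-1 * g E <= n%:R^-1 by rewrite ler_piMr.
have h2 : 0 <= n%:R^-1 * dl by rewrite mulr_ge0.
by rewrite ler_distl; apply/andP; split; lra.
Unshelve. all: by end_near. Qed.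

End StepPolynomialFunctional.

(** * The integrated density of states against finite-volume means *)

Section DensityOfStates.
Variables (R : realType) (d : nat).
Local Notation Om := (config R d).
Variables (mu : probability (measurableTypeR R) R) (P : probability Om R).
Hypothesis hP : product_law mu P.
Variable M : R.
Hypotheses (M0 : 0 <= M) (PM : P (bounded_configs M) = 1%E).
Local Notation D := (bounded_configs M : set Om).
Local Notation Ex f := (\int[P]_(om in D) f om)%R.
Implicit Types (p : {poly R}) (om : Om).
Let mD : measurable D := measurable_bounded_configs M.
Local Notation R0 := (2 * #|` units d|%:R + M).

Lemma plocN (om : Zd d -> R) A p x : ploc om A (- p) x = - ploc om A p x.
Proof. by rewrite /ploc size_polyN -sumrN; apply: eq_bigr => k _; rewrite coefN mulNr. Qed.

(** Each application of the operator looks one site further, so the k-th power cannot detect a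
    boundary beyond distance k. *)
Lemma powk_interior (om : Zd d -> R) (A : pred (Zd d)) k y x :
  (forall z : Zd d, (forall i, `|z 0 i - (x : Zd d) 0 i| <= k%:R) -> A z) ->
  powk om A k y x = powk om xpredT k y x.
Proof.
elim: k x => [//|k IH] x hA; rewrite !powkS /restricted hA; last first.
  by move=> i; rewrite subrr normr0 ler0n.
rewrite !andersonE IH; last first.
  by move=> z hz; apply: hA => i; rewrite (le_trans (hz i)) // ler_nat.
congr (_ + _); rewrite [LHS]big_seq [RHS]big_seq; apply: eq_bigr => e eU.
rewrite IH // => z hz; apply: hA => i.
have /mem_units/(nearest_neighbours_coord i) := eU; rewrite mxE subr0 => he.
have := hz i; rewrite mxE => hz'.
rewrite (_ : z 0 i - x 0 i = (z 0 i - (x 0 i + e 0 i)) + e 0 i); last by ring.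
by rewrite (le_trans (ler_normD _ _)) // -natr1 lerD.
Qed.

(** At sites of the inner box [I] the boundary is out of reach of every power occurring in [p], and
    the two terms coincide; at the remaining sites both are bounded trivially. *)
Lemma trace_boundary p N om : D om -> (2 * size p <= N)%N ->
  `|\sum_(x <- box 0 N) ploc om (mem (box 0 N)) p x - \sum_(x <- box 0 N) ploc om xpredT p x|
   <= 2 * (\sum_(k < size p) `|p`_k| * R0 ^+ k) *
      ((N ^ d)%:R - ((N - 2 * size p) ^ d)%:R).
Proof.
set B := \sum_(k < size p) _ => Dom hN; set I := box (const_mx (size p)%:Z : Zd d) (N - 2 * size p).
have B0 : 0 <= B by apply: sumr_ge0 => k _; rewrite mulr_ge0 // exprn_ge0 // addr_ge0.
rewrite -sumrB (le_trans (ler_norm_sum _ _ _)) //.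
apply: (@le_trans _ _ (\sum_(x <- box 0 N) 2 * B * (1 - (x \in I)%:R))).
  apply: ler_sum => x _; have [/in_box xI|xI] := boolP (x \in I); last first.
    rewrite subr0 mulr1 (le_trans (ler_normB _ _)) // mulr_natl mulr2n.
    by apply: lerD; exact: ploc_bound.
  rewrite subrr mulr0 (_ : ploc om (mem (box 0 N)) p x = ploc om xpredT p x).
    by rewrite subrr normr0.
  apply: eq_bigr => k _; congr (_ * _); apply: powk_interior => z hz.
  apply/in_box => i; have := hz i; have := xI i; have := ltn_ord k.
  by rewrite !mxE; move: hN; clear; lia.
rewrite -mulr_sumr ler_wpM2l ?mulr_ge0 // sumrB lerB //.
  by rewrite big_const_seq count_predT iter_addr_0 card_box.
rewrite -natr_sum ler_nat -(card_box (const_mx (size p)%:Z : Zd d) _) -/I.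
rewrite -(big_mkcond (fun x => x \in I) (fun=> 1%N)) /= sum1_count -size_filter.
apply: uniq_leq_size; first exact: fset_uniq.
move=> x xI; rewrite mem_filter xI /=; apply/in_box => i; have /in_box/(_ i) := xI.
by rewrite !mxE; move: hN; clear; lia.
Qed.

Lemma trace_ge p a b E (S : {fset Zd d}) om : D om ->
  (forall t, `|t| <= R0 -> a * (nat_of_bool (t <= E))%:R + b <= p.[t]) ->
  a * (neig om S E)%:R + b * #|` S|%:R <= \sum_(x <- S) ploc om (mem S) p x.
Proof.
move=> Dom hp; rewrite big_seq_fsetE sum_ploc neigE -sum1_card natr_sum mulr_sumr.
rewrite [X in X + _](_ : _ = \sum_i a * (nat_of_bool (@spectrum R d om S i <= E))%:R); last first.
  by rewrite big_mkcond; apply: eq_bigr => i _; rewrite inE; case: (_ <= _); rewrite ?mulr1 ?mulr0.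
rewrite [X in _ + X](_ : _ = \sum_(i < #|{: S}|) b); last first.
  by rewrite sumr_const card_ord mulr_natr cardfE.
rewrite -big_split /=; apply: ler_sum => i _; apply: hp.
have := @spectrum_bound R d om S M _ i; rewrite natrM; apply=> x _; exact: Dom.
Qed.

Definition mean_density l E : R := Ex (fun om => (neig om (box 0 l) E)%:R / (l ^ d)%:R).

Lemma neig_box_le om a l E : (neig om (box a l) E)%:R <= (l ^ d)%:R :> R.
Proof. by rewrite ler_nat -(card_box a l) neig_card. Qed.

Lemma bounded_on_neig S E : bounded_on D (fun om : Om => (neig om S E)%:R : R).
Proof.
apply: (bounded_onI (c := #|` S|%:R)).
  by apply: (measurable_funS (E := setT)) => //; exact: measurable_neig.
by move=> om _; rewrite ger0_norm // ler_nat neig_card.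
Qed.

Lemma bounded_on_neig_div S E c : bounded_on D (fun om : Om => (neig om S E)%:R / c : R).
Proof. by apply: bounded_onM; [exact: bounded_on_neig|exact: bounded_on_cst]. Qed.

Lemma expectation_neig_box a l E :
  Ex (fun om => (neig om (box a l) E)%:R / (l ^ d)%:R) = mean_density l E.
Proof.
rewrite /mean_density -[RHS](expectation_translate hP PM a) //; last exact: bounded_on_neig_div.
by apply: eq_Rintegral => om _; rewrite neig_translate add0r.
Qed.

Lemma mean_density01 l E : 0 <= mean_density l E <= 1.
Proof.
apply/andP; split; first by apply: Rintegral_ge0 => om _; rewrite divr_ge0.
have -> : 1 = Ex (fun=> 1) by rewrite Rintegral_cst // [fine _](_ : _ = 1) ?mulr1 //; exact: (congr1 fine PM).
apply: (le_expectation_bounded mD PM).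
- exact: bounded_on_neig_div.
- exact: bounded_on_cst.
move=> om _; have [->|n0] := eqVneq ((l ^ d)%:R : R) 0; first by rewrite invr0 mulr0.
by rewrite ler_pdivrMr ?mul1r ?neig_box_le // lt_def n0 /=.
Qed.

(** The small boxes fill the proportion (1 - 1/m)^d of the large one, which is at least 1 - d/m by
    Bernoulli's inequality, whatever [k]. *)
Lemma mean_density_grid m k E : (1 < m)%N -> (0 < k)%N ->
  `|mean_density (k * m) E - mean_density m.-1 E| <= d%:R / m%:R.
Proof.
move=> m1 k0; have l0 : (0 < m.-1)%N by case: m m1 => [|[]].
have lm : (m.-1 < m)%N by case: m m1 {l0}.
have m0 : (m%:R : R) != 0 by rewrite pnatr_eq0 -lt0n (ltn_trans _ m1).
have kd0 : ((k ^ d)%:R : R) != 0 by rewrite pnatr_eq0 -lt0n expn_gt0 k0.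
have dist : 1 - ((k * m.-1) ^ d)%:R / ((k * m) ^ d)%:R <= d%:R / m%:R :> R.
  rewrite !expnMn !natrM invfM mulrACA divff // mul1r !natrX -expr_div_n.
  rewrite (_ : m.-1%:R / m%:R = 1 + - m%:R^-1 :> R); last first.
    by rewrite -subn1 natrB ?(ltnW m1) // mulrBl divff // mul1r.
  have := @bernoulli_ge R (- m%:R^-1) d; rewrite lerN2 invf_le1 ?ltr0n ?(ltn_trans _ m1) //.
  by rewrite ler1n (ltnW m1) mulrN => /(_ isT); lra.
have avg : mean_density m.-1 E = Ex (fun om => (\sum_(c <- grid 0 m k)
    (neig om (box c m.-1) E)%:R) / ((k * m.-1) ^ d)%:R).
  under eq_Rintegral => om _ do rewrite expnMn natrM invfM mulrCA mulr_suml.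
  rewrite RintegralZl //; last first.
    by apply: (bounded_on_integrable mD PM); apply: bounded_on_sum => c; exact: bounded_on_neig_div.
  rewrite (expectation_bounded_sum mD PM); last by move=> c; exact: bounded_on_neig_div.
  under eq_bigr do rewrite expectation_neig_box.
  rewrite big_const_seq count_predT iter_addr_0 (card_grid _ _ (ltnW m1)).
  by rewrite -[X in _ = _ * X]mulr_natl mulrA mulVf // mul1r.
have bg : bounded_on D (fun om => (\sum_(c <- grid 0 m k)
    (neig om (box c m.-1) E)%:R) / ((k * m.-1) ^ d)%:R : R).
  apply: bounded_onM; last exact: bounded_on_cst.
  by apply: bounded_on_sum => c; exact: bounded_on_neig.
rewrite avg; apply: (expectation_bounded_dist mD PM) => //; first exact: bounded_on_neig_div.
by move=> om _; apply: le_trans dist; apply: neig_grid_average.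
Qed.

Lemma neig_right_cvg om S E :
  (neig om S (E + n.+1%:R^-1))%:R @[n --> \oo] --> ((neig om S E)%:R : R).
Proof.
have e E' : (neig om S E')%:R = \sum_i (nat_of_bool (@spectrum R d om S i <= E'))%:R :> R.
  by rewrite neigE -sum1_card natr_sum big_mkcond; apply: eq_bigr => i _; rewrite inE; case: ifP.
under eq_fun do rewrite e; rewrite e; apply: cvg_sumr => i.
apply: cvg_near_cst; near=> n; congr (nat_of_bool _)%:R.
have [le|gt] := leP (@spectrum R d om S i) E; first by rewrite (le_trans le) // lerDl.
apply/negbTE; rewrite -ltNge -ltrBrDl -[ltRHS]invrK ltf_pV2 ?posrE ?invr_gt0 ?subr_gt0 //.
near: n; have [K _ hK] := near_natr_gt (@spectrum R d om S i - E)^-1.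
by exists K => // n Kn; apply: hK; exact: leq_trans Kn _.
Unshelve. all: by end_near. Qed.

Lemma mean_density_right_cvg l E :
  mean_density l (E + n.+1%:R^-1) @[n --> \oo] --> mean_density l E.
Proof.
apply: (expectation_bounded_cvg mD PM (c := 1) _ _ _).2.
- by move=> n; have [] := bounded_on_neig_div (box 0 l) (E + n.+1%:R^-1) (l ^ d)%:R.
- move=> n om _; rewrite ger0_norm ?divr_ge0 //.
  have [->|n0] := eqVneq ((l ^ d)%:R : R) 0; first by rewrite invr0 mulr0.
  by rewrite ler_pdivrMr ?mul1r ?neig_box_le // lt_def n0 /=.
- by move=> om _; apply: cvgM; [exact: neig_right_cvg|exact: cvg_cst].
Qed.

(** By stationarity the expectation at the origin is the mean trace per site of a box of side k m,
    up to boundary terms. These vanish as [k] grows, while the walls keep costing d/m. *)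
Lemma mean_density_functional m E p a b : (1 < m)%N ->
  (forall t, `|t| <= R0 -> a * (nat_of_bool (t <= E))%:R + b <= p.[t]) ->
  a * mean_density m.-1 E + b - `|a| * (d%:R / m%:R) <= Ex (fun om => ploc om xpredT p 0).
Proof.
move=> m1 hp; set ep := Ex _.
set B := \sum_(k < size p) `|p`_k| * R0 ^+ k.
have B0 : 0 <= B by apply: sumr_ge0 => k _; rewrite mulr_ge0 // exprn_ge0 // addr_ge0.
have m0 : (0 < m)%N by exact: ltn_trans m1.
have main k : (0 < k)%N -> (2 * size p <= k)%N ->
    a * mean_density m.-1 E + b - `|a| * (d%:R / m%:R) <= ep + 4 * B * (size p * d)%:R / k%:R.
  move=> k0 hk; pose N := (k * m)%N.
  have kN : (k <= N)%N by rewrite leq_pmulr.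
  have hN : (2 * size p <= N)%N by exact: leq_trans hk kN.
  have N0 : (0 < N)%N by exact: leq_trans k0 kN.
  have Nd0 : 0 < (N ^ d)%:R :> R by rewrite ltr0n expn_gt0 N0.
  have h1 : (N ^ d)%:R * (a * mean_density N E + b) <= (N ^ d)%:R * ep +
      2 * B * ((N ^ d)%:R - ((N - 2 * size p) ^ d)%:R).
    set c := 2 * B * _.
    pose f om := (N ^ d)%:R * a * ((neig om (box 0 N) E)%:R / (N ^ d)%:R) + b * (N ^ d)%:R.
    pose g om := 1 * (\sum_(x <- box 0 N) ploc om xpredT p x) + c.
    have bg0 : bounded_on D (fun om => \sum_(x <- box 0 N) ploc om xpredT p x).
      by apply: bounded_on_sum => x; exact: bounded_on_ploc.
    have -> : (N ^ d)%:R * (a * mean_density N E + b) = Ex f.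
      rewrite (expectation_bounded_affine mD PM); last exact: bounded_on_neig_div.
      by rewrite -/(mean_density N E); ring.
    have -> : (N ^ d)%:R * ep + c = Ex g.
      rewrite (expectation_bounded_affine mD PM) // mul1r (expectation_bounded_sum mD PM); last first.
        by move=> x; exact: bounded_on_ploc.
      under eq_bigr do rewrite (expectation_ploc_translate hP M0 PM).
      by rewrite big_const_seq count_predT iter_addr_0 card_box mulr_natl.
    apply: (le_expectation_bounded mD PM).
    - apply: bounded_onD; last exact: bounded_on_cst.
      by apply: bounded_onZ; exact: bounded_on_neig_div.
    - by apply: bounded_onD; [exact: bounded_onZ|exact: bounded_on_cst].
    move=> om Dom; have := trace_boundary Dom hN; rewrite ler_norml => /andP[_].
    have := trace_ge (box 0 N) Dom hp; rewrite card_box -/B -/c /f /g mul1r.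
    rewrite (_ : _ * a * (_ / _) = a * (neig om (box 0 N) E)%:R); first by lra.
    by rewrite mulrAC -mulrA [_ / _ * _]mulrC mulrA mulrAC; field; rewrite gt_eqF.
  have h2 : (N ^ d)%:R - ((N - 2 * size p) ^ d)%:R <=
      (N ^ d)%:R * (2 * (size p * d)%:R / k%:R) :> R.
    have : 1 - d%:R * (2 * (size p)%:R / N%:R) <= (1 - 2 * (size p)%:R / N%:R) ^+ d :> R.
      have := @bernoulli_ge R (- (2 * (size p)%:R / N%:R)) d; rewrite mulrN; apply.
      by rewrite lerN2 ler_pdivrMr ?ltr0n // mul1r -natrM ler_nat.
    rewrite (_ : 1 - 2 * (size p)%:R / N%:R = (N - 2 * size p)%N%:R / N%:R); last first.
      by rewrite natrB // natrM mulrBl divff // pnatr_eq0 -lt0n.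
    rewrite expr_div_n -!natrX ler_pdivlMr // mulrBl mul1r => h3.
    have h4 : d%:R * (2 * (size p)%:R / N%:R) <= 2 * (size p * d)%:R / k%:R :> R.
      rewrite (_ : d%:R * (2 * (size p)%:R / N%:R) = 2 * (size p * d)%:R / N%:R :> R).
        2: by rewrite natrM; ring.
      by rewrite ler_wpM2l // ?lef_pV2 ?posrE ?ltr0n ?ler_nat // mulr_ge0.
    have := ler_wpM2r (ltW Nd0) h4; lra.
  have h3 : a * mean_density N E + b <= ep + 4 * B * (size p * d)%:R / k%:R.
    rewrite -(ler_pM2l Nd0) (le_trans h1) // [leRHS]mulrDr lerD2l.
    have := ler_wpM2l (mulr_ge0 (ler0n R 2) B0) h2; move=> /le_trans; apply.
    by rewrite le_eqVlt; apply/orP; left; apply/eqP; ring.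
  have h4 := mean_density_grid E m1 k0.
  have h5 : a * mean_density m.-1 E - a * mean_density N E <= `|a| * (d%:R / m%:R).
    rewrite -mulrBr (le_trans (ler_norm _)) // normrM ler_wpM2l // distrC //.
  by move: h3 h5; lra.
set W := 4 * B * _ in main; apply/ler_addgt0Pr => eps eps0.
have [k _ /(_ (maxn k (2 * size p).+1)) hk] := near_natr_gt (W / eps).
have k0 : (0 < maxn k (2 * size p).+1)%N by rewrite leq_max orbT.
have := main _ k0; rewrite leq_max leqnSn orbT => /(_ isT) /le_trans; apply.
rewrite lerD2l ler_pdivrMr ?ltr0n // mulrC -ler_pdivrMr //.
by apply: ltW; apply: hk; rewrite /= leq_maxl.
Qed.

Section IntegratedDensity.
Variables (Q : (Zd d -> R) -> R -> (Zd d -> R) -> (Zd d -> R)) (F : R -> R).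
Hypothesis HQ : forall om, spectral_resolution (anderson om) (Q om).
Hypothesis FE : forall E, ((F E)%:E =
  'E_P[fun om : Om => inner (@delta0 R d) (Q om E (@delta0 R d))])%E.
Local Notation G om E := (cdf_at (Q om) (@delta0 R d) E).

Lemma cdf_at_step_poly om E eps : D om -> 0 < eps ->
  exists N, forall n, (N <= n)%N -> `|ploc om xpredT (step_poly E n) 0 - G om E| <= eps.
Proof.
move=> Dom eps0.
have := @step_poly_functional R (fun p => ploc om xpredT p 0) (fun E => G om E)
  (fun E => 2 * `|E| + `|R0| + 1) 0 (lexx 0) (fun p => plocN _ _ _ _) _ _ _ E eps eps0.
case.
- by move=> E'; rewrite (cdf_at_ge0 (HQ om)) (cdf_at_le1 Dom (HQ om)).
- by move=> E'; exact: cdf_at_right_cvg (HQ om) E'.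
- move=> E' p a b h; rewrite mulr0 subr0; exact: (spectral_cdf_le Dom (HQ om) h).
- by move=> N _ hN; exists N => n Nn; have := hN n Nn; rewrite /= add0r.
Qed.

(** The resolutions [Q om] come with no measurability in [om]; it is inherited from the polynomials,
    whose pointwise limit on [D] is the spectral distribution. The shift by [N0] discards the
    polynomials not yet between 0 and 1 on the spectrum, so that dominated convergence applies. *)
Lemma expectation_cdf_at E :
  bounded_on D (fun om => G om E) /\
  exists N, Ex (fun om => ploc om xpredT (step_poly E (n + N)) 0) @[n --> \oo] --> F E.
Proof.
have [N0 _ hN0] := near_natr_gt (`|E| + (2 * `|E| + `|R0| + 1) + 2 * `|E|).
have [bG cG] : bounded_on D (fun om => G om E) /\
    Ex (fun om => ploc om xpredT (step_poly E (n + N0)) 0) @[n --> \oo] --> Ex (fun om => G om E).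
  apply: (expectation_bounded_cvg mD PM (c := 1)).
  - by move=> n; have [] := @bounded_on_ploc R d M M0 xpredT (step_poly E (n + N0)) 0.
  - move=> n om Dom; set p := step_poly E (n + N0).
    have := hN0 _ (leq_addl n N0); rewrite /= => hn.
    have a1 := normr_ge0 E; have a2 := normr_ge0 R0; have a3 := ler_norm E; have a4 := ler_norm (- E).
    rewrite normrN in a4.
    have p01 t : `|t| <= 2 * `|E| + `|R0| + 1 -> 0 <= p.[t] <= 1.
      rewrite ler_norml => /andP[t1 t2]; apply: step_poly01; first by lra.
      by apply/andP; split; lra.
    have := @spectral_cdf_le R d om M Dom (Q om) (HQ om) E p 0 0.
    have := @spectral_cdf_le R d om M Dom (Q om) (HQ om) E (- p) 0 (-1).
    rewrite plocN !mul0r !add0r lerN2 => h1 h2.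
    rewrite ger0_norm; [apply: h1|apply: h2] => t /p01/andP[t1 t2]; rewrite mul0r add0r //.
    by rewrite hornerN lerN2.
  - move=> om Dom; apply/cvgrPdist_le => eps eps0.
    have [N hN] := cdf_at_step_poly E Dom eps0.
    by exists N => // n /= Nn; rewrite distrC; apply: hN; exact: leq_trans Nn (leq_addr _ _).
split=> //; exists N0; suff -> : F E = Ex (fun om => G om E) by [].
apply: EFin_inj; rewrite FE unlock; apply: (integral_full_measure mD PM) => // om.
exact: (cdf_at_ge0 (HQ om)).
Qed.

Lemma ids_expectation E : F E = Ex (fun om => G om E).
Proof.
have [bG _] := expectation_cdf_at E.
apply: EFin_inj; rewrite FE unlock; apply: (integral_full_measure mD PM) => // om.
exact: (cdf_at_ge0 (HQ om)).
Qed.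

Lemma ids_mono E E' : E <= E' -> F E <= F E'.
Proof.
move=> EE'; rewrite !ids_expectation; apply: (le_expectation_bounded mD PM).
- by have [] := expectation_cdf_at E.
- by have [] := expectation_cdf_at E'.
- by move=> om Dom; exact: cdf_at_mono (HQ om) _ _ EE'.
Qed.

Lemma ids_right_cvg E : F (E + n.+1%:R^-1) @[n --> \oo] --> F E.
Proof.
rewrite ids_expectation; under eq_fun do rewrite ids_expectation.
apply: (expectation_bounded_cvg mD PM (c := 1) _ _ _).2.
- by move=> n; have [[]] := expectation_cdf_at (E + n.+1%:R^-1).
- move=> n om Dom; rewrite ger0_norm; last exact: (cdf_at_ge0 (HQ om)).
  exact: (cdf_at_le1 Dom (HQ om)).
- by move=> om Dom; exact: cdf_at_right_cvg (HQ om) E.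
Qed.

(** Both sides are compared with the expectations of the same step polynomials: these converge to
    [F E] and eventually stay within d/m + eps of the mean density. *)
Lemma ids_mean_density m E : (1 < m)%N -> `|F E - mean_density m.-1 E| <= d%:R / m%:R.
Proof.
move=> m1; have [_ [N cN]] := expectation_cdf_at E.
have dm : 0 <= d%:R / m%:R :> R by rewrite divr_ge0.
apply/ler_addgt0Pr => eps eps0.
have [K _ hK] : \forall n \near \oo, `|Ex (fun om => ploc om xpredT (step_poly E n) 0) -
    mean_density m.-1 E| <= d%:R / m%:R + eps.
  apply: (@step_poly_functional R (fun p => Ex (fun om => ploc om xpredT p 0))
    (mean_density m.-1) (fun=> R0)) => //.
  - move=> p; under eq_Rintegral do rewrite plocN -mulN1r.
    by rewrite RintegralZl ?mulN1r //; apply: (bounded_on_integrable mD PM); exact: bounded_on_ploc.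
  - exact: mean_density01.
  - exact: mean_density_right_cvg.
  - by move=> E' p a b h; exact: mean_density_functional.
have c : `|Ex (fun om => ploc om xpredT (step_poly E (n + N)) 0) - mean_density m.-1 E|
    @[n --> \oo] --> `|F E - mean_density m.-1 E|.
  by apply: cvg_norm; apply: cvgB => //; exact: cvg_cst.
apply: (cvgr_to_le c); exists K => // n Kn; apply: hK.
exact: leq_trans Kn (leq_addr _ _).
Qed.

End IntegratedDensity.

End DensityOfStates.

(** * Exponential moments and Chernoff's bound *)

Lemma expR_le_quadratic (R : realType) (y : R) : `|y| <= 2^-1 -> expR y <= 1 + y + 2 * y ^+ 2.
Proof.
rewrite ler_norml => /andP[y1 y2].
have h := expR_ge1Dx (- y); have p : 0 < 1 - y by lra.
have h2 : expR y <= (1 - y)^-1.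
  by rewrite -[expR y]invrK -expRN lef_pV2 ?posrE ?expR_gt0.
apply: (le_trans h2); rewrite -[leLHS]mul1r ler_pdivrMr //.
rewrite (_ : (1 + y + 2 * y ^+ 2) * (1 - y) = 1 + y ^+ 2 * (1 - 2 * y)); last by ring.
by rewrite lerDl mulr_ge0 ?sqr_ge0 //; lra.
Qed.

Section Concentration.
Variables (R : realType) (d : nat).
Local Notation Om := (config R d).
Variables (mu : probability (measurableTypeR R) R) (P : probability Om R).
Hypothesis hP : product_law mu P.
Variable M : R.
Hypothesis PM : P (bounded_configs M) = 1%E.
Local Notation D := (bounded_configs M : set Om).
Local Notation Ex f := (\int[P]_(om in D) f om)%R.
Let mD : measurable D := measurable_bounded_configs M.
Variables (l : nat) (E : R).
Local Notation f := (mean_density P M l E).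

Definition box_deviation (c : Zd d) (om : Om) : R := (neig om (box c l) E)%:R / (l ^ d)%:R - f.

Lemma measurable_box_deviation c : measurable_fun setT (box_deviation c).
Proof.
apply: measurable_funB; last exact: measurable_cst.
by apply: measurable_funM; [exact: measurable_neig|exact: measurable_cst].
Qed.

Lemma box_deviation_le1 c om : `|box_deviation c om| <= 1.
Proof.
have /andP[f0 f1] := mean_density01 PM l E.
have x0 : 0 <= (neig om (box c l) E)%:R / (l ^ d)%:R :> R by rewrite divr_ge0.
have x1 : (neig om (box c l) E)%:R / (l ^ d)%:R <= 1 :> R.
  have [->|n0] := eqVneq ((l ^ d)%:R : R) 0; first by rewrite invr0 mulr0.
  by rewrite ler_pdivrMr ?mul1r ?neig_box_le // lt_def n0 /=.
by rewrite /box_deviation ler_norml; apply/andP; split; lra.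
Qed.

Lemma box_deviation_local c om om' : (forall k, k \in box c l -> om k = om' k) ->
  box_deviation c om = box_deviation c om'.
Proof. by move=> h; rewrite /box_deviation (neig_local E h). Qed.

Variable t : R.
Hypothesis t_le : `|t| <= 2^-1.

Lemma measurable_exp_deviation c : measurable_fun setT (fun om => expR (t * box_deviation c om)).
Proof.
apply: measurableT_comp; first exact: measurable_expR.
by apply: measurable_funM; [exact: measurable_cst|exact: measurable_box_deviation].
Qed.

Lemma exp_deviation_le c om :
  expR (t * box_deviation c om) <= 1 + t * box_deviation c om + 2 * t ^+ 2.
Proof.
have h : `|t * box_deviation c om| <= 2^-1.
  by rewrite normrM -[leRHS]mulr1 ler_pM // box_deviation_le1.
apply: le_trans (expR_le_quadratic h) _; rewrite lerD2l ler_wpM2l // exprMn.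
rewrite -[leRHS]mulr1 ler_wpM2l ?sqr_ge0 //.
by rewrite -[_ ^+ 2]ger0_norm ?sqr_ge0 // normrX exprn_ile1 // box_deviation_le1.
Qed.

(** By translation invariance the deviation has mean zero, so only the quadratic term of the
    exponential survives. *)
Lemma exp_moment c :
  (\int[P]_om (expR (t * box_deviation c om))%:E <= (expR (2 * t ^+ 2))%:E)%E.
Proof.
have bdev : bounded_on D (box_deviation c).
  apply: (bounded_onI (c := 1)); last by move=> om _; exact: box_deviation_le1.
  by apply: (measurable_funS (E := setT)) => //; exact: measurable_box_deviation.
have bexp : bounded_on D (fun om => expR (t * box_deviation c om)).
  apply: (bounded_onI (c := 2)).
    by apply: (measurable_funS (E := setT)) => //; exact: measurable_exp_deviation.
  move=> om _; rewrite ger0_norm ?expR_ge0 // (le_trans (exp_deviation_le c om)) //.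
  have h : t * box_deviation c om <= 2^-1 * 1.
    by rewrite (le_trans (ler_norm _)) // normrM ler_pM // box_deviation_le1.
  have h2 : t ^+ 2 <= 2^-1 ^+ 2.
    by rewrite -[t ^+ 2]ger0_norm ?sqr_ge0 // normrX lerXn2r // nnegrE.
  lra.
rewrite (integral_full_measure mD PM) ?lee_fin //.
apply: (@le_trans _ _ (Ex (fun om => t * box_deviation c om + (1 + 2 * t ^+ 2)))).
  apply: (le_expectation_bounded mD PM) => //.
    by apply: bounded_onD; [exact: bounded_onZ|exact: bounded_on_cst].
  by move=> om _; apply: le_trans (exp_deviation_le c om) _; lra.
rewrite (expectation_bounded_affine mD PM) //.
have -> : Ex (box_deviation c) = 0.
  rewrite /box_deviation; under eq_Rintegral do rewrite -[X in X + _]mul1r.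
  rewrite (expectation_bounded_affine mD PM); last exact: bounded_on_neig_div.
  by rewrite (expectation_neig_box hP PM) mul1r subrr.
by rewrite mulr0 add0r expR_ge1Dx.
Qed.

Lemma exp_deviation_prod_local (r : seq (Zd d)) om om' :
  (forall c, c \in r -> forall k, k \in box c l -> om k = om' k) ->
  \prod_(c <- r) expR (t * box_deviation c om) = \prod_(c <- r) expR (t * box_deviation c om').
Proof.
have gen (F G : Zd d -> R) : (forall c, c \in r -> F c = G c) ->
    \prod_(c <- r) F c = \prod_(c <- r) G c by exact: eq_big_seq.
move=> h; apply: gen => c cr.
by rewrite (box_deviation_local (h c cr)).
Qed.

Lemma exp_moment_prod (r : seq (Zd d)) : uniq r ->
  {in r &, forall c c', c != c' -> forall k, k \in box c l -> k \notin box c' l} ->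
  (\int[P]_om (\prod_(c <- r) expR (t * box_deviation c om))%:E
     <= (expR (2 * t ^+ 2) ^+ size r)%:E)%E.
Proof.
elim: r => [_ _|c r IH /= /andP[cr ur] dis].
  under eq_integral do rewrite big_nil.
  by rewrite integral_cst // mul1e expr0; apply: probability_le1.
under eq_integral do rewrite big_cons EFinM.
have m1 := measurable_exp_deviation c.
have m2 : measurable_fun setT (fun om => \prod_(c <- r) expR (t * box_deviation c om)).
  by apply: measurable_prod => c' _; exact: measurable_exp_deviation.
have p0 om : 0 <= \prod_(c <- r) expR (t * box_deviation c om).
  by apply: prodr_ge0 => c' _; exact: expR_ge0.
rewrite (independent_integral hP (S := mem (box c l))
  (f := fun om => (expR (t * box_deviation c om))%:E)
  (g := fun om => (\prod_(c <- r) expR (t * box_deviation c om))%:E)).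
- rewrite exprS EFinM; apply: lee_pmul.
  + by apply: integral_ge0 => om _; rewrite lee_fin expR_ge0.
  + by apply: integral_ge0 => om _; rewrite lee_fin.
  + exact: exp_moment.
  + by apply: IH => // c1 c2 h1 h2; apply: dis; rewrite inE ?h1 ?h2 orbT.
- exact/measurable_EFinP.
- exact/measurable_EFinP.
- by move=> om; rewrite lee_fin expR_ge0.
- by move=> om; rewrite lee_fin.
- by move=> om om' h; rewrite (box_deviation_local h).
- move=> om om' h.
  apply: (congr1 EFin); apply: exp_deviation_prod_local => c' c'r k kb; apply: h.
  have cc' : c != c' by apply: contraNneq cr => ->.
  apply/negP => kc; have := dis c c' _ _ cc' k kc; rewrite kb /=.
  by rewrite !inE eqxx c'r orbT => /(_ isT isT).
Qed.

End Concentration.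

Section Chernoff.
Variables (R : realType) (d : nat).
Local Notation Om := (config R d).
Variables (mu : probability (measurableTypeR R) R) (P : probability Om R).
Hypothesis hP : product_law mu P.
Variable M : R.
Hypothesis PM : P (bounded_configs M) = 1%E.

Lemma chernoff_half l E (r : seq (Zd d)) (kap s : R) : uniq r ->
  {in r &, forall c c', c != c' -> forall k, k \in box c l -> k \notin box c' l} ->
  0 < kap <= 2 -> `|s| = 1 ->
  (P [set om : Om | (kap * (size r)%:R < s * \sum_(c <- r) box_deviation P M l E c om)%R]
    <= (expR (- ((size r)%:R * kap ^+ 2 / 8)))%:E)%E.
Proof.
move=> ur dis /andP[k0 k2] s1; set n : R := (size r)%:R.
pose Z (om : Om) := s * \sum_(c <- r) box_deviation P M l E c om.
have mZ : measurable_fun setT Z.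
  apply: measurable_funM; first exact: measurable_cst.
  by apply: measurable_sum => c; exact: measurable_box_deviation.
set A := [set om | _].
have mA : measurable A.
  rewrite (_ : A = Z @^-1` `]kap * n, +oo[%classic).
    by rewrite -[X in measurable X]setTI; apply: mZ => //; exact: measurable_itv.
  by apply/seteqP; split=> om /=; rewrite in_itv /= andbT.
(* For s = 1 this minimizes 2 t^2 - t kap, with value -kap^2/8 per box; the sign [s] selects the
   tail. The bound kap <= 2 keeps |t| within 1/2. *)
pose t := s * kap / 4.
have t_le : `|t| <= 2^-1.
  by rewrite !normrM s1 mul1r (gtr0_norm k0) ger0_norm ?invr_ge0 //; lra.
have t2 : t ^+ 2 = kap ^+ 2 / 16.
  have s2 : s ^+ 2 = 1 by rewrite -[s ^+ 2]ger0_norm ?sqr_ge0 // normrX s1 expr1n.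
  by rewrite /t !exprMn s2 mul1r exprVn; congr (_ / _); ring.
have prodE om : \prod_(c <- r) expR (t * box_deviation P M l E c om) = expR (kap / 4 * Z om).
  rewrite -expR_sum -mulr_sumr /Z; congr expR; rewrite /t; ring.
pose K := expR (- (n * kap ^+ 2 / 4)).
have ind om : ((\1_A om)%:E <= K%:E * (\prod_(c <- r) expR (t * box_deviation P M l E c om))%:E)%E.
  rewrite prodE -EFinM lee_fin indicE; case: (boolP (om \in A)) => [|_]; last first.
    by rewrite mulr_ge0 ?expR_ge0.
  rewrite inE /A /= -/(Z om) => h.
  rewrite -expRD -[leLHS]expR0 ler_expR.
  have : kap / 4 * (kap * n) <= kap / 4 * Z om by rewrite ler_wpM2l ?divr_ge0 ?(ltW k0) ?(ltW h).
  by rewrite (_ : n * kap ^+ 2 / 4 = kap / 4 * (kap * n)); [lra|ring].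
have -> : P A = (\int[P]_om (\1_A om)%:E)%E by rewrite integral_indic // setIT.
have mp : measurable_fun setT (fun om => (\prod_(c <- r) expR (t * box_deviation P M l E c om))%:E).
  apply/measurable_EFinP; apply: measurable_prod => c _.
  exact: measurable_exp_deviation.
apply: (@le_trans _ _ (\int[P]_om (K%:E * (\prod_(c <- r) expR (t * box_deviation P M l E c om))%:E))%E).
  apply: ge0_le_integral => //.
  - by apply/measurable_EFinP; exact: measurable_indic.
  - by apply: measurable_funeM.
rewrite ge0_integralZl //; first last.
- by rewrite lee_fin expR_ge0.
- by move=> om _; rewrite lee_fin prodE expR_ge0.
apply: (@le_trans _ _ (K%:E * (expR (2 * t ^+ 2) ^+ size r)%:E)%E).
  by apply: lee_wpmul2l; [rewrite lee_fin expR_ge0|exact: (exp_moment_prod hP)].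
rewrite -EFinM lee_fin -expRM_natl /K -expRD ler_expR t2 -/n le_eqVlt.
by apply/orP; left; apply/eqP; field.
Qed.

End Chernoff.

(** * Reduction to finitely many energies *)

Lemma seq_extrema (R : realType) (s : seq R) : s != [::] ->
  exists u v, [/\ u \in s, v \in s & forall x, x \in s -> u <= x <= v].
Proof.
elim: s => // y [_ _|z s /(_ isT) [u [v [us vs uv]]] _].
  by exists y, y; rewrite !inE eqxx; split=> // x; rewrite inE => /eqP ->; rewrite lexx.
exists (Num.min y u), (Num.max y v); split.
- by rewrite minEle in_cons; case: ifP; rewrite ?eqxx ?us ?orbT.
- by rewrite maxEle in_cons; case: ifP; rewrite ?eqxx ?vs ?orbT.
- move=> x; rewrite in_cons => /predU1P[->|/uv/andP[ux xv]]; rewrite ge_min le_max ?lexx //.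
  by rewrite ux xv !orbT.
Qed.

(* Grouping the points of [s] by the levels of [f] leaves at most [n] lower and
   [n] upper representatives, whatever the size of [s]. *)
Lemma level_net (R : realType) (f : R -> R) (e : R) n (s : seq R) : 0 < e ->
  (forall x, 0 <= f x < n%:R * e) ->
  exists u v : nat -> R, forall x, x \in s -> exists2 j, (j < n)%N &
    [/\ u j <= x, x <= v j, f x <= f (u j) + e & f (v j) <= f x + e].
Proof.
move=> e0 fn.
have net j : exists uv : R * R, forall x, x \in s -> j%:R * e <= f x < j.+1%:R * e ->
    [/\ uv.1 <= x, x <= uv.2, f x <= f uv.1 + e & f uv.2 <= f x + e].
  pose sj := [seq x <- s | j%:R * e <= f x < j.+1%:R * e].
  have [sj0|sj0] := eqVneq sj [::].
    exists (0, 0) => x xs xj; have : x \in sj by rewrite mem_filter xj.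
    by rewrite sj0.
  have [u [v [us vs uv]]] := seq_extrema sj0; exists (u, v) => x xs xj.
  have /uv/andP[ux xv] : x \in sj by rewrite mem_filter xj.
  move: us vs xj; rewrite !mem_filter => /andP[/andP[u1 u2] _] /andP[/andP[v1 v2] _] /andP[x1 x2].
  by rewrite -natr1 mulrDl mul1r in u2 v2 x2; split=> //=; lra.
have [uv huv] := choice net; exists (fst \o uv), (snd \o uv) => x xs.
have /andP[x0 xn] := fn x.
have /andP[j1 j2] := truncn_itv (divr_ge0 x0 (ltW e0)).
set j := Num.truncn _ in j1 j2; exists j.
  rewrite -(ltr_nat R); apply: le_lt_trans j1 _; by rewrite ltr_pdivrMr.
by apply: huv => //; rewrite -ler_pdivlMr // j1 -ltr_pdivrMr.
Qed.

Section MeasureFacts.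
Variables (R : realType) (dT : measure_display) (T : measurableType dT).
Variable (P : probability T R).

Lemma measurable_gt (g : T -> R) (c : R) : measurable_fun setT g -> measurable [set x | c < g x].
Proof.
move=> mg; rewrite (_ : [set x | c < g x] = g @^-1` `]c, +oo[%classic).
  by rewrite -[X in measurable X]setTI; apply: mg => //; exact: measurable_itv.
by apply/seteqP; split=> x /=; rewrite in_itv /= andbT.
Qed.

(** Continuity from below: a bound independent of the number of events passes to the countable
    union, without summing over the events. *)
Lemma probability_bigcup_le (B : nat -> set T) (c : R) : (forall i, measurable (B i)) ->
  (forall n, P (\big[setU/set0]_(i < n) B i) <= c%:E)%E -> (P (\bigcup_i B i) <= c%:E)%E.
Proof.
move=> mB h; rewrite -bigcup_bigsetU_bigcup.
have mC n : measurable (\big[setU/set0]_(i < n.+1) B i) by exact: bigsetU_measurable.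
have cv : P (\big[setU/set0]_(i < n.+1) B i) @[n --> \oo] -->
    P (\bigcup_k \big[setU/set0]_(i < k.+1) B i).
  apply: nondecreasing_cvg_mu => //; first exact: bigcupT_measurable.
  by move=> k n kn; rewrite subsetEset; apply: subset_bigsetU.
by rewrite -(cvg_lim _ cv) //; apply: lime_le; [apply/cvg_ex; eexists; exact: cv|exact: nearW].
Qed.

End MeasureFacts.

Section UniformDeviation.
Variables (R : realType) (d : nat).
Local Notation Om := (config R d).
Variables (mu : probability (measurableTypeR R) R) (P : probability Om R).
Hypothesis hP : product_law mu P.
Variable M : R.
Hypothesis PM : P (bounded_configs M) = 1%E.
Variables (a : Zd d) (m q : nat).
Hypotheses (m1 : (1 < m)%N) (q0 : (0 < q)%N).
Local Notation l := m.-1.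
Local Notation f := (mean_density P M l).

Definition grid_average (om : Om) (E : R) : R :=
  (\sum_(c <- grid a m q) (neig om (box c l) E)%:R) / ((q * l) ^ d)%:R.

Let qd0 : 0 < (q ^ d)%:R :> R.
Proof. by rewrite ltr0n expn_gt0 q0. Qed.

Lemma grid_average_deviation om E :
  (q ^ d)%:R * (grid_average om E - f E) =
    \sum_(c <- grid a m q) box_deviation P M l E c om.
Proof.
rewrite /box_deviation sumrB big_const_seq count_predT iter_addr_0.
rewrite (card_grid _ _ (ltnW m1)) mulrBr; congr (_ - _); last by rewrite mulr_natl.
by rewrite /grid_average expnMn natrM invfM mulrCA mulVKf ?gt_eqF // mulr_suml.
Qed.

Lemma grid_average_mono om E E' : E <= E' -> grid_average om E <= grid_average om E'.
Proof.
move=> EE'; rewrite /grid_average ler_wpM2r ?invr_ge0 //.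
by apply: ler_sum => c _; rewrite ler_nat neig_mono.
Qed.

Lemma measurable_grid_average E : measurable_fun setT (grid_average ^~ E).
Proof.
apply: measurable_funM; last exact: measurable_cst.
by apply: measurable_sum => c; exact: measurable_neig.
Qed.

Lemma grid_average_tail E (e s : R) : 0 < e <= 2 -> `|s| = 1 ->
  (P [set om : Om | (e < s * (grid_average om E - f E))%R]
    <= (expR (- ((q ^ d)%:R * e ^+ 2 / 8)))%:E)%E.
Proof.
move=> he hs; have := chernoff_half hP PM (l := l) E (fset_uniq (grid a m q)) _ he hs.
rewrite (card_grid _ _ (ltnW m1)) => h.
rewrite (_ : [set om | _] = [set om : Om | e * (q ^ d)%:R <
    s * \sum_(c <- grid a m q) box_deviation P M l E c om]); last first.
  apply/seteqP; split=> om /=;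
    by rewrite -grid_average_deviation mulrCA [e * _]mulrC ltr_pM2l.
apply: h => c c' cg c'g cc' k kc; apply/negP => kc'.
have lm : (l < m)%N by case: m m1.
have [/eqP] := separated_grid lm cg c'g cc' kc kc'.
by [].
Qed.

(** The bound is free of [k]: by [level_net], a deviation 2e at some [s i] forces, by monotonicity
    in the energy, a deviation e downwards at a lower representative or upwards at an upper one, and
    there are only n of each. *)
Lemma prob_finite_deviation (s : nat -> R) n k (e : R) : 0 < e <= 2 -> 1 < n%:R * e ->
  (P (\big[setU/set0]_(i < k) [set om : Om | (2 * e < `|grid_average om (s i) - f (s i)|)%R])
    <= (n%:R * 2 * expR (- ((q ^ d)%:R * e ^+ 2 / 8)))%:E)%E.
Proof.
move=> he ne; have [e0 _] := andP he.
have f01 x : 0 <= f x < n%:R * e.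
  by have /andP[-> h] := mean_density01 PM l x; exact: le_lt_trans ne.
have [u [v huv]] := level_net [seq s i | i <- iota 0 k] e0 f01.
pose G (t x : R) := [set om : Om | (e < t * (grid_average om x - f x))%R].
have mG t x : measurable (G t x).
  apply: measurable_gt; apply: measurable_funM; first exact: measurable_cst.
  by apply: measurable_funB; [exact: measurable_grid_average|exact: measurable_cst].
have sub : \big[setU/set0]_(i < k) [set om : Om | (2 * e < `|grid_average om (s i) - f (s i)|)%R]
    `<=` \big[setU/set0]_(j < n) (G (-1) (u j) `|` G 1 (v j)).
  rewrite -(bigcup_mkord k (fun i => [set om : Om | (2 * e < `|grid_average om (s i) - f (s i)|)%R])).
  rewrite -(bigcup_mkord n (fun j => G (-1) (u j) `|` G 1 (v j))) => om [i /= ik]; have : s i \in [seq s i | i <- iota 0 k].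
    by apply: map_f; rewrite mem_iota.
  move=> /huv[j jn [uE Ev fu fv]] h; exists j => //=.
  have h1 := grid_average_mono om uE; have h2 := grid_average_mono om Ev.
  move: h h1 h2 fu fv; rewrite /G /=.
  move: (grid_average om (s i)) (grid_average om (u j)) (grid_average om (v j)).
  move: (f (s i)) (f (u j)) (f (v j)) => fs fu fv As Au Av.
  by rewrite lter_normr => /orP[h|h] h1 h2 h3 h4; [right|left]; lra.
apply: (@le_trans _ _ (P (\big[setU/set0]_(j < n) (G (-1) (u j) `|` G 1 (v j))))).
  apply: le_measure => //; rewrite inE; apply: bigsetU_measurable => i _.
    apply: measurable_gt; apply: measurableT_comp => //.
    by apply: measurable_funB; [exact: measurable_grid_average|exact: measurable_cst].
  by apply: measurableU.
have mGG j : (j < n)%N -> measurable (G (-1) (u j) `|` G 1 (v j)) by move=> _; exact: measurableU.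
apply: (le_trans (Boole_inequality P mGG)).
rewrite -mulrA mulr_natl -[n in X in (_ <= X)%E]card_ord -sumr_const -sumEFin.
apply: lee_sum => j _.
apply: (le_trans (@measureU2 _ _ _ P _ _ (mG _ _) (mG _ _))).
rewrite mulr_natl mulr2n EFinD; apply: leeD; apply: grid_average_tail => //.
  by rewrite normrN1.
by rewrite normr1.
Qed.

End UniformDeviation.

(** * Numerical constants *)

(* Truncation of the power series of [ln ((1 + u) / (1 - u))]. *)
Lemma ln_ratio_ge (R : realType) (u : R) : 0 <= u < 1 ->
  2 * u + 2 / 3 * u ^+ 3 + 2 / 5 * u ^+ 5 <= ln ((1 + u) / (1 - u)).
Proof.
move=> /andP[u0 u1].
pose p : {poly R} := 2 *: 'X + (2 / 3) *: 'X^3 + (2 / 5) *: 'X^5.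
pose g (x : R) : R := ln (1 + x) - ln (1 - x) - p.[x].
have pE x : p.[x] = 2 * x + 2 / 3 * x ^+ 3 + 2 / 5 * x ^+ 5.
  by rewrite /p !hornerE.
have dpE x : p^`().[x] = 2 + 2 * x ^+ 2 + 2 * x ^+ 4.
  by rewrite /p !derivD !derivZ derivX !derivXn !hornerE /=; field.
have D (x : R) : -1 < x -> x < 1 -> is_derive x (1 : R) g (2 * x ^+ 6 / (1 - x ^+ 2)).
  move=> x0 x1.
  have p1 : 0 < 1 + x by lra.
  have p2 : 0 < 1 - x by lra.
  have d1 : is_derive x (1 : R) (fun x : R => ln (1 + x)) (1 + x)^-1.
    have h : is_derive x (1 : R) (cst 1 + id : R -> R) (0 + 1) by exact: is_deriveD.
    by have := @is_derive1_comp _ (@ln R) _ _ _ _ (is_derive1_ln p1) h; rewrite add0r mulr1.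
  have d2 : is_derive x (1 : R) (fun x : R => ln (1 - x)) (- (1 - x)^-1).
    have h : is_derive x (1 : R) (cst 1 - id : R -> R) (0 - 1) by exact: is_deriveB.
    by have := @is_derive1_comp _ (@ln R) (cst 1 - id) x _ _ (is_derive1_ln p2) h; rewrite add0r mulrN1.
  apply: (@is_derive_eq _ _ _ _ _ _ _ _ (is_deriveB (is_deriveB d1 d2) (is_derive_poly p x))).
  rewrite dpE (_ : 1 - x ^+ 2 = (1 + x) * (1 - x)); last by ring.
  by field; rewrite !gt_eqF.
have mono : g 0 <= g u.
  have itv x : x \in `]0, u[%R -> -1 < x < 1 /\ 0 <= x.
    by rewrite in_itv /= => /andP[h1 h2]; split; [apply/andP; split|]; lra.
  apply: (@ger0_derive1_le_cc _ g 0 u) => //.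
  - move=> x /itv[/andP[x0 x1] _]; exact: (@ex_derive _ _ _ _ _ _ _ (D x x0 x1)).
  - move=> x /itv[/andP[x0 x1] x2]; rewrite derive1E (@derive_val _ _ _ _ _ _ _ (D x x0 x1)).
    by rewrite divr_ge0 ?mulr_ge0 ?exprn_ge0 // subr_ge0 exprn_ile1 // ltW.
  - apply: derivable_within_continuous => x; rewrite in_itv /= => /andP[h1 h2].
    have x0 : -1 < x by lra.
    have x1 : x < 1 by lra.
    exact: (@ex_derive _ _ _ _ _ _ _ (D x x0 x1)).
  - by rewrite in_itv /= lexx u0.
  - by rewrite in_itv /= lexx u0.
have g0 : g 0 = 0 by rewrite /g addr0 subr0 ln1 pE !expr0n /= !mulr0 !addr0 !subrr.
rewrite ln_div ?posrE; [|lra|lra].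
by move: mono; rewrite g0 /g pE; lra.
Qed.

(** The rationals 253/624 and 9/13 lie just below the truncated series at u = 1/5 and u = 1/3. They
    give a total of about 1206.985; at u = 1/5 the cubic truncation would already overshoot 1207. *)
Lemma constK_lt (R : realType) : constK R < 1207.
Proof.
have h3 : 253 / 624 <= ln (3 / 2) :> R.
  have := @ln_ratio_ge R (1 / 5); rewrite (_ : (1 + 1 / 5) / (1 - 1 / 5) = 3 / 2 :> R); last by field.
  by move=> h; apply: le_trans (h _); lra.
have h2 : 9 / 13 <= ln 2 :> R.
  have := @ln_ratio_ge R (1 / 3); rewrite (_ : (1 + 1 / 3) / (1 - 1 / 3) = 2 :> R); last by field.
  by move=> h; apply: le_trans (h _); lra.
have div_le (c x y : R) : 0 <= c -> 0 < y -> y <= x -> c / x <= c / y.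
  move=> c0 y0 yx; apply: ler_wpM2l => //; rewrite lef_pV2 ?posrE //; exact: lt_le_trans yx.
have k3 : 480 / ln (3 / 2) <= 480 / (253 / 624) :> R by apply: div_le; lra.
have k2 : 16 / ln 2 <= 16 / (9 / 13) :> R by apply: div_le; lra.
by rewrite /constK; apply: (le_lt_trans (lerD k3 k2)); lra.
Qed.

Lemma constK_ge1 (R : realType) : 1 <= constK R.
Proof.
have h2 : 0 < ln 2 :> R by rewrite ln_gt0 // ltr1n.
have h3 : 0 < ln (3 / 2) :> R by rewrite ln_gt0 //; lra.
have h4 : ln (3 / 2) <= 1 / 2 :> R.
  by have := @le_ln1Dx R (1 / 2); rewrite (_ : 1 + 1 / 2 = 3 / 2 :> R); [apply; lra|field].
rewrite /constK -[leLHS]addr0 lerD ?divr_ge0 ?(ltW h2) //.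
by rewrite ler_pdivlMr // mul1r; lra.
Qed.

Lemma constC_ge (R : realType) (d : nat) : (3 <= d)%N -> 800 + 3 * d%:R <= constC R d.
Proof.
move=> d3; rewrite /constC.
have h1 : 3 <= d%:R :> R by rewrite ler_nat.
have h2 : 2 ^+ 3 <= 2 ^+ d :> R by rewrite ler_weXn2l // ler1n.
lra.
Qed.

(** With y = m^(d - 2) the hypothesis says y >= z^2, hence y >= z >= ln (2/alpha). The exponent is
    at least 2y: one factor exp (-y) absorbs m <= y < exp y, and the other is at most alpha/2. *)
Lemma tail_bound_lt (R : realType) (d m q : nat) (alpha : R) : (3 <= d)%N -> (1 < m)%N -> (m <= q)%N ->
  0 < alpha < 1 ->
  (ln (2 / alpha) * constK R) `^ (2 / (d%:R - 2)) < m%:R ->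
  m%:R * 2 * expR (- ((q ^ d)%:R * (400 / m%:R) ^+ 2 / 8)) < alpha.
Proof.
move=> d3 m1 mq /andP[a0 a1] hz.
have m0 : 0 < m%:R :> R by rewrite ltr0n (ltn_trans _ m1).
have la : 0 < ln (2 / alpha).
  by rewrite ln_gt0 // ltr_pdivlMr // mul1r; lra.
pose z := ln (2 / alpha) * constK R.
have K1 := constK_ge1 R.
have lz : ln (2 / alpha) <= z by rewrite /z -[leLHS]mulr1 ler_wpM2l // ltW.
have z0 : 0 <= z by rewrite mulr_ge0 ?(ltW la) // (le_trans _ K1).
(* In fact z >= 16, by the summand 16 / ln 2 of [constK] and alpha < 1. This makes z^2 >= z. *)
have z1 : 1 <= z.
  have l2 : 0 < ln 2 :> R by rewrite ln_gt0 // ltr1n.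
  have la2 : ln 2 <= ln (2 / alpha).
    rewrite ler_ln ?posrE ?divr_gt0 // ler_pdivlMr // ler_piMr //; exact: ltW.
  have k2 : 16 / ln 2 <= constK R.
    rewrite /constK lerDr; apply: divr_ge0; [exact: ler0n|apply: ln_ge0; lra].
  have : ln 2 * (16 / ln 2) <= z by apply: ler_pM => //; rewrite ?ltW // divr_gt0.
  by rewrite mulrCA divff ?gt_eqF // mulr1; lra.
pose y : R := (m ^ (d - 2))%:R.
have zy : z <= y.
  have d2 : (d - 2)%N%:R = d%:R - 2 :> R by rewrite natrB // (ltn_trans _ d3).
  have d20 : 0 < d%:R - 2 :> R by rewrite -d2 ltr0n subn_gt0.
  have e : (z `^ (2 / (d%:R - 2))) ^+ (d - 2) = z ^+ 2.
    rewrite -powR_mulrn ?powR_ge0 // -powRrM d2 divfK ?gt_eqF //.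
    by rewrite -(@powR_mulrn _ z 2).
  apply: (@le_trans _ _ (z ^+ 2)); first by rewrite expr2 ler_peMr.
  by rewrite -e /y natrX lerXn2r ?nnegrE ?powR_ge0 // ltW.
have my : m%:R <= y.
  rewrite /y ler_nat -{1}(expn1 m) leq_exp2l // subn_gt0 //.
have y0 : 0 < y by exact: lt_le_trans my.
have expo : 2 * y <= (q ^ d)%:R * (400 / m%:R) ^+ 2 / 8.
  have h : (m ^ d)%:R <= (q ^ d)%:R :> R by rewrite ler_nat leq_exp2r // (ltn_trans _ d3).
  apply: (@le_trans _ _ ((m ^ d)%:R * (400 / m%:R) ^+ 2 / 8)).
    rewrite -[in leRHS](subnK (ltnW d3)) expnD natrM -/y natrX.
    rewrite (_ : _ / 8 = y * (400 * 50)); last by field; rewrite gt_eqF.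
    by rewrite mulrC ler_pM2l //; lra.
  have w0 : 0 <= (400 / m%:R) ^+ 2 :> R by exact: sqr_ge0.
  by apply: ler_wpM2r; [rewrite invr_ge0; lra|exact: ler_wpM2r].
apply: (@le_lt_trans _ _ (2 * (y * expR (- (2 * y))))).
  have assoc (w : R) : m%:R * 2 * w = 2 * (m%:R * w) by ring.
  rewrite assoc ler_pM2l //.
  by apply: ler_pM; rewrite ?expR_ge0 ?(ltW m0) // ler_expR lerN2.
have ey : y < expR y by apply: lt_le_trans (expR_ge1Dx y); rewrite ltrDr.
apply: (@lt_le_trans _ _ (2 * (expR y * expR (- (2 * y))))).
  by rewrite ltr_pM2l // ltr_pM2r // expR_gt0.
rewrite -expRD; apply: (@le_trans _ _ (2 * expR (- ln (2 / alpha)))).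
  by rewrite ler_pM2l // ler_expR; lra.
by rewrite expRN lnK ?posrE ?divr_gt0 // invf_div mulrCA divff // mulr1.
Qed.

(** * Choice of the scale and assembly of the uniform bound *)

Lemma sqrt_floor (L : nat) : exists m, (m * m <= L < m.+1 * m.+1)%N.
Proof.
elim: L => [|L [m /andP[h1 h2]]]; first by exists 0%N.
have [h|h] := ltnP L.+1 (m.+1 * m.+1); first by exists m; rewrite h (leq_trans h1).
by exists m.+1; rewrite h; move: h2; clear; lia.
Qed.

(** Restricting to rational energies turns the event into a countable union. At a rational point
    slightly to the right of [E], monotonicity squeezes both functions between their values at [E]
    and at [E1], and right continuity makes these close. *)
Lemma sup_norm_gt_rat (R : realType) (F G : R -> R) (b : R) :
  (forall E E', E <= E' -> F E <= F E') -> (forall E E', E <= E' -> G E <= G E') ->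
  (forall E, F (E + n.+1%:R^-1) @[n --> \oo] --> F E) ->
  (forall E, G (E + n.+1%:R^-1) @[n --> \oo] --> G E) ->
  (b%:E < sup_norm (fun E => F E - G E)%R)%E <-> exists x : rat, b < `|F (ratr x) - G (ratr x)|.
Proof.
move=> Fm Gm Fc Gc; split; last first.
  move=> [x bx]; apply: (@lt_le_trans _ _ `|F (ratr x) - G (ratr x)|%:E); first by rewrite lte_fin.
  by apply: ereal_sup_ubound; exists (ratr x).
move=> /ereal_sup_gt[_ [E _ <-]]; rewrite lte_fin => bE.
pose e := `|F E - G E| - b; have e0 : 0 < e by rewrite subr_gt0.
have [n1 _ hF] := (cvgrPdist_lt _ _).1 (@Fc E) _ e0.
have [n2 _ hG] := (cvgrPdist_lt _ _).1 (@Gc E) _ e0.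
pose n := maxn n1 n2; pose E1 : R := E + n.+1%:R^-1.
have hFn : F E1 < F E + e.
  have := hF n (leq_maxl _ _); rewrite /= distrC ltr_distl => /andP[_]; rewrite -/E1; lra.
have hGn : G E1 < G E + e.
  have := hG n (leq_maxr _ _); rewrite /= distrC ltr_distl => /andP[_]; rewrite -/E1; lra.
have EE1 : E < E1 by rewrite ltrDl.
have [x] := rat_in_itvoo EE1; rewrite in_itv /= => /andP[x1 x2].
exists x; have f1 := Fm _ _ (ltW x1); have f2 := Fm _ _ (ltW x2).
have g1 := Gm _ _ (ltW x1); have g2 := Gm _ _ (ltW x2).
move: e0 hFn hGn f1 f2 g1 g2; rewrite /e.
move: (F E) (G E) (F E1) (G E1) (F (ratr x)) (G (ratr x)) => FE GE FE1 GE1 Fx Gx.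
move=> e0 a1 a2 a3 a4 a5 a6.
have [h|h] := leP 0 (FE - GE).
  rewrite (ger0_norm h) in e0 a1 a2; apply: lt_le_trans (ler_norm _).
  by lra.
rewrite (ltr0_norm h) in e0 a1 a2; apply: lt_le_trans (_ : - (Fx - Gx) <= _).
  by lra.
by rewrite -normrN ler_norm.
Qed.

Section UniformBound.
Variables (R : realType) (d L m : nat).
Hypotheses (m1 : (1 < m)%N) (mL : (m * m <= L)%N).
Local Notation q := (L %/ m)%N.
Local Notation a := (\row_i - (L./2)%:Z : Zd d).

Lemma N_countingE om E : N_counting om L E = (neig om (box a L) E)%:R / (L ^ d)%:R :> R.
Proof. by rewrite /N_counting cube_box card_box. Qed.

(** The boxes fill q (m - 1) of the side [L]: the walls waste about L/m, and the remainder of the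
    division is less than m, which is at most L/m since m^2 <= L. Each coordinate thus loses at most
    2/m. *)
Lemma counting_deviation om E :
  `|N_counting om L E - grid_average a m q om E| <= 2 * d%:R / m%:R :> R.
Proof.
have m0 : (0 < m)%N by exact: ltn_trans m1.
have L0 : (0 < L)%N by apply: leq_trans mL; rewrite muln_gt0 m0.
have lm : (m.-1 < m)%N by case: m m1.
have l0 : (0 < m.-1)%N by case: m m1 => [|[]].
have q0 : (0 < q)%N by rewrite divn_gt0 // (leq_trans _ mL) // leq_pmulr.
have qL : (q * m <= L)%N by exact: leq_divM.
rewrite N_countingE; apply: le_trans (neig_grid_average om a E lm qL l0 q0) _.
have mR : 0 < m%:R :> R by rewrite ltr0n.
have LR : 0 < L%:R :> R by rewrite ltr0n.
rewrite !natrX -expr_div_n; set t : R := (q * m.-1)%N%:R / L%:R.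
have t0 : 0 <= t by rewrite divr_ge0.
have t2 : 1 - 2 / m%:R <= t.
  have key : (m * L <= m * (q * m.-1) + 2 * L)%N.
    have gen (p k n : nat) : (p.+1 * p.+1 <= n)%N -> (n < k.+1 * p.+1)%N ->
        (p.+1 * n <= p.+1 * (k * p) + 2 * n)%N.
      by move=> h1 h2; have h3 := leq_mul h2 (leqnn p); nia.
    by have := gen m.-1 q L; rewrite (prednK m0); apply=> //; exact: ltn_ceil.
  rewrite -(ler_nat R) natrD !natrM in key.
  rewrite /t ler_pdivlMr // -(ler_pM2l mR) natrM mulrA mulrBr mulr1 mulrCA divff ?gt_eqF //.
  by rewrite mulr1 mulrBl; lra.
have := @bernoulli_ge R (t - 1) d; rewrite lerBrDr addNr => /(_ t0).
rewrite (addrC 1 (t - 1)) subrK => h.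
have h2 : d%:R * (1 - t) <= 2 * d%:R / m%:R.
  rewrite [2 * _]mulrC -mulrA ler_wpM2l //; lra.
by move: h h2; lra.
Qed.

End UniformBound.

Section TailBound.
Variables (R : realType) (d L m : nat).
Local Notation Om := (config R d).
Variables (mu : probability (measurableTypeR R) R) (P : probability Om R) (F : R -> R).
Hypotheses (hP : product_law mu P) (bmu : boundedly_supported mu) (hF : is_IDS P F).
Hypotheses (m1 : (1 < m)%N) (mL : (m * m <= L)%N).
Variable beta : R.
Hypothesis hbeta : constC R d / m%:R < beta.
Hypotheses (d3 : (3 <= d)%N) (m200 : (200 <= m)%N).
Local Notation q := (L %/ m)%N.

Lemma deviation_tail :
  (P [set om : Om | (beta%:E < sup_norm (fun E => N_counting om L E - F E)%R)%E]
   <= (m%:R * 2 * expR (- ((q ^ d)%:R * (400 / m%:R) ^+ 2 / 8)))%:E)%E.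
Proof.
have [M M0 PM] := probability_bounded_configs hP bmu.
have [Q HQ FE] := hF.
have m0 : (0 < m)%N by exact: ltn_trans m1.
have q0 : (0 < q)%N by rewrite divn_gt0 // (leq_trans _ mL) // leq_pmulr.
have mR : 0 < m%:R :> R by rewrite ltr0n.
pose a : Zd d := \row_i - (L./2)%:Z.
(* An enumeration of the rational energies, with default 0 at integers that code no rational. *)
pose x i : R := if (choice.unpickle i : option rat) is Some y then ratr y else 0.
pose B i := [set om : Om | beta < `|N_counting om L (x i) - F (x i)|].
have mN E : measurable_fun setT (fun om : Om => N_counting om L E : R).
  rewrite (_ : (fun om : Om => _) = fun om : Om => (neig om (box a L) E)%:R / (L ^ d)%:R).
    by apply: measurable_funM; [exact: measurable_neig|exact: measurable_cst].
  by apply/funext => om; exact: N_countingE.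
have mB i : measurable (B i).
  apply: measurable_gt; apply: measurableT_comp => //.
  by apply: measurable_funB; [exact: mN|exact: measurable_cst].
rewrite (_ : [set om | _] = \bigcup_i B i); last first.
  apply/seteqP; split=> om.
    move=> /= /sup_norm_gt_rat[].
    - move=> E E' EE'; rewrite !N_countingE ler_wpM2r ?invr_ge0 // ler_nat.
      exact: neig_mono.
    - exact: (ids_mono M0 PM HQ FE).
    - move=> E; rewrite N_countingE; under eq_fun do rewrite N_countingE.
      by apply: cvgM; [exact: neig_right_cvg|exact: cvg_cst].
    - exact: (ids_right_cvg M0 PM HQ FE).
    - move=> y hy; exists (choice.pickle y); first exact: I.
      have e : x (choice.pickle y) = ratr y by rewrite /x choice.pickleK.
      by change (beta < `|N_counting om L (x (choice.pickle y)) - F (x (choice.pickle y))|); rewrite e.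
  move=> [i _ hi] /=; apply: (lt_le_trans (y := `|N_counting om L (x i) - F (x i)|%:E)).
    by rewrite lte_fin.
  by apply: ereal_sup_ubound; exists (x i).
apply: probability_bigcup_le => // n.
(* [e] is both the spacing of the levels and the deviation allowed at a representative, so 2e is the
   800/m of the budget. The condition m >= 200 gives e <= 2, as Chernoff's bound demands. *)
pose e : R := 400 / m%:R.
have he : 0 < e <= 2.
  have h200 : 200 <= m%:R :> R by rewrite ler_nat.
  apply/andP; split; first by apply: divr_gt0; [lra|exact: mR].
  by rewrite (ler_pdivrMr _ _ mR); lra.
have me : 1 < m%:R * e by rewrite /e mulrCA divff ?gt_eqF // mulr1; lra.
apply: le_trans (prob_finite_deviation hP PM a m1 q0 x n he me).
have mC i : measurable [set om : Om |
    (2 * e < `|grid_average a m q om (x i) - mean_density P M m.-1 (x i)|)%R].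
  apply: measurable_gt; apply: measurableT_comp => //.
  by apply: measurable_funB; [exact: measurable_grid_average|exact: measurable_cst].
apply: le_measure; rewrite ?inE.
- by apply: bigsetU_measurable => i _.
- by apply: bigsetU_measurable => i _; exact: mC.
rewrite -(bigcup_mkord n B).
rewrite -(bigcup_mkord n (fun i => [set om : Om |
    (2 * e < `|grid_average a m q om (x i) - mean_density P M m.-1 (x i)|)%R])).
move=> om [i /= ni hi]; exists i => //=.
have h1 := counting_deviation m1 mL om (x i).
have h2 := ids_mean_density hP M0 PM HQ FE (x i) m1.
(* Of the three terms d/m, two come from [counting_deviation] and one from [ids_mean_density]. *)
have h3 : 2 * e + 3 * (d%:R / m%:R) <= constC R d / m%:R.
  rewrite (_ : _ + _ = (800 + 3 * d%:R) / m%:R); last by rewrite /e; ring.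
  by rewrite ler_wpM2r ?invr_ge0 ?(ltW mR) // constC_ge.
move: hi h1 h2 h3 hbeta; rewrite /B /= -/a.
rewrite (_ : 2 * d%:R / m%:R = 2 * (d%:R / m%:R)); last by rewrite mulrA.
move: (d%:R / m%:R) (constC R d / m%:R) (2 * e) => dm Cm e2.
move: (N_counting _ _ _) (F _) (grid_average _ _ _ _ _) (mean_density _ _ _ _) => N1 F1 A1 f1.
move=> h0 h1 h2 h3 h4.
have t1 : `|N1 - F1| <= `|N1 - A1| + (`|A1 - f1| + `|f1 - F1|).
  by rewrite (le_trans (ler_distD A1 _ _)) // lerD2l ler_distD.
rewrite distrC in h2; lra.
Qed.

End TailBound.

Theorem theorem1p1 (R : realType) (d : nat) (alpha beta : R) :
  (3 <= d)%N -> 0 < alpha < 1 -> 0 < beta < 1 ->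
  constK R < 1207 /\
  forall L : nat,
    Num.max (Num.max ((constC R d / beta + 1) ^+ 2)
                     (((ln (2 / alpha) * constK R) `^ (2 / (d%:R - 2)) + 1) ^+ 2))
            16 < L%:R ->
    (ereal_sup
       [set p | exists (mu : probability (measurableTypeR R) R)
                       (P : probability (config R d) R) (N : R -> R),
          [/\ boundedly_supported mu, product_law mu P, is_IDS P N &
              p = P [set om : config R d |
                       (beta%:E < sup_norm (fun E => N_counting om L E - N E)%R)%E]]]
     < alpha%:E)%E.
Proof.
move=> d3 ha hb; split; first exact: constK_lt.
move=> L; rewrite !gt_max => /andP[/andP[hC hK] _].
have [b0 b1] := andP hb.
have [m /andP[mL Lm]] := sqrt_floor L.
(* The origin of the [+ 1] and of the squares in the hypothesis on [L]: (x + 1)^2 < L < (m + 1)^2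
   gives x < m. *)
have lt_m (x : R) : 0 <= x -> (x + 1) ^+ 2 < L%:R -> x < m%:R.
  move=> x0 hx; rewrite -(ltrD2r 1) natr1 -(@ltr_pXn2r _ 2) ?nnegrE ?addr_ge0 //.
  by apply: lt_trans hx _; rewrite -natrX ltr_nat -mulnn.
have C0 := constC_ge R d3.
have C1 : 200 <= constC R d by have := ler0n R d; lra.
(* As beta < 1, the bound m > constC / beta alone already makes [m] larger than 200. *)
have Cb : constC R d <= constC R d / beta by rewrite ler_pdivlMr // ler_piMr //; lra.
have Cm : constC R d / beta < m%:R by apply: lt_m => //; lra.
have m200 : (200 <= m)%N by rewrite -(ler_nat R); lra.
have m1 : (1 < m)%N by exact: leq_trans m200.
have m0 : 0 < m%:R :> R by rewrite ltr0n (ltn_trans _ m1).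
have hbeta : constC R d / m%:R < beta by rewrite ltr_pdivrMr // mulrC -ltr_pdivrMr.
have mq : (m <= L %/ m)%N by rewrite leq_divRL // (ltn_trans _ m1).
apply: (@le_lt_trans _ _ (m%:R * 2 * expR (- (((L %/ m) ^ d)%:R * (400 / m%:R) ^+ 2 / 8)))%:E).
  apply: ge_ereal_sup => _ [mu [P [N [bmu hP hN ->]]]].
  exact: (deviation_tail hP bmu hN).
rewrite lte_fin; apply: tail_bound_lt => //.
by apply: lt_m => //; exact: powR_ge0.
Qed.
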